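(* Let $\alpha=(\alpha_1,\alpha_2)$ be such that $1,\alpha_1,\alpha_2$ are linearly independent over $\mathbb Q$, and let $f:\mathbb T^2\to\mathbb T^2$, $f(\theta)=\theta+\alpha$. Let $\phi:\mathbb T^2\to\mathbb R$ be piecewise Hölder, and suppose that the Lyapunov exponent $L(E)$ is continuous in $E\in\mathbb R$ and $L(E)>0$ for every $E\in\mathbb R$. If $\alpha\in\bigcup_{\tau>1}WDC(\tau)$, then $\beta^-_\theta(p)=0$ for all $\theta\in\mathbb T^2$ and all $p>0$.
   Context: $\mathbb T^2=\mathbb R^2/\mathbb Z^2$ with the flat metric $\mathrm{dist}$ and Lebesgue measure $m$; $\|x\|_{\mathbb R/\mathbb Z}$ is the distance from $x$ to the nearest integer. Weak Diophantine condition: $(\alpha_1,\alpha_2)\in WDC(\tau)$ if there is $c>0$ with $\max\{\|h\alpha_1\|_{\mathbb R/\mathbb Z},\|h\alpha_2\|_{\mathbb R/\mathbb Z}\}\ge c|h|^{-\tau}$ for all $h\in\mathbb Z\setminus\{0\}$. Piecewise Hölder: for $\gamma>0$, $L_\gamma(\mathbb T^2)$ is the space of functions with $\|\phi\|_\infty+\sup_{\theta_1\ne\theta_2}\frac{|\phi(\theta_1)-\phi(\theta_2)|}{\mathrm{dist}(\theta_1,\theta_2)^\gamma}<\infty$. $\phi$ is piecewise Hölder if there are $\gamma>0$, $K\in\mathbb N$, $\phi_1,\dots,\phi_K\in L_\gamma(\mathbb T^2)$ and sets $S_1,\dots,S_K\subset\mathbb T^2$ whose boundaries $\partial S_j$ are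 smooth $1$-dimensional submanifolds of finite length, such that $\phi=\sum_{j=1}^K\chi_{S_j}\phi_j$. Operator: $H_\theta$ acts on $\ell^2(\mathbb Z)$ by $(H_\theta u)(n)=u(n+1)+u(n-1)+\phi(f^n\theta)u(n)$. Lyapunov exponent: $A(\theta,z)=\begin{pmatrix}z-\phi(\theta)&-1\\1&0\end{pmatrix}$, $A_k(\theta,z)=A(f^{k-1}\theta,z)\cdots A(\theta,z)$ for $k\ge1$, and $L(z)=\lim_{k\to\infty}\frac1k\int_{\mathbb T^2}\ln\|A_k(\theta,z)\|\,dm(\theta)$. Transport exponent: $a_\theta(n,t)=|\langle e^{-itH_\theta}\delta_0,\delta_n\rangle|^2$, $\langle|X|^p_\theta(t)\rangle=\sum_{n\in\mathbb Z}(1+|n|)^pa_\theta(n,t)$, $\beta^-_\theta(p)=\liminf_{t\to\infty}\frac{\ln\langle|X|^p_\theta(t)\rangle}{p\ln t}$. *)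

(* Defs.v *)
From HB Require Import structures.
From mathcomp Require Import all_boot all_order all_algebra.
From mathcomp Require Import all_classical all_reals all_analysis.
From mathcomp Require Import complex.

Set Implicit Arguments.
Unset Strict Implicit.
Unset Printing Implicit Defensive.

Import Order.TTheory GRing.Theory Num.Theory.
Import numFieldNormedType.Exports.

Local Open Scope classical_set_scope.
Local Open Scope ring_scope.
Local Open Scope quotient_scope.

Definition Z2 (R : realType) : {pred R * R} :=
  fun x => (x.1 \is a Num.int) && (x.2 \is a Num.int).

Lemma Z2_zmod_closed (R : realType) : zmod_closed (@Z2 R).
Proof.
split=> [|[x1 x2] [y1 y2]]; first by rewrite unfold_in /= !rpred0.
rewrite !unfold_in /= => /andP[? ?] /andP[? ?]; apply/andP; split; exact: rpredB.
Qed.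

HB.instance Definition _ (R : realType) :=
  GRing.isZmodClosed.Build (R * R)%type (@Z2 R) (@Z2_zmod_closed R).

Definition torus (R : realType) : Type :=
  Quotient.quot (@Z2 R : zmodClosed (R * R)%type).
HB.instance Definition _ (R : realType) := GRing.Zmodule.on (torus R).
HB.instance Definition _ (R : realType) := Quotient.on (torus R).

Definition toT (R : realType) (x : R * R) : torus R := \pi x.

Section QuotientTopology.
Context {R : realType}.

Definition torus_open (U : set (torus R)) : Prop := open (@toT R @^-1` U).

Lemma torus_openT : torus_open setT.
Proof. by rewrite /torus_open preimage_setT; exact: openT. Qed.

Lemma torus_openI : setI_closed torus_open.
Proof. by move=> U V oU oV; exact: openI. Qed.

Lemma torus_open_bigU (I : Type) (F : I -> set (torus R)) :
  (forall i, torus_open (F i)) -> torus_open (\bigcup_i F i).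
Proof. by move=> oF; apply: bigcup_open => i _; exact: oF. Qed.

HB.instance Definition _ :=
  isOpenTopological.Build (torus R) torus_openT torus_openI torus_open_bigU.

End QuotientTopology.

Section Torus.
Context {R : realType}.
Local Notation T2 := (torus R).

Definition dist (s t : T2) : R :=
  inf [set Num.sqrt ((x.1 - y.1) ^+ 2 + (x.2 - y.2) ^+ 2)
      | x in [set x | toT x = s] & y in [set y | toT y = t]].

(* The integral against Lebesgue measure m, taken over the fundamental domain
   [0,1)^2.  The library's integral of a nonnegative function that is not Borel
   measurable is the supremum over the simple Borel functions below it, which
   for Lebesgue measurable functions is still the Lebesgue integral. *)
Definition torus_integral (g : T2 -> R) : R :=
  \int[(lebesgue_measure \x lebesgue_measure)%E]_(x in
     (`[0, 1[ `*` `[0, 1[ : set (measurableTypeR R * measurableTypeR R)))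
     g (toT x).

Definition boundary (S : set T2) : set T2 := closure S `\` interior S.

Definition smooth (g : R -> R) : Prop :=
  forall (n : nat) (t : R), derivable (derive1n n g) t 1.

(* Embedded, without boundary: around each point, C is the homeomorphic image of
   R under a regular smooth curve.  An open parameter interval would give the
   same notion, being diffeomorphic to R.  The last clause says that the
   parametrization is open onto its image and, for V = setT, that this image is
   a neighbourhood of p in C; its continuity follows from smoothness. *)
Definition smooth_1submanifold (C : set T2) : Prop :=
  forall p, C p ->
  exists g1 g2 : R -> R,
    let g t := toT (g1 t, g2 t) in
    [/\ smooth g1 /\ smooth g2,
        forall t, (derive1 g1 t, derive1 g2 t) <> (0, 0),
        (exists t, g t = p) /\ injective g
      & forall V : set R, open V ->
          exists W : set T2, open W /\ g @` V = C `&` W].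

(* [dist] is bounded on the torus, so this supremum is a genuine one. *)
Definition diam (A : set T2) : R := sup [set dist s t | s in A & t in A].

(* Length of a subset of the torus: its one-dimensional Hausdorff measure *)
Definition hausdorff1 (A : set T2) : \bar R :=
  ereal_sup
    [set ereal_inf
       [set (\sum_(0 <= i <oo) (diam (F i))%:E)%E
       | F in [set F : nat -> set T2 |
                 A `<=` \bigcup_i F i /\ forall i, diam (F i) <= d]]
    | d in [set d : R | 0 < d]].

Definition holder_norm (gamma : R) (psi : T2 -> R) : \bar R :=
  (ereal_sup [set (`|psi s|)%:E | s in setT]
   + ereal_sup [set (`|psi st.1 - psi st.2| / dist st.1 st.2 `^ gamma)%:E
               | st in [set st : T2 * T2 | st.1 <> st.2]])%E.

Definition piecewise_holder (phi : T2 -> R) : Prop :=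
  exists (gamma : R) (K : nat) (psi : 'I_K -> T2 -> R) (S : 'I_K -> set T2),
    [/\ 0 < gamma,
        forall j, (holder_norm gamma (psi j) < +oo)%E,
        forall j, smooth_1submanifold (boundary (S j)) /\
                  (hausdorff1 (boundary (S j)) < +oo)%E
      & forall s, phi s = \sum_(j < K) \1_(S j) s * psi j s].

Definition rot (alpha : R * R) (s : T2) : T2 := s + toT alpha.
Definition rotz (alpha : R * R) (n : int) (s : T2) : T2 := s + toT alpha *~ n.

Lemma rotz_iter (alpha : R * R) (k : nat) (s : T2) :
  rotz alpha k%:Z s = iter k (rot alpha) s.
Proof.
elim: k => [|k IH]; first by rewrite /rotz mulr0z addr0.
by rewrite iterS -IH /rot /rotz -addrA intS mulrzDr mulr1z [toT _ + _]addrC.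
Qed.

Lemma rotzNK (alpha : R * R) (n : int) :
  cancel (rotz alpha n) (rotz alpha (- n)).
Proof. by move=> s; rewrite /rotz mulrNz addrK. Qed.

End Torus.

Section Arithmetic.
Context {R : realType}.

Definition dist_int (x : R) : R := inf [set `|x - n%:~R| | n in [set: int]].

Definition WDC (tau : R) : set (R * R) :=
  [set alpha | exists2 c : R, 0 < c &
     forall h : int, h != 0 ->
       c * `|h%:~R| `^ (- tau)
         <= Num.max (dist_int (h%:~R * alpha.1)) (dist_int (h%:~R * alpha.2))].

Definition rationally_independent (alpha : R * R) : Prop :=
  forall a b c : rat, ratr a + ratr b * alpha.1 + ratr c * alpha.2 = 0 ->
    [/\ a = 0, b = 0 & c = 0].

End Arithmetic.

Section Lyapunov.
Context {R : realType}.
Local Notation T2 := (torus R).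
Local Notation C := R[i].
Variables (alpha : R * R) (phi : T2 -> R).

Definition enorm (v : 'cV[C]_2) : R :=
  Num.sqrt (\sum_(i < 2) Normc.normc (v i 0) ^+ 2).

Definition opnorm (M : 'M[C]_2) : R :=
  sup [set enorm (M *m v) | v in [set v | enorm v <= 1]].

Definition transfer (z : C) (s : T2) : 'M[C]_2 :=
  \matrix_(i < 2, j < 2)
    nth 0 (nth [::] [:: [:: z - (phi s)%:C%C; -1]; [:: 1; 0]] i) j.

Fixpoint transfer_iter (z : C) (k : nat) (s : T2) : 'M[C]_2 :=
  if k is k'.+1
  then transfer z (iter k' (rot alpha) s) *m transfer_iter z k' s
  else 1%:M.

Definition lyapunov (z : C) : R :=
  limn (fun k : nat =>
    k%:R^-1 * torus_integral (fun s => ln (opnorm (transfer_iter z k s)))).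

End Lyapunov.

Section Transport.
Context {R : realType}.
Local Notation T2 := (torus R).
Local Notation C := R[i].

Definition l2norm (u : int -> C) : \bar R :=
  sqrte (\esum_(n in [set: int]) (Normc.normc (u n) ^+ 2)%:E).

(* <u, v>, linear in u; the series is absolutely convergent on l^2(Z). *)
Definition l2inner (u v : int -> C) : C :=
  limn (fun N : nat =>
    \sum_(k < (2 * N).+1) u (k%:Z - N%:Z) * (v (k%:Z - N%:Z))^*%C : C^o).

Definition delta (k n : int) : C := (n == k)%:R.

(* e^A u for a bounded operator A on l^2(Z): the l^2-limit of the exponential
   series (with the junk value 0 if there is none). *)
Definition l2exp (A : (int -> C) -> int -> C) (u : int -> C) : int -> C :=
  xget (fun=> 0) [set v | (l2norm v < +oo)%E /\
    (fun N : nat =>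
       l2norm (fun n => \sum_(0 <= k < N) (k`!)%:R^-1 * iter k A u n - v n))
      @ \oo --> 0%E].

Variables (alpha : R * R) (phi : T2 -> R) (theta : T2).

(* As phi is bounded in all uses, this operator is bounded on l^2(Z). *)
Definition schrodinger (u : int -> C) (n : int) : C :=
  u (n + 1) + u (n - 1) + (phi (rotz alpha n theta))%:C%C * u n.

Definition evolution (t : R) : (int -> C) -> int -> C :=
  l2exp (fun u n => - 'i%C * t%:C%C * schrodinger u n).

Definition amplitude (n : int) (t : R) : R :=
  Normc.normc (l2inner (evolution t (delta 0)) (delta n)) ^+ 2.

Definition moment (p t : R) : \bar R :=
  \esum_(n in [set: int]) ((1 + `|n%:~R|) `^ p * amplitude n t)%:E.

Definition beta_lower (p : R) : \bar R :=
  limf_einf (fun t : R => lne (moment p t) * ((p * ln t)^-1)%:E)%E (+oo_R).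

End Transport.

(* Main.v *)
From HB Require Import structures.
Require Import Defs.
From mathcomp Require Import all_boot all_order all_algebra.
From mathcomp Require Import all_classical all_reals all_analysis.
From mathcomp Require Import measurable_realfun complex.
From mathcomp Require Import ring lra zify.

Set Implicit Arguments.
Unset Strict Implicit.
Unset Printing Implicit Defensive.

Import Order.TTheory GRing.Theory Num.Theory.
Import numFieldNormedType.Exports.

Local Open Scope classical_set_scope.
Local Open Scope ring_scope.

(** The wave packet at time [t] is controlled by resolvents at energies at height
[1/t] above the real axis, and resolvents by the growth of solutions of the
eigenvalue equation. Suppose that at some scale [q], on both half lines and for
all these energies, a solution with bounded initial data reaches the size
[q ^ A], with [A] as large as desired, within a distance [q ^ e] with a fixed
exponent [e]. Then at time [t = q ^ B] the wave packet is still essentially within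
distance [q ^ e] of the origin, and its moment of order [p] is bounded by a power
of [q] that does not depend on [B]. As [B] is arbitrary, the lower transport
exponent vanishes ([beta_zero]). The passage from resolvents to [exp (-itH)] is
explicit: [exp (-itx)] is approximated by [K] backward Euler steps, whose product
a discrete Cauchy formula turns into a short combination of resolvents
([resolvent_approx]). Solutions bound the resolvent kernel through the flux
identity and the constancy of the Wronskian ([half_green]).

It remains to find such scales [q]. Far above the real axis, or far from the
spectrum, solutions grow exponentially for elementary reasons ([upper_growth],
[far_growth]). Near a real energy [E] in a compact window the reason is the
positivity of the Lyapunov exponent [L]. As the potential is continuous outside
finitely many curves of finite length, [ln] of the norm of a transfer matrix over
a block is upper Riemann integrable, so that equidistribution of the orbits
bounds its Birkhoff sums from above uniformly in the phase; subadditivity then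
gives growth at rate at most [L(E) + eps] for all phases, and, as [L] is
continuous, uniformly for energies near the window ([lognorm_unif]). On the other
hand the mean growth rate over the torus is at least [L(E)], while the points whose
orbit of length [k] comes [1/q]-close to a discontinuity have area [O(k/q)].
Hence, for [k] of order [ln q], some phase grows at rate at least [L(E) - eps] and
is not close to the discontinuities ([good_point]). By Hoelder continuity and the
upper bound on all shorter blocks, this lower bound persists on the square of
side [1/q] around this phase and for energies within a power of [1/q] of [E]
([block_growth]).

Finally every orbit has to visit this square within a time polynomial in [q]
([hitting]). Linear independence of [1, alpha_1, alpha_2] over the rationals makes
three consecutive best approximation vectors independent infinitely often; they
then form a basis in which every target can be rounded, and the Diophantine
condition bounds the largest of them by a power of the scale. A large block
transfer matrix near the visited phase forces a solution to be large at one of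
the ends of the block ([growth_block]), which is the growth asked for. *)

(** * Hitting times of the rotation *)

Section Hitting.
Context {R : realType}.
Implicit Types (x y : R) (al : R * R).

Definition nint x : int := Num.floor (x + 2^-1).
Definition ferr x : R := x - (nint x)%:~R.

Lemma ferr_min x (m : int) : `|ferr x| <= `|x - m%:~R|.
Proof.
rewrite /ferr /nint; have := floor_itv (x + 2^-1).
set f := Num.floor _ => /andP[h1 h2]; rewrite intrD in h2.
have [->//|] := eqVneq m f; rewrite neq_lt => /orP[] h.
  have hm : m%:~R <= f%:~R - 1 :> R by rewrite lerBrDr -(intrD R m 1) ler_int; lia.
  rewrite [X in _ <= X]ger0_norm; last by lra.
  by rewrite ler_norml; apply/andP; split; lra.
have hm : f%:~R + 1 <= m%:~R :> R by rewrite -(intrD R f 1) ler_int; lia.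
rewrite [X in _ <= X]ler0_norm; last by lra.
by rewrite ler_norml; apply/andP; split; lra.
Qed.

Definition ddist al (n : nat) : R :=
  Num.max `|ferr (n%:R * al.1)| `|ferr (n%:R * al.2)|.

Definition frac x : R := x - (Num.floor x)%:~R.

Lemma frac_itv x : 0 <= frac x < 1.
Proof.
rewrite /frac; have := floor_itv x; rewrite intrD => /andP[h1 h2].
by apply/andP; split; lra.
Qed.

(** Pigeonhole: [m ^ 2 + 1] multiples of [al] in [m ^ 2] cells of mesh [1/m]. *)
Lemma dirichlet al (m : nat) : (0 < m)%N ->
  exists n, [/\ (0 < n)%N, (n <= m ^ 2)%N & ddist al n < m%:R^-1].
Proof.
case: m => // m _; set M := m.+1.
have M0 : 0 < M%:R :> R by rewrite ltr0n.
pose box (a : R) (i : nat) : nat := Num.trunc (M%:R * frac (i%:R * a)).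
have boxlt a i : (box a i < M)%N.
  rewrite /box truncn_lt_nat ?mulr_ge0 ?ler0n//; last first.
    by case/andP: (frac_itv (i%:R * a)).
  by rewrite gtr_pMr//; case/andP: (frac_itv (i%:R * a)).
pose c (i : 'I_(M ^ 2).+1) : 'I_M * 'I_M :=
  (Ordinal (boxlt al.1 i), Ordinal (boxlt al.2 i)).
have [i [j [ij cij]]] : exists i j, i != j /\ c i = c j.
  apply/not_existsP => h.
  have /leq_card : injective c.
    move=> i j cij; apply/eqP/negPn/negP => ij; apply: (h i); by exists j.
  by rewrite card_prod !card_ord mulnn ltnn.
wlog ltij : i j ij cij / (i < j)%N.
  move=> H; case: (ltngtP i j) => [h|h|/val_inj h]; first exact: (H i j).
    by apply: (H j i) => //; rewrite eq_sym.
  by rewrite h eqxx in ij.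
exists (j - i)%N; split; first by rewrite subn_gt0.
  by rewrite (leq_trans (leq_subr _ _))// -ltnS.
have key a : box a i = box a j -> `|ferr ((j - i)%:R * a)| < M%:R^-1.
  move=> e.
  apply: le_lt_trans
    (ferr_min _ (Num.floor (j%:R * a) - Num.floor (i%:R * a))) _.
  rewrite natrB ?(ltnW ltij)// intrB mulrBl.
  have -> : j%:R * a - i%:R * a - ((Num.floor (j%:R * a))%:~R -
     (Num.floor (i%:R * a))%:~R) = frac (j%:R * a) - frac (i%:R * a).
    by rewrite /frac; ring.
  have bnd k : (box a k)%:R <= M%:R * frac (k%:R * a) < (box a k)%:R + 1.
    rewrite natr1 /box truncn_itv// mulr_ge0 ?ler0n//.
    by case/andP: (frac_itv (k%:R * a)).
  have := bnd i; have := bnd j; rewrite e => /andP[h1 h2] /andP[h3 h4].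
  rewrite -(ltr_pM2l M0) mulfV ?gt_eqF// -{1}(ger0_norm (ltW M0)) -normrM.
  by rewrite ltr_norml; apply/andP; split; lra.
have [e1 e2] : box al.1 i = box al.1 j /\ box al.2 i = box al.2 j.
  by case: cij.
by rewrite /ddist gt_max !key.
Qed.

(** Rounding the exponent up makes all later estimates polynomial. *)
Lemma WDC_ddist tau al : WDC tau al ->
  exists c : R, exists T : nat, 0 < c /\
    forall n, (0 < n)%N -> c * (n%:R ^+ T)^-1 <= ddist al n.
Proof.
move=> [c c0 H]; exists c, (Num.trunc `|tau|).+1; split=> // n n0.
have n1 : 1 <= n%:R :> R by rewrite ler1n.
have le_int x (m : int) : dist_int x <= `|x - m%:~R|.
  by apply: ge_inf; [exists 0 => _ [k _ <-]; exact: normr_ge0|exists m].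
have := H n%:Z; rewrite -[n%:Z == 0]/(n == 0)%N -lt0n => /(_ n0).
rewrite -[(n%:Z)%:~R]/(n%:R) => /le_trans; rewrite ger0_norm ?ler0n// => H1.
apply: le_trans (H1 (ddist al n) _); last first.
  by rewrite /ddist ge_max !le_max !le_int orbT.
rewrite ler_pM2l// -powR_mulrn ?ler0n// -powRN ler_powR// lerN2.
have /andP[_ h] := truncn_itv (normr_ge0 tau).
by rewrite (le_trans (ler_norm _))// ltW.
Qed.

Section Records.
Variables (al : R * R).
Hypothesis d_gt0 : forall n, (0 < n)%N -> 0 < ddist al n.
Local Notation d := (ddist al).

Lemma ddist_small (e : R) : 0 < e -> exists2 n, (0 < n)%N & d n < e.
Proof.
move=> e0; have [n [n0 _ h]] := @dirichlet al (Num.trunc e^-1).+1 isT.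
exists n => //; apply: lt_trans h _.
rewrite invf_plt ?posrE// ?ltr0n//.
have e1 : 0 <= e^-1 by rewrite invr_ge0 ltW.
by have /andP[] := truncn_itv e1.
Qed.

Lemma next_subproof n :
  exists n', (0 < n')%N && ((0 < n)%N ==> (d n' < d n)).
Proof.
case: (posnP n) => [->|n0]; first by exists 1%N.
by have [n' h1 h2] := ddist_small (d_gt0 n0); exists n'; rewrite h1 h2 implybT.
Qed.

(** The denominators of best simultaneous approximation. *)
Definition record k : nat := iter k (fun n => ex_minn (next_subproof n)) 1%N.

Lemma record_gt0 k : (0 < record k)%N.
Proof. by case: k => //= k; case: ex_minnP => m /andP[]. Qed.

Lemma ddist_record k : d (record k.+1) < d (record k).
Proof.
rewrite {1}/record iterS -/(record k).
by case: ex_minnP => m /andP[_]; rewrite record_gt0.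
Qed.

Lemma record_best k j : (0 < j)%N -> (j < record k.+1)%N -> d (record k) <= d j.
Proof.
move=> j0; rewrite {1}/record iterS -/(record k).
case: ex_minnP => m _ hm jm; rewrite leNgt; apply/negP => h.
by have := hm j; rewrite j0 h implybT leqNgt jm => /(_ isT).
Qed.

Lemma record_lt k : (record k < record k.+1)%N.
Proof.
rewrite ltnNge leq_eqVlt; apply/negP => /orP[/eqP h|h].
  by have := ddist_record k; rewrite h ltxx.
case: k h => [|k] h; first by have := record_gt0 1; rewrite leqNgt h.
have := record_best (record_gt0 _) h; rewrite leNgt => /negP; apply.
exact: lt_trans (ddist_record _) (ddist_record _).
Qed.

Lemma record_gt k : (k < record k)%N.
Proof. by elim: k => // k IH; apply: leq_ltn_trans IH (record_lt k). Qed.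

(** Dirichlet's theorem at resolution [m] yields a denominator that beats
[record k], and [record k.+1] is the first one that does. *)
Lemma record_le k m : (0 < m)%N -> m%:R^-1 <= d (record k) ->
  (record k.+1 <= m ^ 2)%N.
Proof.
move=> m0 h; have [n [n0 nm dn]] := dirichlet al m0.
apply: leq_trans nm; rewrite leqNgt; apply/negP => hn.
by have := record_best n0 hn; rewrite leNgt (lt_le_trans dn h).
Qed.

Lemma record_small m k : (0 < m)%N -> (m ^ 2 <= k)%N ->
  d (record k) < m%:R^-1.
Proof.
move=> m0 mk; have [n [n0 nm dn]] := dirichlet al m0.
apply: le_lt_trans dn; apply: record_best => //.
by apply: leq_ltn_trans nm (leq_ltn_trans mk _); apply: ltn_trans (record_gt _).
Qed.

(** [(rq k, rm1 k, rm2 k)] is the integer vector with first coordinate [record k]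
closest to the line spanned by [(1, al.1, al.2)]; [rdet k] is the determinant of
three consecutive such vectors, and [(nu0 k, nu1 k, nu2 k)] the cross product of
two. *)
Definition rq k : int := record k.
Definition rm1 k : int := nint ((record k)%:R * al.1).
Definition rm2 k : int := nint ((record k)%:R * al.2).

Definition rdet k : int :=
  rq k * (rm1 k.+1 * rm2 k.+2 - rm2 k.+1 * rm1 k.+2)
  - rm1 k * (rq k.+1 * rm2 k.+2 - rm2 k.+1 * rq k.+2)
  + rm2 k * (rq k.+1 * rm1 k.+2 - rm1 k.+1 * rq k.+2).

Definition nu0 k : int := rm1 k * rm2 k.+1 - rm2 k * rm1 k.+1.
Definition nu1 k : int := rm2 k * rq k.+1 - rq k * rm2 k.+1.
Definition nu2 k : int := rq k * rm1 k.+1 - rm1 k * rq k.+1.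

(** For parallel vectors the errors would grow in proportion to the denominators,
but they decrease. *)
Lemma nu_neq0 k : ~~ ((nu1 k == 0) && (nu2 k == 0)).
Proof.
apply/negP => /andP[/eqP h1 /eqP h2].
set q := (record k)%:R : R; set q' := (record k.+1)%:R : R.
have qq : q < q' by rewrite ltr_nat record_lt.
have q0 : 0 < q by rewrite ltr0n record_gt0.
have e1 : q * ferr (q' * al.1) = q' * ferr (q * al.1).
  have : q * (rm1 k.+1)%:~R = q' * (rm1 k)%:~R :> R.
    rewrite -[q]/((rq k)%:~R) -[q']/((rq k.+1)%:~R) -!intrM.
    by congr (_%:~R); move: h2; rewrite /nu2; lia.
  rewrite /ferr -/q' -/q !mulrBr -/(rm1 _) -/(rm1 _) => ->.
  by rewrite !mulrA [q * q']mulrC.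
have e2 : q * ferr (q' * al.2) = q' * ferr (q * al.2).
  have : q * (rm2 k.+1)%:~R = q' * (rm2 k)%:~R :> R.
    rewrite -[q]/((rq k)%:~R) -[q']/((rq k.+1)%:~R) -!intrM.
    by congr (_%:~R); move: h1; rewrite /nu1; lia.
  rewrite /ferr !mulrBr -/(rm2 _) -/(rm2 _) => ->.
  by rewrite !mulrA [q * q']mulrC.
have q'0 : 0 < q' by apply: lt_trans qq.
have : q * d (record k.+1) = q' * d (record k).
  rewrite /ddist -/q -/q' !maxr_pMr ?ltW// -{1 2}(gtr0_norm q0).
  by rewrite -!normrM e1 e2 !normrM (gtr0_norm q'0).
apply/eqP; rewrite lt_eqF//.
apply: (@lt_trans _ _ (q * d (record k))).
  by rewrite ltr_pM2l// ddist_record.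
by rewrite ltr_pM2r// d_gt0// record_gt0.
Qed.

Hypothesis indep : rationally_independent al.

(** If all late records stayed in one rational plane, its normal vector would
be a rational relation between 1, al.1 and al.2 in the limit. *)
Lemma rdet_neq0 k0 : exists2 k, (k0 <= k)%N & rdet k != 0.
Proof.
apply: contrapT => H.
have H0 k : (k0 <= k)%N -> rdet k = 0.
  by move=> hk; apply/eqP/negPn/negP => h; apply: H; exists k.
(* When [rdet l] vanishes, the component [S] of the third vector along the
   normal is annihilated by [nu1 l] and [nu2 l], which are not both zero. *)
have plane k : (k0 <= k)%N ->
    nu0 k0 * rq k + nu1 k0 * rm1 k + nu2 k0 * rm2 k = 0 /\
    nu0 k0 * rq k.+1 + nu1 k0 * rm1 k.+1 + nu2 k0 * rm2 k.+1 = 0.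
  move=> /subnK <-; elim: (k - k0)%N => [|j [IH1 IH2]].
    by rewrite add0n; split; rewrite /nu0 /nu1 /nu2; ring.
  rewrite addSn; set l := (j + k0)%N in IH1 IH2 *; split=> //.
  have D : rdet l = 0 by apply: H0; rewrite leq_addl.
  set S := (X in X = 0).
  have S1 : S * nu1 l = 0.
    transitivity (nu1 k0 * rdet l
      + (rm2 l.+2 * rq l.+1 - rq l.+2 * rm2 l.+1)
        * (nu0 k0 * rq l + nu1 k0 * rm1 l + nu2 k0 * rm2 l)
      + (rq l.+2 * rm2 l - rm2 l.+2 * rq l)
        * (nu0 k0 * rq l.+1 + nu1 k0 * rm1 l.+1 + nu2 k0 * rm2 l.+1)).
      by rewrite /S /rdet /(nu1 l); ring.
    by rewrite D IH1 IH2 !mulr0 !addr0.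
  have S2 : S * nu2 l = 0.
    transitivity (nu2 k0 * rdet l
      + (rq l.+2 * rm1 l.+1 - rm1 l.+2 * rq l.+1)
        * (nu0 k0 * rq l + nu1 k0 * rm1 l + nu2 k0 * rm2 l)
      + (rm1 l.+2 * rq l - rq l.+2 * rm1 l)
        * (nu0 k0 * rq l.+1 + nu1 k0 * rm1 l.+1 + nu2 k0 * rm2 l.+1)).
      by rewrite /S /rdet /(nu2 l); ring.
    by rewrite D IH1 IH2 !mulr0 !addr0.
  apply/eqP; have := nu_neq0 l; apply: contraNT => S0.
  have /eqP := S1; have /eqP := S2; rewrite !mulf_eq0 !(negPf S0) /=.
  by move=> -> ->.
pose a : R := (nu0 k0)%:~R; pose b : R := (nu1 k0)%:~R.
pose c : R := (nu2 k0)%:~R.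
have small k : (k0 <= k)%N ->
    `|a + b * al.1 + c * al.2| <= (`|b| + `|c|) * d (record k).
  move=> hk; set q := (record k)%:R : R.
  have q1 : 1 <= q by rewrite ler1n record_gt0.
  have q0 : 0 < q by apply: lt_le_trans q1.
  have e : q * (a + b * al.1 + c * al.2) =
      b * ferr (q * al.1) + c * ferr (q * al.2).
    have [/(congr1 (fun i : int => i%:~R : R)) P _] := plane k hk.
    rewrite !intrD !intrM mulr0z -/a -/b -/c -[(rq k)%:~R]/q in P.
    rewrite /ferr -/(rm1 k) -/(rm2 k); apply/eqP; rewrite -subr_eq0.
    by rewrite -[X in _ == X]P; apply/eqP; ring.
  apply: (@le_trans _ _ `|q * (a + b * al.1 + c * al.2)|).
    by rewrite normrM (gtr0_norm q0) ler_peMl.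
  rewrite e (le_trans (ler_normD _ _))// !normrM mulrDl.
  by apply: lerD; apply: ler_wpM2l => //; rewrite /ddist le_max lexx ?orbT.
have rel : a + b * al.1 + c * al.2 = 0.
  apply/eqP; rewrite -normr_le0; apply/ler_addgt0Pl => e e0; rewrite addr0.
  pose m := (Num.trunc ((`|b| + `|c|) / e)).+1.
  have bc0 : 0 <= `|b| + `|c| by rewrite addr_ge0.
  apply: le_trans (small (k0 + m ^ 2)%N (leq_addr _ _)) _.
  have /andP[_ hm] := truncn_itv (divr_ge0 bc0 (ltW e0)).
  have sm : d (record (k0 + m ^ 2)) < m%:R^-1.
    by apply: record_small => //; rewrite leq_addl.
  apply: le_trans (ler_wpM2l bc0 (ltW sm)) _.
  by rewrite ler_pdivrMr ?ltr0n// mulrC -ler_pdivrMr// ltW.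
have [|_ B C] := indep (a := (nu0 k0)%:~R) (b := (nu1 k0)%:~R)
  (c := (nu2 k0)%:~R); first by rewrite !ratr_int.
have /negP := nu_neq0 k0; apply; move: B C => /eqP + /eqP.
by rewrite !intr_eq0 => -> ->.
Qed.

End Records.
End Hitting.

Section HittingTime.
Context {R : realType}.
Implicit Types (al : R * R).

(** Rounding down the coordinates, in a basis of three lattice vectors, of a
point of R^3 moves it by at most the sum of the basis vectors. *)
Lemma lattice_rounding (r1 r2 r3 a1 a2 a3 b1 b2 b3 N0 t u : R) :
  r1 * (a2 * b3 - b2 * a3) - a1 * (r2 * b3 - b2 * r3)
    + b1 * (r2 * a3 - a2 * r3) != 0 ->
  exists f1 f2 f3 : int, exists p1 p2 p3 : R,
  [/\ 0 <= p1 < 1, 0 <= p2 < 1 & 0 <= p3 < 1] /\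
  [/\ f1%:~R * r1 + f2%:~R * r2 + f3%:~R * r3
        = N0 - (p1 * r1 + p2 * r2 + p3 * r3),
      f1%:~R * a1 + f2%:~R * a2 + f3%:~R * a3
        = t - (p1 * a1 + p2 * a2 + p3 * a3) &
      f1%:~R * b1 + f2%:~R * b2 + f3%:~R * b3
        = u - (p1 * b1 + p2 * b2 + p3 * b3)].
Proof.
set D := (X in X != 0) => D0.
pose s1 := (N0 * (a2 * b3 - b2 * a3) - t * (r2 * b3 - b2 * r3)
    + u * (r2 * a3 - a2 * r3)) / D.
pose s2 := (r1 * (t * b3 - u * a3) - a1 * (N0 * b3 - u * r3)
    + b1 * (N0 * a3 - t * r3)) / D.
pose s3 := (r1 * (a2 * u - b2 * t) - a1 * (r2 * u - b2 * N0)
    + b1 * (r2 * t - a2 * N0)) / D.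
exists (Num.floor s1), (Num.floor s2), (Num.floor s3).
exists (frac s1), (frac s2), (frac s3).
split; first by split; apply: frac_itv.
have e1 : s1 * r1 + s2 * r2 + s3 * r3 = N0.
  by rewrite /s1 /s2 /s3 /D; field.
have e2 : s1 * a1 + s2 * a2 + s3 * a3 = t.
  by rewrite /s1 /s2 /s3 /D; field.
have e3 : s1 * b1 + s2 * b2 + s3 * b3 = u.
  by rewrite /s1 /s2 /s3 /D; field.
split; rewrite /frac.
- by rewrite -[N0 in RHS]e1; ring.
- by rewrite -[t in RHS]e2; ring.
- by rewrite -[u in RHS]e3; ring.
Qed.

Lemma expW (a b T : nat) : (a <= b)%N -> (a ^ T <= b ^ T)%N.
Proof. by move=> ab; case: T => // T'; rewrite leq_exp2r. Qed.

Lemma pow_bound (q C T r : nat) : (50 <= q)%N -> (C <= q)%N ->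
  (r <= (C * ((4 * q) ^ 2) ^ T) ^ 2)%N -> (3 * r <= q ^ (3 + 6 * T))%N.
Proof.
move=> q50 Cq hr.
have q0 : (0 < q)%N by apply: leq_trans q50.
apply: (@leq_trans (q * (q * (q ^ 3) ^ T) ^ 2)%N).
  apply: leq_mul; first by apply: leq_trans q50.
  apply: leq_trans hr _; rewrite leq_exp2r// leq_mul//.
  apply: expW; rewrite expnMn (expnS q 2) leq_mul2r.
  by rewrite (leq_trans _ q50) ?orbT.
rewrite -!expnM -!expnS -expnM -expnS leq_exp2l ?(leq_trans _ q50)//.
by clear; lia.
Qed.

(** At a scale where three consecutive records are independent, the target is
reached up to their errors by rounding its coordinates in the basis they form.
The time is at most three times the last record, which Dirichlet's theorem and
the Diophantine condition bound by a power of the scale. *)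
Lemma hitting (tau : R) al : rationally_independent al -> WDC tau al ->
  exists e : nat, forall Q0 : nat, exists q : nat,
    [/\ (Q0 <= q)%N, (0 < q)%N & forall x y : R * R,
      exists n : nat, exists m1 m2 : int,
      [/\ (n <= q ^ e)%N,
          `|x.1 + n%:R * al.1 - y.1 - m1%:~R| <= q%:R^-1 &
          `|x.2 + n%:R * al.2 - y.2 - m2%:~R| <= q%:R^-1]].
Proof.
move=> indep /WDC_ddist[c [T [c0 wdc]]].
have d0 n : (0 < n)%N -> 0 < ddist al n.
  move=> n0; apply: lt_le_trans (wdc n n0).
  by rewrite mulr_gt0// invr_gt0 exprn_gt0// ltr0n.
pose C := (Num.trunc c^-1).+1.
have hC : c^-1 <= C%:R.
  have ci : 0 <= c^-1 by rewrite invr_ge0 ltW.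
  by have /andP[_ /ltW] := truncn_itv ci.
exists (3 + 6 * T)%N => Q0.
pose m := (Q0 + C + 50)%N.
have [k hk Dk] := rdet_neq0 d0 indep ((3 * m.+1) ^ 2).
set d := ddist al (record d0 k).
have dgt0 : 0 < d by rewrite /d d0// record_gt0.
have dm : d < (3 * m.+1)%:R^-1 by apply: record_small => //.
have i3d0 : 0 <= (3 * d)^-1 by rewrite invr_ge0 mulr_ge0// ltW.
pose q := Num.trunc (3 * d)^-1.
have /andP[q1 q2] : q%:R <= (3 * d)^-1 < q.+1%:R := truncn_itv i3d0.
have mq : (m < q)%N.
  rewrite truncn_gt_nat -[m.+1%:R]invrK lef_pV2 ?posrE ?invr_gt0 ?ltr0n//;
    last by rewrite mulr_gt0.
  move: dm; rewrite natrM invfM => dm.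
  by set z := m.+1%:R^-1 in dm *; lra.
have q0 : (0 < q)%N by apply: leq_ltn_trans mq.
have qR0 : 0 < q%:R :> R by rewrite ltr0n.
have d3 : 3 * d <= q%:R^-1.
  by rewrite -[3 * d]invrK lef_pV2 ?posrE ?invr_gt0// mulr_gt0.
have d4 : (4 * q)%:R^-1 <= d.
  rewrite -[d]invrK lef_pV2 ?posrE ?invr_gt0 ?d0 ?ltr0n ?record_gt0 ?muln_gt0//.
  move: q2; rewrite invfM -(natr1 q) natrM => q2.
  have : 3%:R <= q%:R :> R by rewrite ler_nat (leq_trans _ mq)// /m; lia.
  by set z := d^-1 in q2 *; lra.
exists q; split=> // [|x y].
  by apply: leq_trans (ltnW mq); rewrite /m -addnA leq_addr.
set r1 := record d0 k; set r2 := record d0 k.+1; set r3 := record d0 k.+2.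
have r2le : (r2 <= (4 * q) ^ 2)%N by apply: record_le d4; rewrite muln_gt0.
have r3le : (r3 <= (C * ((4 * q) ^ 2) ^ T) ^ 2)%N.
  apply: record_le; first by rewrite muln_gt0 !expn_gt0 muln_gt0 q0.
  apply: le_trans (wdc _ (record_gt0 d0 k.+1)).
  rewrite natrM invfM; apply: ler_pM; rewrite ?invr_ge0 ?ler0n//.
    by rewrite -[c]invrK lef_pV2 ?posrE ?invr_gt0 ?ltr0n.
  rewrite -natrX lef_pV2 ?posrE ?ltr0n ?expn_gt0 ?record_gt0 ?muln_gt0 ?q0//.
  by rewrite ler_nat expW.
have r3e : (3 * r3 <= q ^ (3 + 6 * T))%N.
  by apply: pow_bound r3le; apply: leq_trans (ltnW mq); rewrite /m; clear; lia.
have le12 : (r1 <= r2)%N by apply: ltnW; apply: record_lt.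
have le23 : (r2 <= r3)%N by apply: ltnW; apply: record_lt.
have D : r1%:R * (ferr (r2%:R * al.1) * ferr (r3%:R * al.2)
    - ferr (r2%:R * al.2) * ferr (r3%:R * al.1))
  - ferr (r1%:R * al.1) * (r2%:R * ferr (r3%:R * al.2)
    - ferr (r2%:R * al.2) * r3%:R)
  + ferr (r1%:R * al.2) * (r2%:R * ferr (r3%:R * al.1)
    - ferr (r2%:R * al.1) * r3%:R) != 0 :> R.
  move: Dk; rewrite -(intr_eq0 R); apply: contra => /eqP E; apply/eqP.
  rewrite -[RHS]E /rdet /ferr.
  rewrite !(intrD, mulrNz, intrM) -/(rm1 _ _) -/(rm2 _ _).
  rewrite -[(rq d0 k)%:~R]/(r1%:R) -[(rq d0 k.+1)%:~R]/(r2%:R).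
  rewrite -[(rq d0 k.+2)%:~R]/(r3%:R) /rm1 /rm2 -/r1 -/r2 -/r3.
  by ring.
(* Rounding may shorten the time by [r1 + r2 + r3]: aiming at [3 * r3] keeps it
   nonnegative. *)
have [f1 [f2 [f3 [p1 [p2 [p3 [[P1 P2 P3] [E1 E2 E3]]]]]]]] :=
  lattice_rounding (3 * r3%:R) (y.1 - x.1) (y.2 - x.2) D.
move: P1 P2 P3 => /andP[p10 p11] /andP[p20 p21] /andP[p30 p31].
pose n := f1 * r1%:Z + f2 * r2%:Z + f3 * r3%:Z.
have nR : n%:~R = 3 * r3%:R - (p1 * r1%:R + p2 * r2%:R + p3 * r3%:R) :> R.
  by rewrite -E1 /n !intrD !intrM.
have hr12 : r1%:R <= r2%:R :> R by rewrite ler_nat.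
have hr23 : r2%:R <= r3%:R :> R by rewrite ler_nat.
have r1g : 0 <= r1%:R :> R by rewrite ler0n.
have n0 : 0 <= n by rewrite -(ler0z R) nR; nra.
have nle : n <= (3 * r3)%N%:Z.
  by rewrite -(ler_int R) nR -[((3 * r3)%N%:Z)%:~R]/((3 * r3)%N%:R) natrM; nra.
exists `|n|%N.
exists (f1 * nint (r1%:R * al.1) + f2 * nint (r2%:R * al.1)
        + f3 * nint (r3%:R * al.1)).
exists (f1 * nint (r1%:R * al.2) + f2 * nint (r2%:R * al.2)
        + f3 * nint (r3%:R * al.2)).
have nn : `|n|%N%:R = n%:~R :> R by rewrite -{2}(gez0_abs n0).
have dr i : (k <= i)%N -> ddist al (record d0 i) <= d.
  move=> /subnK <-; elim: (i - k)%N => // j IH.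
  by apply: le_trans IH; rewrite addSn ltW// ddist_record.
have fe (i j : nat) : (k <= i)%N ->
    `|ferr ((record d0 i)%:R * al.1)| <= d /\
    `|ferr ((record d0 i)%:R * al.2)| <= d.
  by move=> ki; split; apply: le_trans (dr i ki); rewrite /ddist le_max lexx ?orbT.
have bnd (w1 w2 w3 : R) : `|w1| <= d -> `|w2| <= d -> `|w3| <= d ->
    `|- (p1 * w1 + p2 * w2 + p3 * w3)| <= q%:R^-1.
  move=> h1 h2 h3; apply: le_trans d3.
  rewrite normrN (le_trans (ler_normD _ _))//.
  have : `|p1 * w1 + p2 * w2| <= `|p1 * w1| + `|p2 * w2| := ler_normD _ _.
  rewrite !normrM (ger0_norm p10) (ger0_norm p20) (ger0_norm p30) => h.
  by have := normr_ge0 w1; have := normr_ge0 w2; have := normr_ge0 w3; nra.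
have [a1 b1] := fe k 0%N (leqnn _).
have [a2 b2] := fe k.+1 0%N (leqnSn _).
have [a3 b3] := fe k.+2 0%N (leq_trans (leqnSn _) (leqnSn _)).
split.
- by apply: leq_trans r3e; rewrite -lez_nat gez0_abs.
- rewrite nn (_ : _ - _ - _ = - (p1 * ferr (r1%:R * al.1)
    + p2 * ferr (r2%:R * al.1) + p3 * ferr (r3%:R * al.1))); first exact: bnd.
  have -> : n%:~R = f1%:~R * r1%:R + f2%:~R * r2%:R + f3%:~R * r3%:R :> R.
    by rewrite /n !intrD !intrM.
  rewrite !intrD !intrM; move: E2; rewrite {1 2 3}/ferr => E2.
  by apply/eqP; rewrite -subr_eq0; move/eqP: E2; rewrite -subr_eq0 => /eqP <-;
    apply/eqP; ring.
- rewrite nn (_ : _ - _ - _ = - (p1 * ferr (r1%:R * al.2)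
    + p2 * ferr (r2%:R * al.2) + p3 * ferr (r3%:R * al.2))); first exact: bnd.
  have -> : n%:~R = f1%:~R * r1%:R + f2%:~R * r2%:R + f3%:~R * r3%:R :> R.
    by rewrite /n !intrD !intrM.
  rewrite !intrD !intrM; move: E3; rewrite {1 2 3}/ferr => E3.
  by apply/eqP; rewrite -subr_eq0; move/eqP: E3; rewrite -subr_eq0 => /eqP <-;
    apply/eqP; ring.
Qed.

End HittingTime.

(** * The exponential function on the imaginary axis *)

Local Notation normc := ComplexField.Normc.normc.
Local Notation normc0 := ComplexField.Normc.normc0.
Local Notation normc1 := ComplexField.Normc.normc1.
Local Notation normcM := ComplexField.Normc.normcM.
Local Notation normcV := ComplexField.Normc.normcV.

Section ComplexNorm.
Context {R : realType}.
Implicit Types x y z : R[i].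

Lemma normc_ge0 z : 0 <= normc z.
Proof. by case: z => a b; rewrite /= sqrtr_ge0. Qed.

Lemma normcD x y : normc (x + y) <= normc x + normc y.
Proof. exact: (@le_normcD R x y). Qed.

Lemma normcNE z : normc (- z) = normc z.
Proof. exact: (@normcN R z). Qed.

Lemma normcB x y : normc (x - y) <= normc x + normc y.
Proof. by rewrite (le_trans (normcD _ _))// normcNE. Qed.

Lemma normcBC x y : normc (x - y) = normc (y - x).
Proof. by rewrite -normcNE opprB. Qed.

Lemma normc_sum I (r : seq I) (P : pred I) (F : I -> R[i]) :
  normc (\sum_(i <- r | P i) F i) <= \sum_(i <- r | P i) normc (F i).
Proof.
elim/big_ind2 : _ => [|a x b y ha hb|//]; first by rewrite normc0.
by rewrite (le_trans (normcD _ _))// lerD.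
Qed.

Lemma normcX z n : normc (z ^+ n) = normc z ^+ n.
Proof.
elim: n => [|n IH]; first by rewrite !expr0 normc1.
by rewrite !exprS normcM IH.
Qed.

Lemma normc_real (r : R) : normc r%:C%C = `|r|.
Proof. by rewrite /= expr0n addr0 sqrtr_sqr. Qed.

Lemma normc_nat n : normc (n%:R : R[i]) = n%:R.
Proof.
by rewrite -(rmorph_nat (real_complex R)) normc_real ger0_norm// ler0n.
Qed.

Lemma normc_i : normc ('i%C : R[i]) = 1.
Proof. by rewrite /= expr0n expr1n add0r sqrtr1. Qed.

Lemma normc_Re z : `|complex.Re z| <= normc z.
Proof.
by case: z => a b /=; rewrite -sqrtr_sqr ler_wsqrtr// lerDl sqr_ge0.
Qed.

Lemma normc_Im z : `|complex.Im z| <= normc z.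
Proof.
by case: z => a b /=; rewrite -sqrtr_sqr ler_wsqrtr// lerDr sqr_ge0.
Qed.

Lemma normc_leD z : normc z <= `|complex.Re z| + `|complex.Im z|.
Proof.
case: z => a b; have -> : (a +i* b)%C = a%:C%C + 'i%C * b%:C%C.
  by rewrite {1}[(a +i* b)%C]complexE.
rewrite (le_trans (normcD _ _))// normcM normc_i mul1r.
by rewrite !normc_real /= !(mul0r, mulr0, mul1r, subr0, addr0, add0r).
Qed.

Lemma normc_sqr z : normc z ^+ 2 = complex.Re z ^+ 2 + complex.Im z ^+ 2.
Proof. by case: z => a b /=; rewrite sqr_sqrtr// addr_ge0 ?sqr_ge0. Qed.

Lemma normc_conj z : normc (conjc z) = normc z.
Proof. by case: z => a b /=; rewrite sqrrN. Qed.

Lemma normc_eq0 z : (normc z == 0) = (z == 0).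
Proof.
apply/eqP/eqP => [/ComplexField.Normc.eq0_normc//|->].
exact: normc0.
Qed.

Lemma normc_gt0 z : (0 < normc z) = (z != 0).
Proof. by rewrite lt_neqAle normc_ge0 andbT eq_sym normc_eq0. Qed.

Lemma ReD x y : complex.Re (x + y) = complex.Re x + complex.Re y. Proof. by case: x y => [? ?] []. Qed.
Lemma ImD x y : complex.Im (x + y) = complex.Im x + complex.Im y. Proof. by case: x y => [? ?] []. Qed.
Lemma ReN x : complex.Re (- x) = - complex.Re x. Proof. by case: x. Qed.
Lemma ImN x : complex.Im (- x) = - complex.Im x. Proof. by case: x. Qed.
Lemma ReM x y : complex.Re (x * y) = complex.Re x * complex.Re y - complex.Im x * complex.Im y.
Proof. by case: x y => [? ?] []. Qed.
End ComplexNorm.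

Section ExpTail.
Context {R : realType}.

Lemma exp_partial (Y : R) (n : nat) : 0 <= Y ->
  \sum_(0 <= k < n) Y ^+ k / k`!%:R <= expR Y.
Proof.
move=> Y0; have -> : \sum_(0 <= k < n) Y ^+ k / k`!%:R = series (exp_coeff Y) n.
  by rewrite /series /=; apply: eq_bigr => k _; rewrite exp_coeffE mulrC.
rewrite /expR; apply: nondecreasing_cvgn_le; last exact: is_cvg_series_exp_coeff.
apply: nondecreasing_series => k _ _; exact: exp_coeff_ge0.
Qed.

(** Multiplying each term by [2 ^ (k - L)] only enlarges it, and gives a part of
the series of [expR (2 * Y)]. *)
Lemma exp_tail (Y : R) (L n : nat) : 0 <= Y ->
  \sum_(L <= k < n) Y ^+ k / k`!%:R <= expR (2 * Y) / 2 ^+ L.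
Proof.
move=> Y0; have [nL|Ln] := leqP n L.
  by rewrite big_geq// divr_ge0 ?expR_ge0// exprn_ge0.
rewrite ler_pdivlMr ?exprn_gt0// big_distrl /=.
apply: le_trans (exp_partial n (mulr_ge0 _ Y0)) => //.
rewrite [leRHS](big_cat_nat (n := L)) ?(ltnW Ln)//= ler_wpDl//.
  by apply: sumr_ge0 => k _; rewrite divr_ge0 ?exprn_ge0 ?ler0n ?mulr_ge0.
rewrite big_seq [leRHS]big_seq; apply: ler_sum => k.
rewrite mem_index_iota => /andP[Lk _]; rewrite exprMn mulrAC.
rewrite ler_wpM2r ?invr_ge0 ?ler0n// mulrC ler_wpM2r ?exprn_ge0//.
by rewrite ler_weXn2l// ler1n.
Qed.

End ExpTail.

Section Cis.
Context {R : realType}.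
Local Notation C := R[i].
Implicit Types (x y t : R) (z : C).

(** Partial sums of the series of [exp (-iy)]. *)
Definition texp (L : nat) (y : R) : C :=
  \sum_(0 <= k < L) (k`!)%:R^-1 * (- 'i%C * y%:C%C) ^+ k.

(** [exp (-iy)], with the sign of the quantum evolution. *)
Definition cis y : C := (cos y -i* sin y)%C.

Lemma powNi k : (- 'i%C : C) ^+ k =
  Complex ((~~ odd k)%:R * (-1) ^+ k./2) (- ((odd k)%:R * (-1) ^+ k.-1./2)).
Proof.
elim: k => [|k IH].
  by rewrite /= expr0 mulr1 mul0r oppr0.
rewrite exprS IH /= uphalfE; case: (boolP (odd k)) => ok /=.
  rewrite !mul0r !mul1r; simpc.
  have k0 : (0 < k)%N by case: k ok {IH}.
  congr Complex.
  by case: k k0 {IH ok} => // k _ /=; rewrite exprS mulN1r.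
by rewrite !mul0r !mul1r; simpc.
Qed.

Lemma cisE0 k y : (k`!)%:R^-1 * (- 'i%C * y%:C%C) ^+ k =
  Complex (cos_coeff y k) (- sin_coeff y k) :> C.
Proof.
rewrite exprMn powNi -(rmorphXn (real_complex R)) cos_coeffE sin_coeffE /=.
rewrite -(rmorph_nat (real_complex R)) -fmorphV; simpc.
by congr Complex; rewrite ?mulrN; [|congr (- _)]; ring.
Qed.

Lemma texpE L y :
  texp L y = Complex (series (cos_coeff y) L) (- series (sin_coeff y) L).
Proof.
rewrite /texp /series /=; elim: L => [|L IH].
  by rewrite !big_geq// oppr0.
by rewrite !big_nat_recr//= IH cisE0; simpc.
Qed.

Lemma normcNi y k : normc ((- 'i%C * y%:C%C : C) ^+ k) = `|y| ^+ k.
Proof.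
by rewrite normcX normcM normcNE normc_i mul1r normc_real.
Qed.

Lemma texp_sub (L n : nat) y : (L <= n)%N ->
  normc (texp n y - texp L y) <= \sum_(L <= k < n) `|y| ^+ k / k`!%:R.
Proof.
move=> Ln; rewrite /texp (big_cat_nat (n := L))//= addrAC subrr add0r.
apply: le_trans (normc_sum _ _ _) _; apply: ler_sum => k _.
rewrite normcM normcNi.
by rewrite normcV normc_nat mulrC.
Qed.

Lemma texp_lim_le (L : nat) y z c :
  (forall n, (L <= n)%N -> normc (texp n y - z) <= c) -> normc (cis y - z) <= c.
Proof.
move=> H; apply/ler_addgt0Pl => e e0.
have cc : series (cos_coeff y) @ \oo --> cos y.
  by rewrite unlock; exact: is_cvg_series_cos_coeff.
have cs : series (sin_coeff y) @ \oo --> sin y.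
  by rewrite unlock; exact: is_cvg_series_sin_coeff.
have e20 : 0 < e / 2 by rewrite divr_gt0.
have nc : \forall n \near \oo, `|cos y - series (cos_coeff y) n| <= e / 2.
  by move/cvgrPdist_le: cc; apply.
have ns : \forall n \near \oo, `|sin y - series (sin_coeff y) n| <= e / 2.
  by move/cvgrPdist_le: cs; apply.
near \oo => n.
have -> : cis y - z = (cis y - texp n y) + (texp n y - z) by rewrite addrA subrK.
apply: le_trans (normcD _ _) _; apply: lerD; last first.
  by apply: H; near: n; exact: nbhs_infty_ge.
apply: le_trans (normc_leD _) _; rewrite texpE /cis [leRHS]splitr; simpc => /=.
apply: lerD.
  by near: n; exact: nc.
rewrite -normrN opprD !opprK; near: n.
exact: ns.
Unshelve. all: by end_near. Qed.

Lemma texp_cis (L : nat) y (Y : R) : `|y| <= Y ->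
  normc (cis y - texp L y) <= expR (2 * Y) / 2 ^+ L.
Proof.
move=> yY; have Y0 : 0 <= Y by apply: le_trans yY.
apply: (@texp_lim_le L) => n Ln; apply: le_trans (texp_sub y Ln) _.
apply: le_trans (exp_tail L n Y0); apply: ler_sum => k _.
by rewrite ler_wpM2r ?invr_ge0// lerXn2r// nnegrE.
Qed.

Lemma normc_cis y : normc (cis y) = 1.
Proof. by rewrite /cis /= sqrrN cos2Dsin2 sqrtr1. Qed.

Lemma cisD x y : cis (x + y) = cis x * cis y.
Proof.
rewrite /cis cosD sinD; simpc; congr Complex; ring.
Qed.

Lemma cis0 : cis 0 = 1.
Proof. by rewrite /cis cos0 sin0 oppr0. Qed.

Lemma cisMn y n : cis (n%:R * y) = cis y ^+ n.
Proof.
elim: n => [|n IH]; first by rewrite mul0r cis0 expr0.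
by rewrite -natr1 mulrDl mul1r cisD IH exprSr.
Qed.

(** Second order accuracy of one backward Euler step. *)
Lemma cis_euler y : `|y| <= 1 ->
  normc (cis y - (1 + 'i%C * y%:C%C)^-1) <= 3 * y ^+ 2.
Proof.
move=> y1; set b := 1 + _.
have bn : 1 <= normc b.
  have -> : 1 = `|complex.Re b| :> R.
    by rewrite /b ReD ReM /= !(mul0r, mulr0, subr0, addr0) normr1.
  exact: normc_Re.
have b2 : normc b <= 2.
  rewrite (le_trans (normcD _ _))// normc1.
  by rewrite normcM normc_i normc_real mul1r; lra.
have b0 : b != 0 by rewrite -normc_gt0 (lt_le_trans _ bn).
have rem : normc (cis y - texp 2 y) <= y ^+ 2.
  apply: (@texp_lim_le 2) => n Ln; apply: le_trans (texp_sub y Ln) _.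
  apply: (@le_trans _ _ (\sum_(2 <= k < n) y ^+ 2 * (2 ^+ k.-1)^-1)).
    rewrite big_seq [leRHS]big_seq; apply: ler_sum => k.
    rewrite mem_index_iota => /andP[k2 _].
    apply: ler_pM; rewrite ?exprn_ge0 ?invr_ge0//.
      by rewrite -real_normK ?num_real// ler_wiXn2l.
    rewrite lef_pV2 ?posrE ?exprn_gt0 ?ltr0n ?fact_gt0//.
    case: k k2 => // k _ /=; rewrite -natrX ler_nat.
    elim: k => // k IH; rewrite expnS factS; apply: leq_mul => //.
  rewrite -big_distrr /= ler_piMr ?sqr_ge0//.
  have [n2|n2] := leqP n 2; first by rewrite big_geq.
  have geo m : \sum_(2 <= k < m.+2) (2 ^+ k.-1)^-1 = 1 - (2 ^+ m)^-1 :> R.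
    elim: m => [|m IH]; first by rewrite big_geq// expr0 invr1 subrr.
    by rewrite big_nat_recr//= IH !exprS; field.
  rewrite -(subnK (ltnW n2)) addn2 geo.
  by rewrite gerBl invr_ge0 exprn_ge0.
have -> : cis y - b^-1 = ((cis y - texp 2 y) * b + (texp 2 y * b - 1)) / b.
  by rewrite mulrBl addrA subrK mulrBl mul1r mulfK.
rewrite normcM normcV.
rewrite ler_pdivrMr ?(lt_le_trans _ bn)//.
apply: le_trans (_ : 3 * y ^+ 2 <= _); last by rewrite ler_peMr// mulr_ge0 ?sqr_ge0.
have -> : texp 2 y * b - 1 = (y ^+ 2)%:C%C.
  rewrite /texp big_nat_recr//= big_nat1 expr0 expr1 /b.
  by rewrite !invr1; simpc; congr Complex; ring.
apply: le_trans (normcD _ _) _.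
rewrite normcM normc_real ger0_norm ?sqr_ge0//.
have := sqr_ge0 y; have := normc_ge0 (cis y - texp 2 y); nra.
Qed.

End Cis.

(** * Approximation of the evolution by resolvents *)

Lemma ndvdn_alias (M k j : nat) : (k < M)%N -> (j < M)%N -> j != k ->
  ~~ (M %| j + (M - k))%N.
Proof.
move=> kM jM jk; apply/negP => /dvdnP[[|[|c]]]; rewrite ?mul0n ?mul1n ?mulSn; lia.
Qed.

Section ResolventApprox.
Context {R : realType}.
Local Notation C := R[i].
Implicit Types (x y t : R).

Definition unity (M : nat) : C := cis (2 * pi / M%:R).

Lemma unity_pow M : (0 < M)%N -> unity M ^+ M = 1.
Proof.
move=> M0; rewrite -cisMn [M%:R * _]mulrC divfK ?pnatr_eq0 -?lt0n//.
by rewrite /cis mulr_natl cos2pi sin2pi oppr0.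
Qed.

Lemma cis_neq1 y : 0 < y < pi -> cis (2 * y) != 1.
Proof.
move=> /sin_gt0_pi sy; rewrite /cis; apply/negP => /eqP[] h _.
have := cos2Dsin2 y; have := sy.
move: h; rewrite mulr_natl cos_mulr2n mulr2n => h.
by have := mulr_gt0 sy sy; rewrite -expr2; lra.
Qed.

Lemma unity_neq1 M a : (0 < M)%N -> ~~ (M %| a)%N -> unity M ^+ a != 1.
Proof.
move=> M0 Ma; rewrite (divn_eq a M) exprD mulnC exprM unity_pow// expr1n mul1r.
rewrite /dvdn -lt0n in Ma.
have M1 : 0 < M%:R :> R by rewrite ltr0n.
rewrite -cisMn (_ : _ * _ = 2 * ((a %% M)%:R * pi / M%:R)); last by ring.
apply: cis_neq1; rewrite divr_gt0 ?mulr_gt0 ?pi_gt0 ?ltr0n//=.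
by rewrite ltr_pdivrMr// mulrC ltr_pM2l ?pi_gt0// ltr_nat ltn_mod.
Qed.

Lemma unity_sum M a : (0 < M)%N -> ~~ (M %| a)%N ->
  \sum_(i < M) (unity M ^+ i) ^+ a = 0.
Proof.
move=> M0 Ma; have h1 := unity_neq1 M0 Ma.
apply: (mulfI (_ : unity M ^+ a - 1 != 0)); first by rewrite subr_eq0.
rewrite mulr0; transitivity ((unity M ^+ a) ^+ M - 1); last first.
  by rewrite exprAC unity_pow// expr1n subrr.
by rewrite [RHS]subrX1; congr (_ * _); apply: eq_bigr => i _; rewrite exprAC.
Qed.

Lemma normc_unity M i : normc ((unity M ^+ i) : C) = 1.
Proof. by rewrite normcX normc_cis expr1n. Qed.

Lemma ImiM (z : C) : complex.Im ('i%C * z) = complex.Re z.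
Proof. by case: z => a b; simpc. Qed.

Lemma pow_small (rho e : R) : 0 <= rho < 1 -> 0 < e ->
  exists M0, forall M, (M0 <= M)%N -> rho ^+ M < e.
Proof.
move=> /andP[r0 r1] e0.
have : `|rho| < 1 by rewrite ger0_norm.
move/(cvg_geometric 1)/cvgrPdist_lt => /(_ _ e0)[M0 _ H].
exists M0 => M /H /=; rewrite sub0r normrN mul1r.
by apply: le_lt_trans; exact: ler_norm.
Qed.

Lemma normc_1D_ix x : 1 <= normc (1 + 'i%C * x%:C%C : C).
Proof.
apply: le_trans (normc_Re _).
by rewrite ReD ReM /= !(mul0r, mulr0, subr0, addr0) normr1.
Qed.

Variables (M K : nat) (s : R).
Hypotheses (K2 : (2 <= K)%N) (KM : (K <= M)%N) (s0 : 0 < s).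
Let rho : R := 1 - K%:R^-1.
Let om (i : 'I_M) : C := unity M ^+ i.
(** With [B = 1 + isx], the product [is (x - node i)] is [B - rho * om i]; the nodes
lie on a circle in the upper half plane, at height at least [1 / (K s)]. *)
Definition node (i : 'I_M) : C := 'i%C * s^-1%:C%C * (1 - rho%:C%C * om i).
Definition weight (i : 'I_M) : C :=
  (rho ^- K.-1)%:C%C * (M%:R)^-1 * om i ^+ (M - K.-1) * ('i%C * s%:C%C)^-1.

Let K0 : 0 < K%:R :> R. Proof. by rewrite ltr0n; apply: leq_trans K2. Qed.
Let M0 : (0 < M)%N. Proof. by apply: leq_trans KM; apply: leq_trans K2. Qed.
Let rho01 : 0 < rho < 1.
Proof.
rewrite /rho subr_gt0 invf_lt1// ltr1n K2 /= gtrBl invr_gt0//.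
Qed.

Lemma Im_node i : (K%:R * s)^-1 <= complex.Im (node i).
Proof.
rewrite /node -mulrA ImiM ReM /= !(mul0r, subr0).
rewrite invfM mulrC ler_pM2l ?invr_gt0// ReD ReN ReM /= !(mul0r, subr0).
have : complex.Re (om i) <= 1.
  by rewrite -(normc_unity M i) (le_trans (ler_norm _))// normc_Re.
have /andP[r0 _] := rho01; move=> /(ler_wpM2l (ltW r0)).
by rewrite /rho; lra.
Qed.

(** [(1 - 1/K) ^- (K - 1) = (1 + 1/(K - 1)) ^ (K - 1)]. *)
Lemma rho_pow : rho ^- K.-1 <= expR 1.
Proof.
have K1 : (0 < K.-1)%N by case: K K2 => [|[]].
have K1' : 0 < K.-1%:R :> R by rewrite ltr0n.
have KE : K%:R = K.-1%:R + 1 :> R by rewrite natr1 prednK//; apply: leq_trans K2.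
rewrite -exprVn (_ : rho^-1 = 1 + K.-1%:R^-1); last first.
  by rewrite /rho KE; field; rewrite lt0r_neq0//= lt0r_neq0// addr_gt0.
apply: le_trans (_ : expR (K.-1%:R^-1) ^+ K.-1 <= _).
  by rewrite lerXn2r ?nnegrE ?expR_ge0 ?expR_ge1Dx// addr_ge0// invr_ge0 ltW.
by rewrite -expRM_natr mulVf// lt0r_neq0.
Qed.

Lemma sum_weight : \sum_i normc (weight i) <= expR 1 / s.
Proof.
have E i : normc (weight i) = M%:R^-1 * (rho ^- K.-1 / s).
  rewrite /weight !normcM normcX normc_unity expr1n mulr1.
  rewrite normcV normc_nat normcV.
  rewrite normcM normc_i mul1r !normc_real (gtr0_norm s0).
  have /andP[r0 _] := rho01.
  by rewrite ger0_norm ?invr_ge0 ?exprn_ge0 ?ltW//; ring.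
rewrite (eq_bigr _ (fun i _ => E i)) sumr_const card_ord.
rewrite -[leLHS]mulr_natl mulVKf ?pnatr_eq0 -?lt0n// ler_wpM2r ?invr_ge0 ?(ltW s0)//.
exact: rho_pow.
Qed.

(** Discrete Cauchy formula: averaging over roots of unity extracts one
coefficient of the geometric series of the resolvent, up to aliasing. *)
Lemma resolvent_sum x :
  normc ((1 + 'i%C * (s * x)%:C%C)^-1 ^+ K - \sum_i weight i / (x%:C%C - node i))
   <= expR 1 * K%:R * rho ^+ M.
Proof.
set B : C := 1 + _; set b := B^-1.
have B1 : 1 <= normc B by apply: normc_1D_ix.
have B0 : B != 0 by rewrite -normc_gt0 (lt_le_trans _ B1).
have b1 : normc b <= 1 by rewrite normcV invf_le1// (lt_le_trans _ B1).
have /andP[r0 r1] := rho01.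
have s0' : s%:C%C != 0 :> C by rewrite -normc_gt0 normc_real normr_gt0 gt_eqF.
have i0 : 'i%C != 0 :> C by rewrite -normc_gt0 normc_i.
have ii : 'i%C * 'i%C = -1 :> C by rewrite -expr2 sqr_i.
have dist i : K%:R^-1 <= normc (B - rho%:C%C * om i).
  have : normc B <= normc (B - rho%:C%C * om i) + normc (rho%:C%C * om i).
    by rewrite -{1}[B](subrK (rho%:C%C * om i)) normcD.
  rewrite normcM normc_unity normc_real mulr1 gtr0_norm//.
  by move: B1; rewrite /rho; lra.
have d0 i : B - rho%:C%C * om i != 0.
  by rewrite -normc_gt0 (lt_le_trans _ (dist i))// invr_gt0.
have nodeE i : 'i%C * s%:C%C * (x%:C%C - node i) = B - rho%:C%C * om i.
  rewrite /node /B rmorphM fmorphV /=.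
  have -> : 'i%C * s%:C%C * (x%:C%C - 'i%C / s%:C%C * (1 - rho%:C%C * om i)) =
    'i%C * s%:C%C * x%:C%C - ('i%C * 'i%C) * (s%:C%C / s%:C%C)
       * (1 - rho%:C%C * om i) by ring.
  by rewrite ii mulfV//; ring.
have nz i : x%:C%C - node i != 0.
  by have := d0 i; rewrite -nodeE mulf_eq0 negb_or => /andP[].
pose g := (M%:R)^-1 * \sum_i om i ^+ (M - K.-1) / (B - rho%:C%C * om i).
have gE : \sum_i weight i / (x%:C%C - node i) = (rho ^- K.-1)%:C%C * g.
  rewrite /g mulrA big_distrr /=; apply: eq_bigr => i _.
  rewrite /weight -!mulrA; do 3 congr (_ * _).
  by rewrite -nodeE [RHS]invfM.
have gn : normc g <= K%:R.
  rewrite /g normcM normcV normc_nat.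
  rewrite ler_pdivrMl ?ltr0n//; apply: le_trans (normc_sum _ _ _) _.
  rewrite mulr_natl -[M in _ *+ M]card_ord -sumr_const; apply: ler_sum => i _.
  rewrite normcM normcX normc_unity expr1n mul1r.
  rewrite normcV -[K%:R]invrK lef_pV2 ?posrE ?invr_gt0//.
  by rewrite normc_gt0.
have key : g * (1 - rho%:C%C ^+ M * b ^+ M) = rho%:C%C ^+ K.-1 * b ^+ K.
  have term i : (B - rho%:C%C * om i)^-1 * (1 - rho%:C%C ^+ M * b ^+ M) =
      \sum_(j < M) rho%:C%C ^+ j * b ^+ j.+1 * om i ^+ j.
    apply: (mulfI (d0 i)); rewrite mulrA mulfV// mul1r.
    have omM : om i ^+ M = 1 by rewrite /om exprAC unity_pow// expr1n.
    have -> : B - rho%:C%C * om i = B * (1 - rho%:C%C * b * om i).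
      by rewrite mulrBr mulr1 /b; congr (_ - _); rewrite mulrA mulrCA mulfV ?mulr1.
    have -> : 1 - rho%:C%C ^+ M * b ^+ M = 1 - (rho%:C%C * b * om i) ^+ M.
      by rewrite !exprMn omM mulr1.
    set q := rho%:C%C * b * om i.
    have -> : \sum_(j < M) rho%:C%C ^+ j * b ^+ j.+1 * om i ^+ j =
        b * \sum_(j < M) q ^+ j.
      by rewrite big_distrr /=; apply: eq_bigr => j _; rewrite exprS !exprMn; ring.
    rewrite mulrA [B * _]mulrC -[_ * B * b]mulrA mulfV// mulr1.
    by rewrite -opprB subrX1 -mulNr opprB.
  rewrite /g -mulrA big_distrl /=.
  transitivity ((M%:R)^-1 * \sum_(i < M) \sum_(j < M)
      rho%:C%C ^+ j * b ^+ j.+1 * om i ^+ (j + (M - K.-1))).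
    congr (_ * _); apply: eq_bigr => i _; rewrite -mulrA term big_distrr /=.
    by apply: eq_bigr => j _; rewrite exprD; ring.
  have KM1 : (K.-1 < M)%N by apply: leq_trans KM; rewrite prednK//; apply: leq_trans K2.
  rewrite exchange_big /= (bigD1 (Ordinal KM1))//= [X in _ + X]big1 ?addr0; last first.
    move=> j jK; rewrite -big_distrr /= unity_sum ?mulr0//.
    exact: (ndvdn_alias KM1 (ltn_ord j) jK).
  rewrite subnKC ?(ltnW KM1)//.
  have e1 (i : 'I_M) : om i ^+ M = 1 by rewrite /om exprAC unity_pow// expr1n.
  rewrite (eq_bigr (fun=> rho%:C%C ^+ K.-1 * b ^+ K.-1.+1)); last first.
    by move=> i _; rewrite e1 mulr1.
  rewrite sumr_const card_ord prednK ?(leq_trans _ K2)// -[X in _ * X]mulr_natl.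
  by rewrite mulKf// pnatr_eq0 -lt0n.
rewrite gE.
have rk : rho%:C%C ^+ K.-1 != 0 :> C.
  by rewrite expf_neq0// -normc_gt0 normc_real normr_gt0 gt_eqF.
have -> : b ^+ K = (rho ^- K.-1)%:C%C * (g * (1 - rho%:C%C ^+ M * b ^+ M)).
  by rewrite key fmorphV rmorphXn /= mulrA mulVf ?mul1r.
rewrite (_ : _ - _ = - ((rho ^- K.-1)%:C%C * (g * (rho%:C%C ^+ M * b ^+ M))));
  last by ring.
clearbody g; rewrite normcNE !normcM !normcX.
rewrite !normc_real (gtr0_norm r0) ger0_norm ?invr_ge0 ?exprn_ge0 ?(ltW r0)//.
have rM : 0 <= rho ^+ M by rewrite exprn_ge0 ?(ltW r0).
have bM : 0 <= normc b ^+ M by rewrite exprn_ge0 ?normc_ge0.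
rewrite -mulrA; apply: ler_pM; rewrite ?invr_ge0 ?exprn_ge0 ?(ltW r0) ?rho_pow//.
  by rewrite mulr_ge0 ?normc_ge0 ?mulr_ge0.
apply: ler_pM; rewrite ?normc_ge0 ?mulr_ge0//.
by rewrite ler_piMr// exprn_ile1// normc_ge0.
Qed.

End ResolventApprox.

Section ResolventApproxCis.
Context {R : realType}.

(** [K] backward Euler steps of length [t / K] approximate [exp (-itx)] up to
[O(t ^ 2 / K)]; their product, a power of a resolvent, is a sum of resolvents by
[resolvent_sum]. The number [M] of nodes makes the aliasing error negligible and
affects neither the mass of the coefficients nor the height of the energies. *)
Lemma resolvent_approx (c t : R) (K : nat) : 1 <= c -> 1 <= t -> (2 <= K)%N ->
  t * c <= K%:R ->
  exists (M : nat) (w z : 'I_M -> R[i]),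
  [/\ \sum_i normc (w i) <= expR 1 * K%:R / t,
      forall i, t^-1 <= complex.Im (z i) &
      forall x : R, `|x| <= c -> 
      normc (cis (t * x) - \sum_i w i / (x%:C%C - z i))
        <= 4 * (t * c) ^+ 2 / K%:R].
Proof.
move=> c1 t1 K2 tcK.
have t0 : 0 < t by apply: lt_le_trans t1.
have c0 : 0 < c by apply: lt_le_trans c1.
have K0 : 0 < K%:R :> R by rewrite ltr0n; apply: leq_trans K2.
pose s := t / K%:R.
have s0 : 0 < s by rewrite divr_gt0.
pose rho : R := 1 - K%:R^-1.
have rho01 : 0 <= rho < 1.
  by rewrite /rho subr_ge0 invf_le1// ler1n (ltnW K2) /= gtrBl invr_gt0.
pose e := (t * c) ^+ 2 / K%:R / (expR 1 * K%:R).
have e0 : 0 < e.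
  by rewrite divr_gt0 ?mulr_gt0 ?expR_gt0 ?invr_gt0// exprn_gt0// mulr_gt0.
have [M0 HM0] := pow_small rho01 e0.
pose M := maxn M0 K.
have KM : (K <= M)%N by rewrite leq_maxr.
exists M, (@weight R M K s), (@node R M K s); split.
- apply: le_trans (sum_weight K2 KM s0) _.
  by rewrite /s invf_div mulrA.
- move=> i; apply: le_trans (Im_node K2 s0 i).
  by rewrite /s [K%:R * _]mulrC divfK// gt_eqF.
- move=> x xc.
  set b : R[i] := (1 + 'i%C * (s * x)%:C%C)^-1.
  have tx : t * x = K%:R * (s * x).
    by rewrite /s mulrA [K%:R * _]mulrC divfK// gt_eqF.
  have sx : `|s * x| <= s * c by rewrite normrM gtr0_norm// ler_pM2l.
  have sc1 : s * c <= 1 by rewrite /s mulrAC ler_pdivrMr// mul1r.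
  have h1 := cis_euler (le_trans sx sc1).
  have b1 : normc b <= 1.
    rewrite normcV invf_le1 ?normc_1D_ix//.
    exact: lt_le_trans (normc_1D_ix _).
  have h2 : normc (cis (t * x) - b ^+ K) <= 3 * (t * c) ^+ 2 / K%:R.
    rewrite tx cisMn subrXX normcM.
    apply: (@le_trans _ _ (3 * (s * c) ^+ 2 * K%:R)); last first.
      by rewrite /s !exprMn exprVn le_eqVlt; apply/orP; left; apply/eqP; field; 
         rewrite gt_eqF.
    apply: ler_pM; rewrite ?normc_ge0//.
      apply: le_trans h1 _; rewrite ler_pM2l//.
      by rewrite -real_normK ?num_real// lerXn2r// nnegrE// mulr_ge0// ltW.
    apply: le_trans (normc_sum _ _ _) _.
    have -> : K%:R = \sum_(i < K) 1 :> R by rewrite sumr_const card_ord.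
    apply: ler_sum => j _.
    rewrite normcM !normcX normc_cis expr1n mul1r.
    by rewrite exprn_ile1// normc_ge0.
  have h3 := resolvent_sum K2 KM s0 x.
  rewrite -/b in h3.
  have h4 : expR 1 * K%:R * rho ^+ M <= (t * c) ^+ 2 / K%:R.
    have /ltW := HM0 M (leq_maxl _ _).
    by rewrite /e ler_pdivlMr ?mulr_gt0 ?expR_gt0// mulrC.
  rewrite -[cis _ - _](subrKA (b ^+ K)).
  apply: le_trans (normcD _ _) _; rewrite -/rho in h3.
  apply: le_trans (lerD h2 (le_trans h3 h4)) _.
  by rewrite le_eqVlt; apply/orP; left; apply/eqP; ring.
Qed.

End ResolventApproxCis.

(** * Solutions of the eigenvalue equation *)

Section Green.
Context {R : realType}.
Local Notation C := R[i].
Implicit Types (z : C) (V : nat -> R) (u v : nat -> C).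

Fixpoint sol v (a b : C) (k : nat) {struct k} : C :=
  if k is k1.+1 then
    if k1 is k2.+1 then v k2 * sol v a b k1 - sol v a b k2 else b
  else a.

Lemma solSS v a b k : sol v a b k.+2 = v k * sol v a b k.+1 - sol v a b k.
Proof. by []. Qed.

(** Real initial data make the flux of the solution vanish at the origin; above
the real axis it is therefore nonnegative further on. *)
Definition growth v (N : nat) (X : R) : Prop :=
  exists a b : R, [/\ `|a| <= 1, `|b| <= 1 &
  exists2 n, (0 < n <= N)%N & X <= normc (sol v a%:C%C b%:C%C n)].

(** The current of [u], which increases along solutions at energies above the real
axis. *)
Definition flux u k : R := complex.Im (conjc (u k) * u k.+1).

Lemma flux_step V z u k : u k.+2 = (z - (V k)%:C%C) * u k.+1 - u k ->
  flux u k.+1 = flux u k + complex.Im z * normc (u k.+1) ^+ 2.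
Proof.
rewrite /flux => ->; rewrite normc_sqr.
by case: (u k) (u k.+1) z => [a b] [c d] [e f]; simpc => /=; ring.
Qed.

Lemma flux_le u k : `|flux u k| <= normc (u k) * normc (u k.+1).
Proof.
by rewrite (le_trans (normc_Im _))// normcM normc_conj.
Qed.

Section HalfLine.
Variables (V : nat -> R) (z : C) (u : nat -> C) (m : nat).
Local Notation eta := (complex.Im z).
Hypotheses (eta0 : 0 < eta)
  (ueq : forall k, (k < m)%N -> u k.+2 = (z - (V k)%:C%C) * u k.+1 - u k)
  (uend : u m.+1 = 0).

Lemma flux_half n : (n <= m)%N ->
  flux u n = - (eta * \sum_(n <= j < m) normc (u j.+1) ^+ 2).
Proof.
move=> nm; rewrite -(subKn nm); have : (m - n <= m)%N by rewrite leq_subr.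
elim: (m - n)%N => [|j IH] jm.
  by rewrite subn0 big_geq// mulr0 oppr0 /flux uend mulr0.
have lt : (m - j.+1 < m)%N by rewrite ltn_subrL (leq_trans _ jm).
have := flux_step (ueq lt); have E : (m - j.+1).+1 = (m - j)%N by rewrite subnSK.
rewrite E (IH (ltnW jm)) (big_ltn lt) E => h.
by rewrite mulrDr; lra.
Qed.

Lemma half_sum_ge n k : (n <= k < m)%N ->
  normc (u k.+1) ^+ 2 <= \sum_(n <= j < m) normc (u j.+1) ^+ 2.
Proof.
move=> /andP[nk km].
rewrite (big_cat_nat nk (ltnW km)) (big_ltn km)/= addrCA lerDl addr_ge0//;
  by apply: sumr_ge0 => j _; rewrite exprn_ge0 ?normc_ge0.
Qed.

(** [eta] times the mass beyond [n] is the flux through [n], hence at most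
[normc (u n) * normc (u n.+1)]; so [eta ^ 2] times this mass is at most
[normc (u n) ^ 2]. *)
Lemma half_decay n k : (n < k <= m)%N -> normc (u k) <= normc (u n) / eta.
Proof.
case: k => // k /andP[nk km]; rewrite ltnS in nk.
have nm : (n < m)%N by apply: leq_ltn_trans nk km.
rewrite ler_pdivlMr// mulrC.
set S := \sum_(n <= j < m) normc (u j.+1) ^+ 2.
have S1 : normc (u k.+1) ^+ 2 <= S by apply: half_sum_ge; rewrite nk.
have S2 : normc (u n.+1) ^+ 2 <= S by apply: half_sum_ge; rewrite leqnn.
have S0 : 0 <= S by apply: le_trans S1; rewrite exprn_ge0 ?normc_ge0.
have := flux_le u n; rewrite flux_half ?(ltnW nm)// normrN ger0_norm; last first.
  by rewrite mulr_ge0// ltW.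
rewrite -/S => hS.
have [S00|Spos] := eqVneq S 0.
  have -> : normc (u k.+1) = 0.
    apply/eqP; rewrite -sqrf_eq0 eq_le exprn_ge0 ?normc_ge0// andbT.
    by rewrite -S00.
  by rewrite mulr0 normc_ge0.
have {}Spos : 0 < S by rewrite lt_neqAle eq_sym Spos.
have h2 : eta ^+ 2 * S <= normc (u n) ^+ 2.
  rewrite -(ler_pM2r Spos).
  apply: (@le_trans _ _ ((eta * S) ^+ 2)); first by rewrite exprMn -mulrA.
  apply: (@le_trans _ _ ((normc (u n) * normc (u n.+1)) ^+ 2)).
    rewrite lerXn2r// nnegrE; rewrite ?mulr_ge0 ?normc_ge0//; exact: ltW.
  by rewrite exprMn ler_wpM2l// exprn_ge0 ?normc_ge0.
rewrite -ler_sqr ?nnegrE ?mulr_ge0 ?normc_ge0 ?(ltW eta0)//.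
by apply: le_trans h2; rewrite exprMn ler_wpM2l// exprn_ge0// ltW.
Qed.

(** The Wronskian of the decaying solution [u] and the growing solution [w] is
constant. Their fluxes have opposite signs, so that the contributions of both to
the Wronskian at [n] add up instead of cancelling. *)
Lemma half_wronskian a b n : (0 < n <= m)%N ->
  eta * (normc (u n) * normc (sol (fun k => z - (V k)%:C%C) a%:C%C b%:C%C n))
  <= normc (u 1 * a%:C%C - u 0 * b%:C%C).
Proof.
set w := sol _ _ _ => /andP[n0 nm].
have W k : (k <= m)%N ->
    u k.+1 * w k - u k * w k.+1 = u 1 * a%:C%C - u 0 * b%:C%C.
  elim: k => [//|k IH] km; rewrite -(IH (ltnW km)) /w solSS ueq//.
  by ring.
have Jw k : complex.Im z * normc (w k.+1) ^+ 2 <= flux w k.+1.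
  have J0 : flux w 0 = 0 by rewrite /flux /w /=; simpc.
  have st i : flux w i.+1 = flux w i + eta * normc (w i.+1) ^+ 2.
    by apply: flux_step; rewrite /w solSS.
  rewrite st lerDr; elim: k => [|k IH]; first by rewrite J0.
  by rewrite st addr_ge0// mulr_ge0 ?exprn_ge0 ?normc_ge0// ltW.
have Ju : flux u n <= 0.
  rewrite flux_half// oppr_le0 mulr_ge0 ?(ltW eta0)//.
  by apply: sumr_ge0 => j _; rewrite exprn_ge0 ?normc_ge0.
rewrite -(W n nm).
have [E|ne] := eqVneq (normc (u n) * normc (w n)) 0.
  by rewrite E mulr0 normc_ge0.
have pos : 0 < normc (u n) * normc (w n).
  by rewrite lt_neqAle eq_sym ne mulr_ge0 ?normc_ge0.
rewrite -(ler_pM2l pos).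
have -> : normc (u n) * normc (w n) * normc (u n.+1 * w n - u n * w n.+1) =
   normc (conjc (u n) * conjc (w n) * (u n.+1 * w n - u n * w n.+1)).
  by rewrite [RHS]normcM normcM !normc_conj.
apply: le_trans (normc_Im _); rewrite -normrN; apply: le_trans (ler_norm _).
have -> : complex.Im (conjc (u n) * conjc (w n) * (u n.+1 * w n - u n * w n.+1)) =
    normc (w n) ^+ 2 * flux u n - normc (u n) ^+ 2 * flux w n.
  rewrite /flux !normc_sqr.
  by case: (u n) (u n.+1) (w n) (w n.+1) => [? ?] [? ?] [? ?] [? ?]; simpc => /=; ring.
case: n n0 nm {ne pos} Ju => // n _ nm Ju.
have := ler_wpM2l (exprn_ge0 2 (normc_ge0 (u n.+1))) (Jw n).
have := mulr_ge0_le0 (exprn_ge0 2 (normc_ge0 (w n.+1))) Ju.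
set A := _ * flux u _; set B := _ * flux w _ => hA hB.
rewrite opprB; apply: le_trans (_ : B <= _); last by lra.
by apply: le_trans hB; rewrite le_eqVlt; apply/orP; left; apply/eqP; ring.
Qed.

(** The decaying solution is small where the growing one is large, by
[half_wronskian], and stays small from there on, by [half_decay]. *)
Lemma half_green N X (e : R) : 0 < e <= 1 -> e <= eta -> 0 < X -> (N <= m)%N ->
  growth (fun k => z - (V k)%:C%C) N X ->
  normc (u 0) <= e^-1 -> normc (u 1) <= e^-1 ->
  forall k, (N <= k <= m)%N -> normc (u k) <= 2 / (e ^+ 3 * X).
Proof.
move=> /andP[e0 e1] ee X0 Nm [a [b [a1 b1 [n /andP[n0 nN] hX]]]] u0 u1 k /andP[Nk km].
have nm : (n <= m)%N by apply: leq_trans Nm.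
have H := @half_wronskian a b n; rewrite n0 nm in H; have {}H := H isT.
set w := normc (sol _ _ _ _) in H hX.
have W2 : normc (u 1 * a%:C%C - u 0 * b%:C%C) <= 2 / e.
  rewrite (le_trans (normcB _ _))// !normcM !normc_real.
  have := normc_ge0 (u 0); have := normc_ge0 (u 1); have := normr_ge0 a.
  by have := normr_ge0 b; nra.
have un0 := normc_ge0 (u n).
have un : normc (u n) <= 2 / (e ^+ 2 * X).
  have h : e * (normc (u n) * X) <= 2 / e.
    apply: le_trans W2; apply: le_trans H; apply: ler_pM => //.
      exact: ltW.
      by rewrite mulr_ge0// ltW.
    by rewrite ler_wpM2l.
  rewrite ler_pdivlMr ?mulr_gt0 ?exprn_gt0//.
  move: h; rewrite ler_pdivlMr// => h.
  by apply: le_trans h; rewrite le_eqVlt; apply/orP; left; apply/eqP; ring.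
have un' : normc (u n) / e <= 2 / (e ^+ 3 * X).
  rewrite ler_pdivrMr//; apply: le_trans un _.
  by rewrite le_eqVlt; apply/orP; left; apply/eqP; field; rewrite !gt_eqF.
have : (n <= k)%N by apply: leq_trans Nk.
rewrite leq_eqVlt => /orP[/eqP <-|nk].
  by apply: le_trans un'; rewrite ler_pdivlMr// ler_piMr.
apply: le_trans un'; apply: (@le_trans _ _ (normc (u n) / eta)).
  by apply: half_decay; rewrite nk.
by rewrite ler_wpM2l// lef_pV2// posrE.
Qed.

End HalfLine.

(** The a priori bound [1 / Im z]: [Im z] times the mass of the Green function on
both half lines is the imaginary part of its value at the origin. *)
Lemma green_bound (Vr Vl : nat -> R) (V0 : R) z (r l : nat -> C) m :
  0 < complex.Im z ->
  (forall k, (k < m)%N -> r k.+2 = (z - (Vr k)%:C%C) * r k.+1 - r k) ->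
  (forall k, (k < m)%N -> l k.+2 = (z - (Vl k)%:C%C) * l k.+1 - l k) ->
  r m.+1 = 0 -> l m.+1 = 0 -> r 0 = l 0 ->
  r 1 + l 1 = 1 + (z - V0%:C%C) * r 0 ->
  forall k, (k <= m)%N -> normc (r k) <= (complex.Im z)^-1.
Proof.
set eta := complex.Im z => eta0 req leq0 rend lend rl center.
have Fr := flux_half req rend (leq0n m).
have Fl := flux_half leq0 lend (leq0n m).
set Sr := \sum_(_ <= j < _) _ in Fr; set Sl := \sum_(_ <= j < _) _ in Fl.
have Sl0 : 0 <= Sl by apply: sumr_ge0 => j _; rewrite exprn_ge0 ?normc_ge0.
have Sr0 : 0 <= Sr by apply: sumr_ge0 => j _; rewrite exprn_ge0 ?normc_ge0.
have E : eta * (Sr + Sl + normc (r 0) ^+ 2) = complex.Im (r 0).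
  have : flux r 0 + flux l 0 = complex.Im (conjc (r 0) * (r 1 + l 1)).
    by rewrite /flux -rl mulrDr ImD.
  rewrite center Fr Fl -/eta normc_sqr /eta.
  by case: (r 0) (z) => [a b] [c d]; simpc => /= h; lra.
have I0 : complex.Im (r 0) <= normc (r 0).
  by apply: le_trans (normc_Im _); exact: ler_norm.
have n0 := normc_ge0 (r 0).
have r0 : normc (r 0) * eta <= 1.
  have [->|ne] := eqVneq (normc (r 0)) 0; first by rewrite mul0r.
  have pos : 0 < normc (r 0) by rewrite lt_neqAle eq_sym ne.
  rewrite -(ler_pM2l pos) mulr1; apply: le_trans I0; rewrite -E.
  rewrite mulrA -expr2 [leLHS]mulrC ler_pM2l// lerDr addr_ge0//.
case=> [|k] km; first by rewrite -ler_pdivlMr// mul1r in r0.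
have h1 : normc (r k.+1) ^+ 2 <= Sr by apply: half_sum_ge; rewrite leq0n.
rewrite -ler_sqr ?nnegrE ?normc_ge0 ?invr_ge0 ?(ltW eta0)//.
apply: le_trans h1 _; rewrite -(ler_pM2l eta0).
apply: (@le_trans _ _ (eta * (Sr + Sl + normc (r 0) ^+ 2))).
  rewrite ler_pM2l// -addrA lerDl addr_ge0// exprn_ge0//.
rewrite E; apply: le_trans I0 _; rewrite expr2 mulrA mulfV ?gt_eqF// mul1r.
by rewrite -ler_pdivlMr// mul1r in r0.
Qed.

End Green.

(** * Functional calculus of normal matrices *)

Section FunctionalCalculus.
Variables (C : numClosedFieldType) (n : nat) (P : 'M[C]_n).
Hypothesis (Punitary : P \is unitarymx).
Implicit Types (f g : 'I_n -> C).

(** The normal matrix with eigenvalues [f] and eigenvectors the rows of [P],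
conjugated. *)
Definition fcalc f : 'M[C]_n := invmx P *m diag_mx (\row_k f k) *m P.

Let Pu : P \in unitmx. Proof. exact: unitarymx_unit. Qed.

Let PVE i k : invmx P i k = (P k i)^*.
Proof. by rewrite invmx_unitary// !mxE. Qed.

Lemma fcalcE f i j : fcalc f i j = \sum_k (P k i)^* * f k * P k j.
Proof.
by rewrite mxE; apply: eq_bigr => k _; rewrite mul_mx_diag !mxE PVE.
Qed.

Lemma fcalc1 : fcalc (fun=> 1) = 1%:M.
Proof.
rewrite /fcalc (_ : diag_mx _ = 1%:M) ?mulmx1 ?mulVmx//.
by apply/matrixP => i j; rewrite !mxE.
Qed.

Lemma fcalcM f g : fcalc f *m fcalc g = fcalc (fun k => f k * g k).
Proof.
rewrite /fcalc -!mulmxA; congr (_ *m _); rewrite mulKVmx// mulmxA.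
by congr (_ *m _); apply/matrixP => k l; rewrite mul_diag_mx !mxE mulrnAr.
Qed.

Lemma fcalcZ a f i j : fcalc (fun k => a * f k) i j = a * fcalc f i j.
Proof.
rewrite !fcalcE big_distrr /=; apply: eq_bigr => k _.
by rewrite mulrCA !mulrA.
Qed.

Lemma fcalc_sum I (r : seq I) (F : I -> 'I_n -> C) i j :
  fcalc (fun k => \sum_(a <- r) F a k) i j = \sum_(a <- r) fcalc (F a) i j.
Proof.
rewrite fcalcE [RHS](eq_bigr (fun a => \sum_k (P k i)^* * F a k * P k j)).
  rewrite exchange_big /=; apply: eq_bigr => k _.
  by rewrite big_distrr big_distrl.
by move=> a _; rewrite fcalcE.
Qed.

Lemma fcalcB f g i j :
  fcalc (fun k => f k - g k) i j = fcalc f i j - fcalc g i j.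
Proof.
rewrite !fcalcE -sumrB; apply: eq_bigr => k _.
by rewrite mulrBr mulrBl.
Qed.

Lemma fcalc_resolvent (e : 'I_n -> C) z i j : (forall k, e k - z != 0) ->
  (fcalc e *m fcalc (fun k => (e k - z)^-1)) i j =
  (i == j)%:R + z * fcalc (fun k => (e k - z)^-1) i j.
Proof.
move=> ez; rewrite fcalcM -fcalcZ.
have <- : fcalc (fun=> 1) i j = (i == j)%:R by rewrite fcalc1 mxE.
rewrite !fcalcE -big_split /=; apply: eq_bigr => k _.
rewrite -mulrDl -mulrDr; congr (_ * _ * _).
by apply: (mulIf (ez k)); rewrite mulrDl -!mulrA mulVf// !mulr1 mul1r subrK.
Qed.

Lemma fcalc_split f g i j :
  fcalc f i j = fcalc (fun k => f k - g k) i j + fcalc g i j.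
Proof. by rewrite fcalcB subrK. Qed.

Lemma fcalc_powS (e : 'I_n -> C) a p i j :
  a * (fcalc e *m fcalc (fun k => (a * e k) ^+ p)) i j =
  fcalc (fun k => (a * e k) ^+ p.+1) i j.
Proof.
rewrite fcalcM -fcalcZ !fcalcE; apply: eq_bigr => k _.
by rewrite exprS !mulrA.
Qed.

Lemma fcalc_lin I (r : seq I) (c : I -> C) (F : I -> 'I_n -> C) i j :
  fcalc (fun k => \sum_(a <- r) c a * F a k) i j
  = \sum_(a <- r) c a * fcalc (F a) i j.
Proof. by rewrite fcalc_sum; apply: eq_bigr => a _; rewrite fcalcZ. Qed.

Lemma col_norm j : \sum_k `|P k j| ^+ 2 = 1.
Proof.
have : (invmx P *m P) j j = 1 by rewrite mulVmx// mxE eqxx.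
rewrite mxE => <-; apply: eq_bigr => k _.
by rewrite PVE mulrC -normCK.
Qed.

Lemma fcalc_bound f (B : C) i j : (forall k, `|f k| <= B) ->
  `|fcalc f i j| <= B.
Proof.
move=> fB; rewrite fcalcE; apply: le_trans (ler_norm_sum _ _ _) _.
apply: (@le_trans _ _ (\sum_k B * ((`|P k i| ^+ 2 + `|P k j| ^+ 2) / 2))).
  apply: ler_sum => k _; rewrite !normrM norm_conjC.
  rewrite mulrAC mulrC; apply: ler_pM; rewrite ?mulr_ge0//.
  rewrite ler_pdivlMr// -subr_ge0.
  rewrite [X in 0 <= X](_ : _ = (`|P k i| - `|P k j|) ^+ 2); last by ring.
  by rewrite real_exprn_even_ge0// rpredB ?normr_real.
rewrite -big_distrr -big_distrl big_split /= !col_norm -[1 + 1]/2 divff ?mulr1//.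
Qed.

(** In the orthonormal basis [P] the column [j] of [fcalc f] has coordinates
[f k * P k j]. *)
Lemma fcalc_norm_ge f (B : C) j : 0 <= B -> (forall k, B <= `|f k|) ->
  B ^+ 2 <= \sum_i `|fcalc f i j| ^+ 2.
Proof.
move=> B0 fB.
pose g := P *m fcalc f.
have gE k : g k j = f k * P k j.
  by rewrite /g /fcalc -mulmxA mulKVmx// mul_diag_mx !mxE.
have fE i : fcalc f i j = \sum_k (P k i)^* * g k j.
  by rewrite fcalcE; apply: eq_bigr => k _; rewrite gE mulrA.
have -> : \sum_i `|fcalc f i j| ^+ 2 = \sum_k `|g k j| ^+ 2.
  transitivity (\sum_i \sum_k (g k j)^* * (P k i * fcalc f i j)).
    apply: eq_bigr => i _; rewrite normCK {2}fE rmorph_sum big_distrr /=.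
    apply: eq_bigr => k _.
    have -> : ((P k i)^* * g k j)^* = P k i * (g k j)^*.
      by rewrite rmorphM /= conjCK.
    by ring.
  rewrite exchange_big /=; apply: eq_bigr => k _.
  rewrite -big_distrr /= normCK mulrC; congr (_ * _).
  by rewrite /g mxE.
apply: (@le_trans _ _ (\sum_k B ^+ 2 * `|P k j| ^+ 2)).
  by rewrite -big_distrr /= col_norm mulr1.
apply: ler_sum => k _; rewrite gE normrM exprMn.
by rewrite ler_wpM2r ?exprn_ge0// lerXn2r// nnegrE.
Qed.

(** Compare both sides of the eigenvector equation at the largest coordinate. *)
Lemma eigval_bound (H : 'M[C]_n) (e : 'I_n -> C) (c : C) : H = fcalc e ->
  (forall j, \sum_i `|H i j| <= c) -> forall k, `|e k| <= c.
Proof.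
move=> HE Hc k.
have PH : P *m H = diag_mx (\row_k e k) *m P.
  by rewrite HE /fcalc -mulmxA mulKVmx.
have row j : e k * P k j = \sum_i P k i * H i j.
  by have /matrixP/(_ k j) := PH; rewrite mul_diag_mx !mxE => <-.
have [j jmax] : exists j, forall i, `|P k i| <= `|P k j|.
  have : exists2 j, j \in enum 'I_n & forall i, i \in enum 'I_n -> `|P k i| <= `|P k j|.
    have : enum 'I_n != [::] by rewrite -size_eq0 size_enum_ord -lt0n (leq_trans _ (ltn_ord k)).
    elim: (enum 'I_n) => // a s IH _; have [->|/IH[j js jm]] := eqVneq s [::].
      by exists a; rewrite ?inE// => i; rewrite inE => /eqP ->.
    have : (`|P k a| <= `|P k j|) || (`|P k j| <= `|P k a|).
      by apply: real_leVge; rewrite normr_real.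
    case/orP => h; [exists j|exists a] => [|i|//|i]; rewrite !inE ?js ?orbT ?eqxx// =>
      /orP[/eqP->//|/jm//] h'; exact: le_trans h.
  by case=> j _ jm; exists j => i; apply: jm; rewrite mem_enum.
have Pj : 0 < `|P k j|.
  rewrite normr_gt0; apply/eqP => P0.
  have z i : P k i = 0.
    by apply/eqP; rewrite -normr_le0 (le_trans (jmax i))// P0 normr0.
  have : (P *m invmx P) k k = 1 by rewrite mulmxV// mxE eqxx.
  rewrite mxE big1 => [/eqP|i _]; last by rewrite z mul0r.
  by rewrite eq_sym oner_eq0.
rewrite -(ler_pM2r Pj) -normrM row.
apply: le_trans (ler_norm_sum _ _ _) _.
apply: (@le_trans _ _ (\sum_i `|P k j| * `|H i j|)).
  by apply: ler_sum => i _; rewrite normrM ler_wpM2r.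
by rewrite -big_distrr /= mulrC ler_wpM2r.
Qed.

End FunctionalCalculus.

Lemma hermitian_fcalc (C : numClosedFieldType) n (H : 'M[C]_n) :
  H \is hermsymmx -> exists (P : 'M[C]_n) (e : 'I_n -> C),
  [/\ P \is unitarymx, forall k, e k \is Num.real & H = fcalc P e].
Proof.
move=> Hh; exists (spectralmx H), (fun k => spectral_diag H 0 k).
have /hermitian_normalmx /orthomx_spectralP E := Hh.
have /mxOverP rl := hermitian_spectral_diag_real Hh.
split; [exact: spectral_unitarymx|by move=> k; exact: rl|].
rewrite [LHS]E /fcalc; congr (_ *m diag_mx _ *m _); apply/rowP => k.
by rewrite mxE.
Qed.

(** * Finite boxes *)

Section Box.
Context {R : realType}.
Local Notation C := R[i].
Variables (V : int -> R) (m : nat).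
Local Notation I := 'I_(m.*2.+1).

Definition site (i : I) : int := i%:Z - m%:Z.
Definition box_index (n : int) : I := inord `|(n + m%:Z)%R|%N.

Lemma site_le i : (`|site i| <= m)%N.
Proof. by rewrite /site; have := ltn_ord i; move: (nat_of_ord i) => {}i; lia. Qed.

Lemma box_indexK n : (`|n| <= m)%N -> site (box_index n) = n.
Proof. by move=> h; rewrite /site inordK; lia. Qed.

Lemma siteK i : box_index (site i) = i.
Proof.
apply: val_inj; rewrite /= inordK /site; have := ltn_ord i;
  by move: (nat_of_ord i) => {}i; lia.
Qed.

Definition boxH : 'M[C]_(m.*2.+1) := \matrix_(i, j)
  ((V (site i))%:C%C * (i == j)%:R + (j == i.+1 :> nat)%:R + (i == j.+1 :> nat)%:R).

Lemma boxH_herm : boxH \is hermsymmx.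
Proof.
apply/is_hermitianmxP; rewrite expr0 scale1r; apply/matrixP => i j; rewrite !mxE.
rewrite !rmorphD rmorphM /= !conjC_nat.
have -> : ((V (site j))%:C%C)^* = (V (site j))%:C%C :> C.
  by apply/CrealP/complex_realP; exists (V (site j)).
rewrite addrAC; congr (_ + _ + _).
by rewrite eq_sym; case: eqVneq => [->//|_]; rewrite !mulr0.
Qed.

Lemma boxH_mul (y : int -> C) i : (forall n : int, (m < `|n|)%N -> y n = 0) ->
  \sum_j boxH i j * y (site j) =
  y (site i + 1) + y (site i - 1) + (V (site i))%:C%C * y (site i).
Proof.
move=> y0.
have pick (P : pred nat) (n : int) :
    (forall j : I, P j = (site j == n)) ->
    \sum_(j : I) (P j)%:R * y (site j) = y n.
  move=> PE; have [nm|nm] := leqP `|n|%N m.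
    rewrite (bigD1 (box_index n))//= PE box_indexK// eqxx mul1r big1 ?addr0// => j jn.
    rewrite PE; case: eqVneq => [e|_]; last by rewrite mul0r.
    by rewrite -e siteK eqxx in jn.
  rewrite y0// big1// => j _; rewrite PE; case: eqVneq => [e|_]; last by rewrite mul0r.
  by have := site_le j; rewrite e leqNgt nm.
transitivity (\sum_j ((V (site i))%:C%C * (i == j)%:R) * y (site j)
   + \sum_(j : I) (j == i.+1 :> nat)%:R * y (site j)
   + \sum_(j : I) (i == j.+1 :> nat)%:R * y (site j)).
  by rewrite -!big_split /=; apply: eq_bigr => j _; rewrite mxE !mulrDl.
rewrite (pick (fun j => j == i.+1) (site i + 1)); last first.
  by move=> j; rewrite /site; move: (nat_of_ord i) (nat_of_ord j) => a b; lia.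
rewrite (pick (fun j => nat_of_ord i == j.+1) (site i - 1)); last first.
  by move=> j; rewrite /site; move: (nat_of_ord i) (nat_of_ord j) => a b; lia.
rewrite (bigD1 i)//= eqxx mulr1 big1 ?addr0; last first.
  by move=> j; rewrite eq_sym => /negPf ->; rewrite mulr0 mul0r.
by rewrite -addrA addrC.
Qed.

Lemma boxH_col_sum c j : (forall n, `|V n| <= c) ->
  \sum_i normc (boxH i j) <= c + 2.
Proof.
move=> Vc.
apply: (@le_trans _ _ (\sum_i (c * (i == j)%:R + (j == i.+1 :> nat)%:R
   + (i == j.+1 :> nat)%:R))).
  apply: ler_sum => i _; rewrite mxE (le_trans (normcD _ _))// normc_nat lerD2r.
  rewrite (le_trans (normcD _ _))// normc_nat lerD2r.
  by rewrite normcM normc_real normc_nat ler_wpM2r.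
have le1 (P : pred nat) (i0 : nat) : (forall i : I, P i -> i = i0 :> nat) ->
    \sum_(i : I) (P i)%:R <= 1 :> R.
  move=> PE; have [h|h] := boolP [exists i : I, P i]; last first.
    rewrite big1// => i _; case: (boolP (P i)) => // Pi.
    by case/existsP: h; exists i.
  have [i1 Pi1] := existsP h.
  rewrite (bigD1 i1)//= Pi1 big1 ?addr0// => i ii; case: (boolP (P i)) => // Pi.
  by case/eqP: ii; apply: val_inj; rewrite /= (PE i)// (PE i1).
rewrite !big_split /= -addrA; apply: lerD.
  rewrite (bigD1 j)//= eqxx mulr1 big1 ?addr0// => i /negPf ->; exact: mulr0.
rewrite (_ : 2 = 1 + 1)//; apply: lerD.
  by apply: (le1 (fun i => nat_of_ord j == i.+1) j.-1) => i /eqP ->.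
by apply: (le1 (fun i => i == j.+1) j.+1) => i /eqP ->.
Qed.

(** A column of the resolvent, extended by 0, solves the eigenvalue equation on
each of the two half lines and vanishes beyond the box: [half_green] applies to
both sides. *)
Lemma box_green (P : 'M[C]_(m.*2.+1)) (ev : I -> C) z N X (e : R) :
  P \is unitarymx -> boxH = fcalc P ev -> (forall k, ev k - z != 0) ->
  0 < e <= 1 -> e <= complex.Im z -> 0 < X -> (0 < m)%N -> (N <= m)%N ->
  growth (fun k => z - (V k.+1%:Z)%:C%C) N X ->
  growth (fun k => z - (V (- k.+1%:Z))%:C%C) N X ->
  forall n : int, (N <= `|n| <= m)%N ->
  normc (fcalc P (fun k => (ev k - z)^-1) (box_index n) (box_index 0))
    <= 2 / (e ^+ 3 * X).
Proof.
move=> Pu HE evz e01 ez X0 mpos Nm gr gl.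
set G := fcalc P _.
pose y (n : int) : C :=
  if (`|n| <= m)%N then G (box_index n) (box_index 0) else 0.
have y0 (n : int) : (m < `|n|)%N -> y n = 0.
  by rewrite /y ltnNge => /negPf ->.
have Hy (n : int) : (`|n| <= m)%N ->
    y (n + 1) + y (n - 1) + (V n)%:C%C * y n = (n == 0)%:R + z * y n.
  move=> nm; have := boxH_mul (box_index n) y0; rewrite box_indexK// => <-.
  have -> : \sum_j boxH (box_index n) j * y (site j)
      = (boxH *m G) (box_index n) (box_index 0).
    by rewrite mxE; apply: eq_bigr => j _; rewrite /y site_le siteK.
  rewrite /y nm {1}HE /G (fcalc_resolvent Pu _ _ evz); congr (_%:R + _).
  have [->|n0] := eqVneq n 0; first by rewrite eqxx.
  case: eqVneq => // /(congr1 site); rewrite !box_indexK// => h.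
  by rewrite h eqxx in n0.
pose r (k : nat) := y k%:Z; pose l (k : nat) := y (- k%:Z).
have req k : (k < m)%N -> r k.+2 = (z - (V k.+1%:Z)%:C%C) * r k.+1 - r k.
  move=> km; have := Hy k.+1%:Z km; rewrite /r.
  have -> : k.+1%:Z + 1 = k.+2%:Z by lia.
  have -> : k.+1%:Z - 1 = k%:Z by lia.
  have -> : (k.+1%:Z == 0) = false by [].
  rewrite add0r => /eqP h; apply/eqP; rewrite -subr_eq0; rewrite -subr_eq0 in h.
  by apply/eqP; move/eqP: h => <-; ring.
have lreq k : (k < m)%N -> l k.+2 = (z - (V (- k.+1%:Z))%:C%C) * l k.+1 - l k.
  move=> km; have := Hy (- k.+1%:Z); rewrite /l abszN => /(_ km).
  have -> : - k.+1%:Z + 1 = - k%:Z by lia.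
  have -> : - k.+1%:Z - 1 = - k.+2%:Z by lia.
  have -> : (- k.+1%:Z == 0) = false by [].
  rewrite add0r => /eqP h; apply/eqP; rewrite -subr_eq0; rewrite -subr_eq0 in h.
  by apply/eqP; move/eqP: h => <-; ring.
have rend : r m.+1 = 0 by rewrite /r y0//=.
have lend : l m.+1 = 0 by rewrite /l y0// abszN.
have rl : r 0 = l 0 by rewrite /r /l oppr0.
have ctr : r 1 + l 1 = 1 + (z - (V 0)%:C%C) * r 0.
  have := Hy 0 isT; rewrite eqxx -[true%:R]/(1 : C) add0r sub0r => h.
  rewrite /r /l; apply/eqP; rewrite -subr_eq0; move/eqP: h; rewrite -subr_eq0.
  by move=> h; rewrite -[X in _ == X](eqP h); apply/eqP; ring.
have eta0 : 0 < complex.Im z by apply: lt_le_trans ez; case/andP: e01.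
have inv_e : (complex.Im z)^-1 <= e^-1.
  by rewrite lef_pV2 ?posrE//; case/andP: e01.
have br k : (k <= m)%N -> normc (r k) <= e^-1.
  move=> km; apply: le_trans inv_e.
  exact: (green_bound eta0 req lreq rend lend rl ctr km).
have bl k : (k <= m)%N -> normc (l k) <= e^-1.
  move=> km; apply: le_trans inv_e.
  apply: (green_bound eta0 lreq req lend rend (esym rl) (V0 := V 0) _ km).
  by rewrite addrC -rl.
have Br := half_green eta0 req rend e01 ez X0 Nm gr (br 0%N (leq0n _)) (br 1%N mpos).
have Bl := half_green eta0 lreq lend e01 ez X0 Nm gl (bl 0%N (leq0n _)) (bl 1%N mpos).
move=> n /andP[Nn nm].
have -> : G (box_index n) (box_index 0) = y n by rewrite /y nm.
case: n Nn nm => n Nn nm; first by apply: Br; rewrite Nn.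
by rewrite NegzE; apply: Bl; rewrite Nn.
Qed.

End Box.

(** * The time evolution inside a box *)

Section Dynamics.
Context {R : realType}.
Local Notation C := R[i].
Variables (V : int -> R).

(** The generator [-itH] of the evolution, for a potential [V] on the line. *)
Definition hop (t : R) (u : int -> C) (n : int) : C :=
  - 'i%C * t%:C%C * (u (n + 1) + u (n - 1) + (V n)%:C%C * u n).

Definition psum (t : R) (L : nat) (n : int) : C :=
  \sum_(0 <= k < L) (k`!)%:R^-1 * iter k (hop t) (delta 0) n.

Lemma iter_hop_supp t k (n : int) : (k < `|n|)%N -> iter k (hop t) (delta 0) n = 0.
Proof.
elim: k n => [|k IH] n kn; first by rewrite /= /delta; case: eqVneq kn => // ->.
have h1 : (k < `|(n + 1)%R|)%N by clear IH; lia.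
have h2 : (k < `|(n - 1)%R|)%N by clear IH h1; lia.
by rewrite iterS /hop (IH _ h1) (IH _ h2) (IH n (ltnW kn)) mulr0 !addr0 mulr0.
Qed.

Section Bounded.
Variables (c0 : R).
Hypothesis (Vc : forall n, `|V n| <= c0).
Let c := c0 + 2.

Lemma iter_hop_le t k (n : int) : 0 <= t ->
  normc (iter k (hop t) (delta 0) n) <= (t * c) ^+ k.
Proof.
move=> t0; elim: k n => [|k IH] n.
  by rewrite /= /delta normc_nat expr0; case: (n == 0).
rewrite iterS /hop !normcM normcNE normc_i mul1r normc_real.
rewrite ger0_norm// exprS -mulrA ler_wpM2l//.
set B := (t * c) ^+ k in IH *.
apply: (@le_trans _ _ (B + B + c0 * B)); last by rewrite /c; lra.
have B0 : 0 <= B by apply: le_trans (IH n); exact: normc_ge0.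
rewrite (le_trans (normcD _ _))// lerD//.
  by rewrite (le_trans (normcD _ _))// lerD.
rewrite normcM normc_real.
by apply: ler_pM; rewrite ?normc_ge0.
Qed.

(** The [k]-th power of the generator moves by at most [k] sites, so that the
terms below [|n|] do not contribute at [n]. *)
Lemma psum_cauchy t L L' (n : int) : 0 <= t -> (L <= L')%N ->
  normc (psum t L' n - psum t L n) <= expR (2 * (t * c)) / 2 ^+ maxn L `|n|.
Proof.
move=> t0 LL.
have c0g : 0 <= c0 by apply: le_trans (Vc 0).
have tc0 : 0 <= t * c by rewrite mulr_ge0// addr_ge0.
apply: le_trans (exp_tail (maxn L `|n|) L' tc0).
rewrite /psum (big_cat_nat (n := L))//= addrAC subrr add0r.
have [h|h] := leqP L' (maxn L `|n|).
  rewrite [X in _ <= X]big_geq//.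
  move: h; rewrite leq_max => /orP[h|h].
    by rewrite big_geq// normc0.
  rewrite big_seq big1 ?normc0// => k.
  rewrite mem_index_iota => /andP[_ kL]; rewrite iter_hop_supp ?mulr0//.
  exact: leq_trans h.
rewrite (big_cat_nat (n := maxn L `|n|)) ?leq_maxl ?(ltnW h)//=.
rewrite [X in X + _]big_seq [X in X + _]big1 ?add0r => [|k]; last first.
  rewrite mem_index_iota => /andP[Lk km]; rewrite iter_hop_supp ?mulr0//.
  by move: km; rewrite leq_max => /orP[|//]; rewrite ltnNge Lk.
apply: le_trans (normc_sum _ _ _) _; apply: ler_sum => k _.
rewrite normcM normcV normc_nat mulrC.
by rewrite ler_wpM2r ?invr_ge0 ?ler0n// iter_hop_le.
Qed.

(** The powers of the generator applied to [delta 0] are those of the box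
Hamiltonian as long as they do not reach the walls. *)
Lemma psum_box t m : exists (P : 'M[C]_(m.*2.+1)) (ev : 'I_(m.*2.+1) -> R),
  [/\ P \is unitarymx, boxH V m = fcalc P (fun k => (ev k)%:C%C),
      forall k, `|ev k| <= c &
  forall L i, (L <= m.+1)%N -> psum t L (site i) =
      fcalc P (fun k => texp L (t * ev k)) i (box_index m 0)].
Proof.
have [P [e [Pu er HE]]] := hermitian_fcalc (boxH_herm V m).
have {er}E k : e k = (complex.Re (e k))%:C%C by rewrite RRe_real.
exists P, (fun k => complex.Re (e k)).
have HE' : boxH V m = fcalc P (fun k => (complex.Re (e k))%:C%C).
  by rewrite {1}HE; congr (fcalc P); apply/funext => k; rewrite -E.
split=> //.
  move=> k; have : `|e k| <= c%:C%C.
    apply: (eigval_bound Pu HE) => j; apply: (@le_trans _ _ (\sum_i normc (boxH V m i j))%:C%C).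
      rewrite rmorph_sum /=; apply: ler_sum => i _.
      by rewrite normc_def; case: (boxH V m i j).
    by rewrite lecR boxH_col_sum.
  rewrite {1}E normc_def lecR; apply: le_trans.
  by rewrite -sqrtr_sqr ler_wsqrtr//= lerDl sqr_ge0.
have step k i : (k <= m)%N -> iter k (hop t) (delta 0) (site i) =
    fcalc P (fun a => (- 'i%C * t%:C%C * (complex.Re (e a))%:C%C) ^+ k) i (box_index m 0).
  elim: k i => [|k IH] i km.
    have -> : (fun a => (- 'i%C * t%:C%C * (complex.Re (e a))%:C%C) ^+ 0) = (fun=> 1).
      by apply/funext => a; rewrite expr0.
    rewrite fcalc1// mxE /= /delta; congr (_%:R).
    congr nat_of_bool; apply/idP/idP => /eqP; [by move=> <-; rewrite siteK|by move=> ->; rewrite box_indexK].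
  rewrite iterS {1}/hop.
  have supp (n : int) : (m < `|n|)%N -> iter k (hop t) (delta 0) n = 0.
    by move=> h; apply: iter_hop_supp; apply: leq_trans h; apply: ltnW.
  rewrite -(boxH_mul V i supp).
  set g := fun a => (- 'i%C * t%:C%C * (complex.Re (e a))%:C%C) ^+ k.
  have -> : \sum_j boxH V m i j * iter k (hop t) (delta 0) (site j) =
      (boxH V m *m fcalc P g) i (box_index m 0).
    by rewrite mxE; apply: eq_bigr => j _; rewrite IH// ltnW.
  by rewrite {1}HE' (fcalc_powS Pu).
move=> L i Lm; rewrite /psum.
have -> : (fun k => texp L (t * complex.Re (e k))) = (fun k => \sum_(0 <= a < L)
    (a`!)%:R^-1 * (- 'i%C * t%:C%C * (complex.Re (e k))%:C%C) ^+ a).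
  apply/funext => k; apply: eq_bigr => a _.
  by rewrite [(t * _)%:C%C]rmorphM -mulrA.
rewrite (fcalc_lin Pu) big_seq [RHS]big_seq; apply: eq_bigr => k.
rewrite mem_index_iota => /andP[_ kL].
by rewrite step// -ltnS (leq_trans kL).
Qed.

Lemma fcalc_bound_normc n (P : 'M[C]_n) f (B : R) i j : P \is unitarymx ->
  (forall k, normc (f k) <= B) -> normc (fcalc P f i j) <= B.
Proof.
move=> Pu fB; have : `|fcalc P f i j| <= B%:C%C.
  apply: fcalc_bound => // k; rewrite normc_def lecR; apply: le_trans (fB k).
  by case: (f k).
by rewrite normc_def lecR; case: (fcalc P f i j).
Qed.

(** In the box the exact exponential is unitary, and the partial sum is close to it
by [texp_cis]. *)
Lemma psum_norm_ge t L m : 0 <= t -> (L <= m)%N ->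
  expR (2 * (t * c)) / 2 ^+ L <= 1 ->
  (1 - expR (2 * (t * c)) / 2 ^+ L) ^+ 2
    <= \sum_(i < m.*2.+1) normc (psum t L (site i)) ^+ 2.
Proof.
move=> t0 Lm; set eps := expR _ / _ => eps1.
have [P [ev [Pu HE evc psE]]] := psum_box t m.
have fB k : (1 - eps)%:C%C <= `|texp L (t * ev k)|.
  rewrite normc_def lecR; have -> : forall z : C, Num.sqrt (complex.Re z ^+ 2 + complex.Im z ^+ 2) = normc z.
    by case.
  have : normc (cis (t * ev k) - texp L (t * ev k)) <= eps.
    by apply: texp_cis; rewrite normrM ger0_norm// ler_wpM2l.
  have := normcD (cis (t * ev k) - texp L (t * ev k)) (texp L (t * ev k)).
  by rewrite subrK normc_cis; lra.
have B0 : 0 <= (1 - eps)%:C%C :> C by rewrite ler0c subr_ge0.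
have := fcalc_norm_ge Pu (box_index m 0) B0 fB.
rewrite -rmorphXn /=.
have -> : \sum_i `|fcalc P (fun k => texp L (t * ev k)) i (box_index m 0)| ^+ 2 =
    (\sum_(i < m.*2.+1) normc (psum t L (site i)) ^+ 2)%:C%C.
  rewrite rmorph_sum /=; apply: eq_bigr => i _; rewrite psE ?(leq_trans Lm)//.
  by rewrite normc_def -rmorphXn /=; case: (fcalc P _ i _).
by rewrite lecR.
Qed.

(** In a large box the exponential is, up to small errors, the combination of
resolvents of [resolvent_approx]; these are small at distance [N] by [box_green]. *)
Lemma psum_small t K N X L (n : int) : 1 <= t -> (2 <= K)%N -> t * c <= K%:R ->
  0 < X ->
  (forall z : C, t^-1 <= complex.Im z ->
    growth (fun k => z - (V k.+1%:Z)%:C%C) N X /\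
    growth (fun k => z - (V (- k.+1%:Z))%:C%C) N X) ->
  (N <= `|n|)%N ->
  normc (psum t L n) <= expR (2 * (t * c)) / 2 ^+ L
    + (4 * (t * c) ^+ 2 / K%:R + 2 * expR 1 * K%:R * t ^+ 2 / X).
Proof.
move=> t1 K2 tcK X0 gr Nn.
have t0 : 0 < t by apply: lt_le_trans t1.
have c0g : 0 <= c0 by apply: le_trans (Vc 0).
have c1 : 1 <= c by rewrite /c; lra.
pose m := maxn (maxn L `|n|) 1.
have Lm : (L <= m)%N by rewrite /m !leq_max leqnn.
have nm : (`|n| <= m)%N by rewrite /m !leq_max leqnn orbT.
have m0 : (0 < m)%N by rewrite /m !leq_max orbT.
have [P [ev [Pu HE evc psE]]] := psum_box t m.
have [M [w [z [wle zim app]]]] := resolvent_approx c1 t1 K2 tcK.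
have evz j k : (ev k)%:C%C - z j != 0.
  apply/eqP => /(congr1 (@complex.Im R)); rewrite ImD ImN /= sub0r => /eqP.
  by rewrite oppr_eq0 gt_eqF// (lt_le_trans _ (zim j))// invr_gt0.
pose q k : C := \sum_j w j / ((ev k)%:C%C - z j).
rewrite -(box_indexK nm) psE ?(leq_trans Lm)//.
set i := box_index m n; set i0 := box_index m 0.
rewrite (fcalc_split Pu (fun k => texp L (t * ev k)) q i i0).
rewrite [X in _ <= X]addrA; apply: le_trans (normcD _ _) _; apply: lerD.
  apply: fcalc_bound_normc => // k.
  rewrite -[_ - _](subrKA (cis (t * ev k))); apply: le_trans (normcD _ _) _.
  apply: lerD; last by apply: app.
  by rewrite normcBC; apply: texp_cis; rewrite normrM (gtr0_norm t0) ler_pM2l.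
rewrite /q (fcalc_lin Pu); apply: le_trans (normc_sum _ _ _) _.
have bnd j : normc (w j * fcalc P (fun k => ((ev k)%:C%C - z j)^-1) i i0) <=
    normc (w j) * (2 / ((t^-1) ^+ 3 * X)).
  rewrite normcM ler_wpM2l ?normc_ge0//.
  have [gr1 gl1] := gr _ (zim j).
  apply: (box_green Pu HE (evz j) _ (zim j) X0 m0 _ gr1 gl1).
  - by rewrite invr_gt0 t0 invf_le1.
  - exact: leq_trans nm.
  - by rewrite Nn.
apply: le_trans (ler_sum _ (fun j _ => bnd j)) _.
rewrite -big_distrl /=.
have pos : 0 <= 2 / (t^-1 ^+ 3 * X).
  by rewrite divr_ge0// mulr_ge0 ?(ltW X0)// exprn_ge0// invr_ge0 ltW.
apply: le_trans (ler_wpM2r pos wle) _.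
rewrite le_eqVlt; apply/orP; left; apply/eqP; field.
by rewrite !gt_eqF.
Qed.

End Bounded.
End Dynamics.

(** * The wave packet on the line *)

Section TwoSidedSums.
Context {R : realType}.

Lemma sum_sites (B : nat) (g : nat -> R) : (forall k, 0 <= g k) ->
  \sum_(i < B.*2.+1) g `|site i|%N <= 2 * \sum_(0 <= k < B.+1) g k.
Proof.
move=> g0; have -> : \sum_(i < B.*2.+1) g `|site i|%N =
    \sum_(0 <= i < B.*2.+1) g `|(i%:Z - B%:Z)%R|%N by rewrite big_mkord.
rewrite (big_cat_nat (n := B))//=; last by lia.
rewrite mulr_natl mulr2n; apply: lerD.
  rewrite big_nat_rev /= add0n big_nat_recl// ler_wpDl//.
  rewrite big_seq [leRHS]big_seq; apply: ler_sum => i.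
  rewrite mem_index_iota => /andP[_ iB].
  by rewrite (_ : `|_|%N = i.+1)//; lia.
rewrite -{1}[B]add0n big_addn (_ : (B.*2.+1 - B = B.+1)%N); last by lia.
by apply: ler_sum => i _; rewrite (_ : `|_|%N = i)//; lia.
Qed.

Lemma site_inj m : injective (@site m).
Proof. by apply: can_inj (@siteK m). Qed.

Lemma esum_site_le (f : int -> R) (c : R) : (forall n, 0 <= f n) ->
  (forall B, \sum_(i < B.*2.+1) f (site i) <= c) ->
  (\esum_(n in [set: int]) (f n)%:E <= c%:E)%E.
Proof.
move=> f0 H; apply: ge_ereal_sup => _ [A [Afin _] <-].
rewrite fsbig_finite//= sumEFin lee_fin.
set s : seq int := finmap.enum_fset _.
have us : uniq s by exact: finmap.fset_uniq.
pose B := \max_(n <- s) `|n|%N.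
apply: le_trans (H B).
rewrite -(big_map (@site B) predT f).
set r := map _ _.
have ur : uniq r by rewrite map_inj_uniq ?index_enum_uniq//; exact: site_inj.
have sr : {subset s <= r}.
  move=> n ns; apply/mapP; exists (box_index B n); first by rewrite mem_index_enum.
  by rewrite box_indexK// /B (bigD1_seq n)//= leq_maxl.
rewrite [leRHS](bigID (mem s)) /= ler_wpDr ?sumr_ge0//.
rewrite -[leRHS]big_filter (perm_big [seq n <- r | n \in s])//.
apply: uniq_perm => //; first by rewrite filter_uniq.
by move=> n; rewrite mem_filter /=; case: (boolP (n \in s)) => // /sr ->.
Qed.

Lemma esum_site_ge (f : int -> R) B : (forall n, 0 <= f n) ->
  ((\sum_(i < B.*2.+1) f (site i))%:E <= \esum_(n in [set: int]) (f n)%:E)%E.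
Proof.
move=> f0; pose r := map (@site B) (index_enum 'I_(B.*2.+1)).
have ur : uniq r by rewrite map_inj_uniq ?index_enum_uniq//; exact: site_inj.
apply: esum_ge; exists [set` r]; first by split => //; exact: finite_seq.
by rewrite -fsbig_seq// sumEFin big_map.
Qed.

End TwoSidedSums.

Section ComplexLimit.
Context {R : realType}.
Local Notation C := R[i].

Lemma complex_cauchy (s : nat -> C) (c : nat -> R) :
  (forall e, 0 < e -> exists L, c L < e) ->
  (forall L L', (L <= L')%N -> normc (s L' - s L) <= c L) ->
  exists v, forall L, normc (v - s L) <= c L.
Proof.
move=> c0 sc.
have cv (p : C -> R) : (forall z, `|p z| <= normc z) ->
    (forall x y, p (x - y) = p x - p y) -> cvgn (p \o s).
  move=> pn pB; apply: R_complete; apply: cauchy_exP => e e0.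
  have [L Le] := c0 _ e0; exists (p (s L)); exists L => // n /= Ln.
  rewrite /ball /= -normrN opprB -pB; apply: le_lt_trans (pn _) _.
  exact: le_lt_trans (sc _ _ Ln) Le.
have cR := cv (@complex.Re R) (@normc_Re R) (fun x y => etrans (ReD _ _) (congr1 _ (ReN _))).
have cI := cv (@complex.Im R) (@normc_Im R) (fun x y => etrans (ImD _ _) (congr1 _ (ImN _))).
exists (Complex (limn (@complex.Re R \o s)) (limn (@complex.Im R \o s))) => L.
set v := Complex _ _; apply/ler_addgt0Pl => e e0.
have e20 : 0 < e / 2 by rewrite divr_gt0.
have nr : \forall n \near \oo, `|complex.Re v - complex.Re (s n)| <= e / 2.
  by move/cvgrPdist_le : cR => /(_ _ e20).
have ni : \forall n \near \oo, `|complex.Im v - complex.Im (s n)| <= e / 2.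
  by move/cvgrPdist_le : cI => /(_ _ e20).
near \oo => n.
rewrite -[v - _](subrKA (s n)) (le_trans (normcD _ _))// lerD//; last first.
  by apply: sc; near: n; exact: nbhs_infty_ge.
rewrite (le_trans (normc_leD _))// ReD ImD ReN ImN [leRHS]splitr lerD//.
  by near: n.
by near: n.
Unshelve. all: by end_near. Qed.

Lemma geo_small (B e : R) : 0 < e -> exists L, B / 2 ^+ L < e.
Proof.
move=> e0; have h01 : 0 <= (2^-1 : R) < 1.
  by rewrite invr_ge0 ler0n invf_lt1 ?ltr1n.
have e1 : 0 < e / (`|B| + 1) by rewrite divr_gt0// ltr_wpDl.
have [M HM] := pow_small h01 e1.
exists M; have := HM M (leqnn M); rewrite exprVn ltr_pdivlMr ?ltr_wpDl//.
apply: le_lt_trans; rewrite mulrC ler_wpM2l ?invr_ge0 ?exprn_ge0//.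
by rewrite (le_trans (ler_norm _))// lerDl.
Qed.

End ComplexLimit.

Section Evolution.
Context {R : realType}.
Local Notation C := R[i].
Variables (alpha : R * R) (phi : torus R -> R) (theta : torus R) (c0 : R).
Let V (n : int) : R := phi (rotz alpha n theta).
Hypothesis (Vc : forall n, `|V n| <= c0).
Let c := c0 + 2.

Let c0ge : 0 <= c0. Proof. by apply: le_trans (Vc 0). Qed.

Lemma l2norm_le (u : int -> C) (a : R) L : 0 <= a ->
  (forall n, normc (u n) <= a / 2 ^+ maxn L `|n|) ->
  (l2norm u <= (2 * a * Num.sqrt 2^-1 ^+ L)%:E)%E.
Proof.
move=> a0 ua; rewrite /l2norm.
have h0 : 0 <= 2 * a * Num.sqrt 2^-1 ^+ L.
  by rewrite mulr_ge0 ?exprn_ge0 ?sqrtr_ge0// mulr_ge0.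
have E : (\esum_(n in [set: int]) (normc (u n) ^+ 2)%:E <= ((2 * a * Num.sqrt 2^-1 ^+ L) ^+ 2)%:E)%E.
  apply: esum_site_le => [n|B]; first by rewrite exprn_ge0 ?normc_ge0.
  pose g k : R := a ^+ 2 / 2 ^+ L * (2^-1) ^+ k.
  have g0 k : 0 <= g k.
    by rewrite /g mulr_ge0 ?divr_ge0 ?exprn_ge0 ?invr_ge0.
  apply: (@le_trans _ _ (\sum_(i < B.*2.+1) g `|site i|%N)).
    apply: ler_sum => i _; set k := `|site i|%N.
    apply: (@le_trans _ _ ((a / 2 ^+ maxn L k) ^+ 2)).
      by rewrite lerXn2r ?nnegrE ?normc_ge0 ?divr_ge0 ?exprn_ge0.
    rewrite /g exprMn -mulrA ler_wpM2l ?exprn_ge0// !exprVn -invfM -exprD -exprM.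
    by rewrite lef_pV2 ?posrE ?exprn_gt0// ler_weXn2l ?ler1n//; lia.
  apply: le_trans (sum_sites B g0) _.
  have -> : \sum_(0 <= k < B.+1) g k = a ^+ 2 / 2 ^+ L * \sum_(0 <= k < B.+1) 2^-1 ^+ k.
    by rewrite big_distrr.
  have geo n : \sum_(0 <= k < n) 2^-1 ^+ k <= 2 :> R.
    have : \sum_(0 <= k < n) 2^-1 ^+ k = 2 - 2 * 2^-1 ^+ n :> R.
      elim: n => [|n IH]; first by rewrite big_geq// expr0 mulr1 subrr.
      by rewrite big_nat_recr//= IH exprS; field.
    by move=> ->; rewrite gerBl mulr_ge0// exprn_ge0// invr_ge0.
  rewrite exprMn exprAC sqr_sqrtr ?invr_ge0// exprVn exprMn.
  have := geo B.+1; have : 0 <= a ^+ 2 / 2 ^+ L by rewrite divr_ge0 ?exprn_ge0.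
  by set x := a ^+ 2 / _; set y := \sum_(_ <= _ < _) _; rewrite -mulrA -/x; nra.
have -> : (2 * a * Num.sqrt 2^-1 ^+ L)%:E = sqrte ((2 * a * Num.sqrt 2^-1 ^+ L) ^+ 2)%:E.
  by rewrite /sqrte sqrtr_sqr ger0_norm.
by rewrite lee_sqrt// lee_fin exprn_ge0.
Qed.

Lemma l2norm_ge (u : int -> C) n : ((normc (u n))%:E <= l2norm u)%E.
Proof.
rewrite /l2norm; have -> : (normc (u n))%:E = sqrte (normc (u n) ^+ 2)%:E.
  by rewrite /sqrte sqrtr_sqr ger0_norm// normc_ge0.
have f0 k : 0 <= normc (u k) ^+ 2 by rewrite exprn_ge0 ?normc_ge0.
rewrite lee_sqrt; last by apply: esum_ge0 => k _; rewrite lee_fin.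
apply: le_trans (esum_site_ge `|n|%N f0); rewrite lee_fin.
rewrite (bigD1 (box_index `|n|%N n))//= box_indexK// lerDl.
exact: sumr_ge0.
Qed.

(** The pointwise limits of the partial sums are also their limit in l2, because the
errors decay exponentially in [n]; as limits in l2 are unique, they are the value
that [l2exp] chooses. *)
Lemma evolution_psum t L n : 0 <= t ->
  normc (evolution alpha phi theta t (delta 0) n - psum V t L n)
   <= expR (2 * (t * c)) / 2 ^+ maxn L `|n|.
Proof.
move=> t0; set B := expR _.
have B0 : 0 <= B by exact: expR_ge0.
have pw k : exists v, forall L, normc (v - psum V t L k) <= B / 2 ^+ maxn L `|k|.
  apply: (@complex_cauchy _ (fun L => psum V t L k) (fun L => B / 2 ^+ maxn L `|k|)).
    move=> e e0; have [L' h] := geo_small B e0; exists L'.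
    apply: le_lt_trans h; rewrite ler_wpM2l// lef_pV2 ?posrE ?exprn_gt0//.
    by rewrite ler_weXn2l ?ler1n// leq_maxl.
  by move=> L1 L2 L12; apply: (psum_cauchy Vc).
have [v vP] := choice pw.
pose S := [set w | (l2norm w < +oo)%E /\
    (fun N : nat => l2norm (fun n => psum V t N n - w n)) @ \oo --> 0%E].
have vS : S v.
  split.
    apply: (@le_lt_trans _ _ (2 * B * Num.sqrt 2^-1 ^+ 0)%:E); last exact: ltry.
    apply: l2norm_le => // k; have := vP k 0%N.
    by rewrite /psum big_geq// subr0.
  have q1 : `|Num.sqrt 2^-1| < 1 :> R.
    rewrite ger0_norm ?sqrtr_ge0// -[ltRHS]sqrtr1 ltr_sqrt//.
    by rewrite invf_lt1 ?ltr1n.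
  have h0 : (fun N => (2 * B * Num.sqrt 2^-1 ^+ N)%:E) @ \oo --> 0%E.
    by apply: cvg_EFin; [near=> N|exact: (cvg_geometric (2 * B) q1)].
  apply: squeeze_cvge (cvg_cst 0%E) h0; near=> N; apply/andP; split.
    by rewrite /l2norm sqrte_ge0.
  by apply: l2norm_le => // k; rewrite normcBC; exact: vP.
have uS : S (evolution alpha phi theta t (delta 0)).
  exact: (xgetPex (fun=> 0) (ex_intro _ v vS)).
move: uS; set u := evolution _ _ _ _ _ => -[_ uS].
suff -> : u n = v n by exact: vP.
apply/eqP; rewrite -subr_eq0 -normc_eq0 eq_le normc_ge0 andbT.
apply/ler_addgt0Pl => e e0; rewrite addr0.
have e20 : 0 < e / 2 by rewrite divr_gt0.
have nu : \forall N \near \oo, normc (psum V t N n - u n) <= e / 2.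
  have /fine_cvgP[fn /cvgrPdist_le/(_ _ e20) cv] := uS.
  near=> N; have fN : l2norm (fun n => psum V t N n - u n) \is a fin_num by near: N.
  have := l2norm_ge (fun n => psum V t N n - u n) n.
  rewrite -(fineK fN) lee_fin => /le_trans; apply.
  have : `|0 - fine (l2norm (fun n => psum V t N n - u n))| <= e / 2 by near: N.
  by rewrite sub0r normrN; apply: le_trans; exact: ler_norm.
have [L' HL] := geo_small B e20.
near \oo => N.
rewrite -[u n - _](subrKA (psum V t N n)) [leRHS]splitr.
rewrite (le_trans (normcD _ _))// lerD//.
  by rewrite normcBC; near: N.
rewrite normcBC (le_trans (vP _ N))// (le_trans _ (ltW HL))//.
rewrite ler_wpM2l// lef_pV2 ?posrE ?exprn_gt0// ler_weXn2l ?ler1n//.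
rewrite leq_max; apply/orP; left; near: N; exact: nbhs_infty_ge.
Unshelve. all: by end_near. Qed.

End Evolution.

Lemma sqr_le_pow2 m : (4 <= m)%N -> (m ^ 2 <= 2 ^ m)%N.
Proof.
elim: m => // m IH; rewrite leq_eqVlt => /orP[/eqP <-//|]; rewrite ltnS => h.
by have := IH h; rewrite (expnS 2 m) => IH'; nia.
Qed.

Lemma sqr_perturb (R : realType) (x y e : R) : 0 <= x -> 0 <= y <= 1 ->
  0 <= e <= 1 -> x <= y + e -> x ^+ 2 <= y ^+ 2 + 3 * e.
Proof.
move=> x0 /andP[y0 y1] /andP[e0 e1] h.
have : x ^+ 2 <= (y + e) ^+ 2 by rewrite lerXn2r// nnegrE addr_ge0.
have : e * y <= e * 1 by rewrite ler_wpM2l.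
have : e * e <= e * 1 by rewrite ler_wpM2l.
by rewrite sqrrD mulr2n [e ^+ 2]expr2; lra.
Qed.

Section Moments.
Context {R : realType}.
Local Notation C := R[i].

Lemma bernoulli_exp (s : R) k : 1 <= s -> 1 + k%:R * (s - 1) <= s ^+ k.
Proof.
move=> s1; elim: k => [|k IH]; first by rewrite expr0 mul0r addr0.
rewrite exprS -natr1; apply: le_trans (ler_wpM2l _ IH); last by lra.
have k0 : 0 <= k%:R :> R by rewrite ler0n.
have h : 0 <= k%:R * (s - 1) * (s - 1) by rewrite !mulr_ge0// subr_ge0.
by nra.
Qed.

Lemma poly_le_exp (P : nat) (r : R) : 1 < r ->
  exists2 c : R, 0 <= c & forall k, (1 + k%:R) ^+ P <= c * r ^+ k.
Proof.
elim: P r => [|P IH] r r1.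
  exists 1 => // k; rewrite expr0 mul1r; apply: exprn_ege1; exact: ltW.
pose s := Num.sqrt r.
have r0 : 0 <= r by rewrite (le_trans _ (ltW r1)).
have s1 : 1 < s by rewrite -[X in X < _]sqrtr1 ltr_sqrt// (lt_trans _ r1).
have s2 : s ^+ 2 = r by rewrite sqr_sqrtr.
have [c c0 hc] := IH s s1.
pose d := 1 + (s - 1)^-1.
have d0 : 0 <= d by rewrite addr_ge0// invr_ge0 subr_ge0 ltW.
exists (d * c) => [|k]; first exact: mulr_ge0.
rewrite exprS -s2 -exprM mulnC exprM expr2 mulrACA.
apply: ler_pM; rewrite ?exprn_ge0 ?addr_ge0//.
apply: (@le_trans _ _ (d * (1 + k%:R * (s - 1)))); last first.
  by rewrite ler_wpM2l// bernoulli_exp// ltW.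
have k0 : 0 <= k%:R :> R by rewrite ler0n.
have ss : (s - 1)^-1 * (s - 1) = 1 by rewrite mulVf// gt_eqF// subr_gt0.
have i0 : 0 <= (s - 1)^-1 by rewrite invr_ge0 subr_ge0 ltW.
rewrite /d; have -> : (1 + (s - 1)^-1) * (1 + k%:R * (s - 1)) =
  1 + (s - 1)^-1 + k%:R * (s - 1) + k%:R * ((s - 1)^-1 * (s - 1)) by ring.
have : 0 <= k%:R * (s - 1) by rewrite mulr_ge0// subr_ge0 ltW.
by rewrite ss; lra.
Qed.

Lemma expR_le_pow2 (x : R) k : 2 * x <= k%:R -> expR x <= 2 ^+ k.
Proof.
move=> xk; apply: (@le_trans _ _ (expR (2^-1) ^+ k)).
  by rewrite -expRM_natr ler_expR; lra.
rewrite lerXn2r ?nnegrE ?expR_ge0//.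
have := @expR_ge1Dx R (- 2^-1); rewrite expRN => h.
rewrite -[expR _]invrK -[leRHS]invrK lef_pV2 ?posrE ?invr_gt0 ?expR_gt0//.
by apply: le_trans h; lra.
Qed.

Lemma expR1_le4 : expR 1 <= 4 :> R.
Proof.
have h : 2 * 1 <= 2%:R :> R by lra.
by apply: le_trans (expR_le_pow2 h) _; rewrite expr2; lra.
Qed.

Variables (alpha : R * R) (phi : torus R -> R) (theta : torus R) (c0 : R).
Let V (n : int) : R := phi (rotz alpha n theta).
Hypothesis (Vc : forall n, `|V n| <= c0).
Let c := c0 + 2.
Let c0ge : 0 <= c0. Proof. by apply: le_trans (Vc 0). Qed.
Local Notation psi t := (evolution alpha phi theta t (delta 0)).

Lemma l2inner_delta (u : int -> C) n : l2inner u (delta n) = u n.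
Proof.
have H : hausdorff_space C^o by exact: (@norm_hausdorff C C^o).
rewrite /l2inner; set f := (X in limn X).
apply: (@lim_near_cst C^o H nat \oo _ (u n) (f : nat -> C^o)).
near=> N.
have nN : (`|n| <= N)%N by near: N; exact: nbhs_infty_ge.
have lt : (`|(n + N%:Z)%R| < (2 * N).+1)%N by lia.
rewrite /f (bigD1 (Ordinal lt))//= big1 ?addr0; last first.
  move=> k kn; rewrite /delta; case: eqVneq => [e|_]; last by rewrite conjc0 mulr0.
  case/eqP: kn; by apply: val_inj; rewrite /= -e subrK.
have -> : `|(n + N%:Z)%R|%:Z - N%:Z = n by lia.
by rewrite /delta eqxx conjc1 mulr1.
Unshelve. all: by end_near. Qed.

Lemma amplitudeE n t : amplitude alpha phi theta n t = normc (psi t n) ^+ 2.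
Proof. by rewrite /amplitude l2inner_delta. Qed.

Lemma psum_le1 t L n : 0 <= t ->
  normc (psum V t L n) <= 1 + expR (2 * (t * c)) / 2 ^+ L.
Proof.
move=> t0; pose m := maxn L `|n|.
have nm : (`|n| <= m)%N by rewrite leq_maxr.
have [P [ev [Pu HE evc psE]]] := psum_box Vc t m.
rewrite -(box_indexK nm) psE; last by rewrite ltnW// ltnS leq_maxl.
apply: fcalc_bound_normc => // k.
rewrite -[texp _ _](subrK (cis (t * ev k))) addrC (le_trans (normcD _ _))//.
rewrite normc_cis lerD2l normcBC; apply: texp_cis.
by rewrite normrM ger0_norm// ler_wpM2l.
Qed.

Lemma psi_le1 t n : 0 <= t -> normc (psi t n) <= 1.
Proof.
move=> t0; apply/ler_addgt0Pl => e e0.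
have [L hL] := geo_small (2 * expR (2 * (t * c))) e0.
have h1 := evolution_psum Vc L n t0; have h2 := psum_le1 L n t0.
rewrite -[psi t n](subrK (psum V t L n)) (le_trans (normcD _ _))//.
set E := expR _ in h1 h2 hL.
have h3 : E / 2 ^+ maxn L `|n| <= E / 2 ^+ L.
  rewrite ler_wpM2l ?expR_ge0// lef_pV2 ?posrE ?exprn_gt0//.
  by rewrite ler_weXn2l ?ler1n// leq_maxl.
move: h1 h2 h3 hL; rewrite -mulrA -/c -/E; set x := E / 2 ^+ L.
by move=> h1 h2 h3 hL; lra.
Qed.

Lemma psi_decay t n : 0 <= t ->
  normc (psi t n) <= expR (2 * (t * c)) / 2 ^+ `|n|.
Proof.
move=> t0; have := evolution_psum Vc 0 n t0.
by rewrite /psum big_geq// subr0 max0n.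
Qed.

(** The moment dominates the squared l2 norm, which the evolution preserves. This is
seen in a finite box, where the truncated exponential is nearly unitary. *)
Lemma moment_ge1 p t : 0 <= p -> 0 <= t ->
  (1 <= moment alpha phi theta p t)%E.
Proof.
move=> p0 t0.
have f0 n : 0 <= (1 + `|n%:~R|) `^ p * amplitude alpha phi theta n t.
  by rewrite mulr_ge0 ?powR_ge0// amplitudeE exprn_ge0 ?normc_ge0.
have g0 (n : int) : 0 <= normc (psi t n) ^+ 2 by rewrite exprn_ge0 ?normc_ge0.
apply: (@le_trans _ _ (\esum_(n in [set: int]) (normc (psi t n) ^+ 2)%:E)); last first.
  apply: le_esum => n _; rewrite lee_fin amplitudeE ler_peMl//.
  by rewrite -[leLHS](powRr0 (1 + `|n%:~R : R|)) ler_powR// lerDl.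
apply/lee_addgt0Pr => e e0.
set B := expR (2 * (t * c)).
have B0 : 0 < B by exact: expR_gt0.
pose D := 8 * B / e + B.
have D0 : 0 <= D by rewrite addr_ge0 ?divr_ge0 ?mulr_ge0 ?ltW.
pose m := maxn 4 (Num.trunc D).+1.
have m4 : (4 <= m)%N by rewrite leq_maxl.
have mD : D < m%:R.
  apply: lt_le_trans (_ : (Num.trunc D).+1%:R <= _); last by rewrite ler_nat leq_maxr.
  by have /andP[] := truncn_itv D0.
have m0 : 0 < m%:R :> R by rewrite ltr0n (leq_trans _ m4).
have m1 : 4 <= m%:R :> R by rewrite (ler_nat R 4).
have m2 : m%:R ^+ 2 <= 2 ^+ m :> R by rewrite -!natrX ler_nat sqr_le_pow2.
pose eps := B / 2 ^+ m.
have eps0 : 0 < eps by rewrite divr_gt0 ?exprn_gt0.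
have epsm : eps * m%:R ^+ 2 <= B.
  by rewrite /eps mulrAC ler_pdivrMr ?exprn_gt0// ler_wpM2l// ltW.
have Bm : B < m%:R.
  by apply: le_lt_trans mD; rewrite lerDr divr_ge0 ?mulr_ge0 ?ltW.
have De : 8 * B < e * m%:R.
  have : 8 * B / e < m%:R by apply: le_lt_trans mD; rewrite lerDl ltW.
  by rewrite ltr_pdivrMr// [m%:R * e]mulrC.
have epsm1 : eps * m%:R <= e / 8.
  rewrite -(ler_pM2r m0) -mulrA -expr2 (le_trans epsm)//.
  by move: De; lra.
have eps1 : eps <= 1.
  rewrite -(ler_pM2r (exprn_gt0 2 m0)) mul1r (le_trans epsm)// (le_trans (ltW Bm))//.
  by rewrite expr2 ler_peMr ?(ltW m0)//; lra.
have h := psum_norm_ge Vc t0 (leqnn m) eps1.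
apply: le_trans (leeD2r _ (esum_site_ge m g0)).
rewrite -EFinD lee_fin -/c -/B -/eps in h *.
have : \sum_(i < m.*2.+1) normc (psum V t m (site i)) ^+ 2 <=
    \sum_(i < m.*2.+1) (normc (psi t (site i)) ^+ 2 + 3 * eps).
  apply: ler_sum => i _.
  have h1 := evolution_psum Vc m (site i) t0.
  have h2 := psi_le1 (site i) t0.
  have h3 : normc (psum V t m (site i)) <= normc (psi t (site i)) + eps.
    rewrite -[psum _ _ _ _](subrK (psi t (site i))) addrC (le_trans (normcD _ _))//.
    rewrite lerD2l normcBC (le_trans h1)// -/c -/B.
    have -> : maxn m `|site i| = m by apply/maxn_idPl/site_le.
    by [].
  by apply: sqr_perturb h3; rewrite ?normc_ge0 ?h2 ?(ltW eps0).
rewrite big_split /= sumr_const card_ord -[_ *+ m.*2.+1]mulr_natl.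
have -> : m.*2.+1%:R = 2 * m%:R + 1 :> R by rewrite -natr1 -mul2n natrM.
have -> : (2 * m%:R + 1) * (3 * eps) = 6 * (eps * m%:R) + 3 * eps by ring.
have : eps * 4 <= eps * m%:R by rewrite ler_wpM2l// ltW.
have := sqr_ge0 eps; move: h; rewrite sqrrB expr1n mul1r mulr2n.
by set S1 := \sum_(_ < _) _; set S2 := \sum_(_ < _) _; lra.
Qed.

(** Three zones: below [N] the amplitudes are at most 1, below [M0] at most [b ^ 2],
and further out, beyond the speed of propagation, they decay exponentially. *)
Lemma moment_le (p t b : R) (P N M0 : nat) : 0 <= p <= P%:R -> 0 <= t ->
  8 * (t * c) <= M0%:R ->
  (forall n : int, (N <= `|n|)%N -> normc (psi t n) <= b) ->
  forall D, (forall k : nat, (1 + k%:R) ^+ P <= D * (3 / 2) ^+ k) ->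
  (moment alpha phi theta p t <=
   (2 * (N%:R * (1 + N%:R) ^+ P + M0%:R * (1 + M0%:R) ^+ P * b ^+ 2 + 4 * D))%:E)%E.
Proof.
move=> /andP[p0 pP] t0 tM hb D HD.
have D0 : 0 <= D by have := HD 0%N; rewrite addr0 expr1n expr0 mulr1; lra.
have b2 : 0 <= b ^+ 2 by exact: sqr_ge0.
pose g (k : nat) : R := (k < N)%:R * (1 + N%:R) ^+ P
  + (k < M0)%:R * ((1 + M0%:R) ^+ P * b ^+ 2) + D * (3 / 4) ^+ k.
have pw (k : nat) : 0 <= (1 + k%:R) ^+ P :> R by rewrite exprn_ge0// addr_ge0.
have g1 k : 0 <= (k < N)%:R * (1 + N%:R) ^+ P :> R by rewrite mulr_ge0.
have g2 k : 0 <= (k < M0)%:R * ((1 + M0%:R) ^+ P * b ^+ 2).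
  by rewrite mulr_ge0// mulr_ge0.
have g3 k : 0 <= D * (3 / 4) ^+ k by rewrite mulr_ge0// exprn_ge0.
have g0 k : 0 <= g k by rewrite !addr_ge0.
have f0 n : 0 <= (1 + `|n%:~R|) `^ p * amplitude alpha phi theta n t.
  by rewrite mulr_ge0 ?powR_ge0// amplitudeE exprn_ge0 ?normc_ge0.
have fg (n : int) : (1 + `|n%:~R|) `^ p * amplitude alpha phi theta n t <= g `|n|%N.
  have nE : `|n%:~R| = `|n|%N%:R :> R by rewrite -intr_norm -natr_absz.
  rewrite amplitudeE nE; set k := `|n|%N.
  have a0 : 0 <= normc (psi t n) ^+ 2 by rewrite exprn_ge0 ?normc_ge0.
  apply: (@le_trans _ _ ((1 + k%:R) ^+ P * normc (psi t n) ^+ 2)).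
    rewrite ler_wpM2r// -powR_mulrn ?addr_ge0//.
    by rewrite ler_powR// lerDl.
  have mono (a : nat) : (k <= a)%N -> (1 + k%:R) ^+ P <= (1 + a%:R) ^+ P :> R.
    by move=> ka; rewrite lerXn2r ?nnegrE ?addr_ge0// lerD2l ler_nat.
  rewrite /g; have [kN|Nk] := ltnP k N.
    rewrite mul1r -[leLHS]addr0 -addrA; apply: lerD; last exact: addr_ge0.
    apply: le_trans (_ : (1 + k%:R) ^+ P * 1 <= _); last by rewrite mulr1 mono// ltnW.
    by rewrite ler_wpM2l// exprn_ile1 ?normc_ge0 ?psi_le1.
  rewrite mul0r add0r; have [kM|Mk] := ltnP k M0.
    rewrite mul1r -[leLHS]addr0; apply: lerD => //.
    apply: ler_pM => //; first by rewrite mono// ltnW.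
    by rewrite lerXn2r ?nnegrE ?normc_ge0 ?hb// (le_trans (normc_ge0 _) (hb n Nk)).
  rewrite mul0r add0r.
  have e2 : expR (2 * (t * c)) ^+ 2 <= 2 ^+ k.
    rewrite -expRM_natr; apply: expR_le_pow2.
    by apply: le_trans (_ : M0%:R <= _); [lra|rewrite ler_nat].
  apply: (@le_trans _ _ ((D * (3 / 2) ^+ k) * (2 ^+ k)^-1)).
    apply: ler_pM => //; apply: (@le_trans _ _ ((expR (2 * (t * c)) / 2 ^+ k) ^+ 2)).
      by rewrite lerXn2r ?nnegrE ?normc_ge0 ?divr_ge0 ?expR_ge0 ?exprn_ge0// psi_decay.
    rewrite exprMn exprVn ler_pdivrMr ?exprn_gt0// (le_trans e2)//.
    by rewrite [(2 ^+ k) ^+ 2]expr2 mulKf// lt0r_neq0// exprn_gt0.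
  rewrite -mulrA -exprVn -exprMn le_eqVlt; apply/orP; left; apply/eqP.
  by congr (_ * _ ^+ _); field.
apply: esum_site_le => // B.
apply: (@le_trans _ _ (\sum_(i < B.*2.+1) g `|site i|%N)).
  by apply: ler_sum => i _; exact: fg.
apply: le_trans (sum_sites B g0) _; rewrite ler_pM2l//.
have ind (a n : nat) : \sum_(0 <= k < n) (k < a)%:R <= a%:R :> R.
  have : \sum_(0 <= k < n) (k < a)%:R <= (minn a n)%:R :> R.
    elim: n => [|n IH]; first by rewrite big_geq.
    rewrite big_nat_recr//=; case: ltnP => h.
      apply: le_trans (lerD IH (lexx _)) _; rewrite natr1 ler_nat; lia.
    rewrite addr0; apply: le_trans IH _; rewrite ler_nat; lia.
  by move=> /le_trans; apply; rewrite ler_nat geq_minl.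
have geo n : \sum_(0 <= k < n) (3 / 4) ^+ k <= 4 :> R.
  have : \sum_(0 <= k < n) (3 / 4) ^+ k = 4 - 4 * (3 / 4) ^+ n :> R.
    elim: n => [|n IH]; first by rewrite big_geq// expr0 mulr1 subrr.
    by rewrite big_nat_recr//= IH exprS; field.
  by move=> ->; rewrite gerBl mulr_ge0// exprn_ge0.
rewrite /g !big_split /= -!big_distrl -big_distrr /=; apply: lerD; first apply: lerD.
- by rewrite ler_wpM2r.
- by rewrite -mulrA ler_wpM2r// mulr_ge0.
- by rewrite mulrC ler_wpM2r.
Qed.

End Moments.

Section Beta.
Context {R : realType}.
Local Notation C := R[i].
Variables (alpha : R * R) (phi : torus R -> R) (theta : torus R) (c0 : R).
Let V (n : int) : R := phi (rotz alpha n theta).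
Hypothesis (Vc : forall n, `|V n| <= c0).
Let c := c0 + 2.
Let c0ge : 0 <= c0. Proof. by apply: le_trans (Vc 0). Qed.
Local Notation psi t := (evolution alpha phi theta t (delta 0)).

Lemma psi_small t K N X (n : int) : 1 <= t -> (2 <= K)%N -> t * c <= K%:R ->
  0 < X ->
  (forall z : C, t^-1 <= complex.Im z ->
    growth (fun k => z - (V k.+1%:Z)%:C%C) N X /\
    growth (fun k => z - (V (- k.+1%:Z))%:C%C) N X) ->
  (N <= `|n|)%N ->
  normc (psi t n)
    <= 4 * (t * c) ^+ 2 / K%:R + 2 * expR 1 * K%:R * t ^+ 2 / X.
Proof.
move=> t1 K2 tK X0 gr Nn; apply/ler_addgt0Pr => e e0.
have t0 : 0 <= t by apply: le_trans t1.
have [L hL] := geo_small (2 * expR (2 * (t * c))) e0.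
have h1 := evolution_psum Vc L n t0.
have h2 := psum_small Vc L t1 K2 tK X0 gr Nn.
rewrite -[psi t n](subrK (psum V t L n)) (le_trans (normcD _ _))//.
have h3 : expR (2 * (t * c)) / 2 ^+ maxn L `|n| <= expR (2 * (t * c)) / 2 ^+ L.
  rewrite ler_wpM2l ?expR_ge0// lef_pV2 ?posrE ?exprn_gt0//.
  by rewrite ler_weXn2l ?ler1n// leq_maxl.
move: h1 h2 h3 hL; rewrite -[2 * expR _ / _]mulrA -/c.
set E := expR (2 * (t * c)) / _; set E' := expR (2 * (t * c)) / _.
set b := _ / K%:R; set b' := _ / X.
by move=> h1 h2 h3 hL; lra.
Qed.

Lemma pow_absorb (q : R) (k l : nat) : 1 <= q -> (k <= l)%N -> q ^+ k <= q ^+ l.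
Proof. by move=> q1 kl; rewrite ler_weXn2l. Qed.

(** All parameters are powers of [q], so that the moment of order [p] at time
[q ^ B] is at most a power of [q] that does not depend on [B]. *)
Lemma moment_pow (e P B q : nat) (p D : R) : 0 <= p <= P%:R ->
  (forall k : nat, (1 + k%:R) ^+ P <= D * (3 / 2) ^+ k) ->
  9 * c <= q%:R -> 2 * (2 ^+ P + 4 + 4 * D) <= q%:R -> (8 <= q)%N ->
  let A := (1 + ((B + 2) * P.+1 + 2 * B + 2) + 2 * B + (B + 2) * P.+1)%N in
  (forall z : C, ((q%:R ^+ B)^-1 : R) <= complex.Im z ->
    growth (fun k => z - (V k.+1%:Z)%:C%C) (q ^ e) (q%:R ^+ A : R) /\
    growth (fun k => z - (V (- k.+1%:Z))%:C%C) (q ^ e) (q%:R ^+ A : R)) ->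
  (moment alpha phi theta p (q%:R ^+ B) <= (q%:R ^+ (e * P.+1).+1)%:E)%E.
Proof.
move=> pP HD qc qD q8; set Dd := ((B + 2) * P.+1)%N.
(* With [K = q ^ k] Euler steps the error is [q ^- Dd], which compensates the
   weights of order [q ^ Dd] in the middle zone; [A] beats [K * t ^ 2 * q ^ Dd]. *)
set k := (Dd + 2 * B + 2)%N => A gr.
set Q : R := q%:R in qc qD gr *.
have Q8 : 8 <= Q by rewrite /Q (ler_nat R 8).
have Q1 : 1 <= Q by lra.
have Q0 : 0 < Q by lra.
have pw j : 0 < Q ^+ j by rewrite exprn_gt0.
set t := Q ^+ B in gr *.
have t1 : 1 <= t by exact: exprn_ege1.
have c2 : 2 <= c by rewrite /c; move: c0ge; lra.
have tM : 8 * (t * c) <= (q ^ B.+1)%N%:R.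
  rewrite natrX exprSr -/Q -/t.
  have : t * (8 * c) <= t * Q by rewrite ler_wpM2l ?(ltW (pw _))//; lra.
  by lra.
have K2 : (2 <= q ^ k)%N.
  apply: (@leq_trans (q ^ 1)); first by rewrite expn1 (leq_trans _ q8).
  by rewrite leq_pexp2l ?(leq_trans _ q8)// /k addn2.
have tK : t * c <= (q ^ k)%N%:R.
  rewrite natrX -/Q; apply: le_trans (pow_absorb Q1 (_ : B.+1 <= k)%N); last by rewrite /k; clear; lia.
  rewrite exprSr ler_wpM2l ?(ltW (pw _))//; lra.
pose b := 4 * (t * c) ^+ 2 / (q ^ k)%N%:R + 2 * expR 1 * (q ^ k)%N%:R * t ^+ 2 / Q ^+ A.
have hb (n : int) : (q ^ e <= `|n|)%N -> normc (psi t n) <= b.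
  by move=> h; apply: psi_small t1 K2 tK (pw A) gr h.
have b0 : 0 <= b.
  by apply: le_trans (hb (q ^ e)%N%:Z (leqnn _)); exact: normc_ge0.
have bD : b <= 2 * (Q ^+ Dd)^-1.
  have -> : 2 * (Q ^+ Dd)^-1 = (Q ^+ Dd)^-1 + (Q ^+ Dd)^-1 by ring.
  rewrite /b natrX -/Q; apply: lerD.
    rewrite ler_pdivrMr// -ler_pdivrMl ?invr_gt0// invrK.
    have -> : Q ^+ k = Q ^+ Dd * (t ^+ 2 * Q ^+ 2).
      by rewrite /t -exprM -!exprD; congr (_ ^+ _); rewrite /k; clear; lia.
    rewrite ler_pM2l// exprMn mulrCA ler_pM2l ?exprn_gt0//.
    have : (9 * c) ^+ 2 <= Q ^+ 2 by rewrite lerXn2r ?nnegrE ?(ltW Q0)//; lra.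
    by rewrite exprMn; have := sqr_ge0 c; lra.
  rewrite ler_pdivrMr// -ler_pdivrMl ?invr_gt0// invrK.
  have -> : Q ^+ A = Q * (Q ^+ k * (t ^+ 2 * Q ^+ Dd)).
    by rewrite /t -exprM -!exprD -exprS; congr (_ ^+ _); rewrite /A; clear; lia.
  have -> : Q ^+ Dd * (2 * expR 1 * Q ^+ k * t ^+ 2) =
     (2 * expR 1) * (Q ^+ k * (t ^+ 2 * Q ^+ Dd)) by ring.
  rewrite ler_pM2r ?mulr_gt0 ?exprn_gt0//; have := @expR1_le4 R; lra.
apply: le_trans (moment_le Vc pP (le_trans ler01 t1) tM hb HD) _.
rewrite lee_fin !natrX -/Q.
set N := Q ^+ e; have N1 : 1 <= N by exact: exprn_ege1.
have eM : Q ^+ B.+1 * (1 + Q ^+ B.+1) ^+ P * b ^+ 2 <= 4.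
  have h1 : 1 + Q ^+ B.+1 <= Q ^+ (B + 2).
    rewrite addn2 [leRHS]exprS; have : 1 <= Q ^+ B.+1 by exact: exprn_ege1.
    by move: Q8; set y := Q ^+ B.+1; nra.
  have h2 : Q ^+ B.+1 * (1 + Q ^+ B.+1) ^+ P <= Q ^+ Dd.
    rewrite /Dd mulnS exprD exprM; apply: ler_pM.
    - exact: ltW.
    - by rewrite exprn_ge0// addr_ge0// ltW.
    - by apply: pow_absorb => //; rewrite addn2.
    - by rewrite lerXn2r// nnegrE ?addr_ge0 ?(ltW (pw _)).
  have h3 : b ^+ 2 <= (2 * (Q ^+ Dd)^-1) ^+ 2.
    by rewrite lerXn2r// nnegrE mulr_ge0// invr_ge0 ltW.
  apply: le_trans (ler_pM _ _ h2 h3) _; rewrite ?sqr_ge0//.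
    by rewrite mulr_ge0 ?(ltW (pw _))// exprn_ge0// addr_ge0// ltW.
  have -> : Q ^+ Dd * (2 / Q ^+ Dd) ^+ 2 = 4 / Q ^+ Dd.
    by field; rewrite gt_eqF.
  by rewrite ler_pdivrMr// ler_peMr// exprn_ege1.
have eN : N * (1 + N) ^+ P <= 2 ^+ P * Q ^+ (e * P.+1).
  rewrite exprM -/N exprS mulrCA ler_pM2l ?exprn_gt0// -exprMn.
  by rewrite lerXn2r ?nnegrE ?mulr_ge0 ?addr_ge0 ?(ltW (pw _))//; lra.
have y1 : 1 <= Q ^+ (e * P.+1) by exact: exprn_ege1.
have D0 : 0 <= D by have := HD 0%N; rewrite addr0 expr1n expr0 mulr1; lra.
rewrite [leRHS]exprS; move: eM eN y1.
set y := Q ^+ (e * _); set m1 := N * _; set m2 := _ * b ^+ 2 => eM eN y1.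
apply: (@le_trans _ _ (2 * (2 ^+ P + 4 + 4 * D) * y)).
  have : (4 + 4 * D) * 1 <= (4 + 4 * D) * y by rewrite ler_wpM2l//; lra.
  by lra.
by rewrite ler_pM2r// (lt_le_trans _ y1).
Qed.

Lemma natr_above (x : R) : exists n : nat, x <= n%:R.
Proof.
exists (Num.trunc `|x|).+1; apply: le_trans (ler_norm _) _.
by have /andP[_ /ltW] := truncn_itv (normr_ge0 x).
Qed.

(** At the time [t = q ^ B] the logarithm of the moment is at most a multiple of
[ln q] that does not depend on [B], whereas [ln t] is [B * ln q]; [B] is
arbitrary. *)
Lemma beta_zero (e : nat) :
  (forall A B Q0 : nat, exists2 q : nat, (Q0 <= q)%N &
   forall z : C, ((q%:R ^+ B)^-1 : R) <= complex.Im z ->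
    growth (fun k => z - (V k.+1%:Z)%:C%C) (q ^ e) (q%:R ^+ A : R) /\
    growth (fun k => z - (V (- k.+1%:Z))%:C%C) (q ^ e) (q%:R ^+ A : R)) ->
  forall p : R, 0 < p -> beta_lower alpha phi theta p = 0%E.
Proof.
move=> HG p p0; rewrite /beta_lower limf_einfE; apply/eqP; rewrite eq_le.
set f := (fun t : R => _).
apply/andP; split; last first.
  apply: ereal_sup_ge; exists (ereal_inf [set f t | t in [set t : R | 1 < t]]).
    exists [set t : R | 1 < t] => //; exists 1; split=> //; exact: num_real.
  apply: le_ereal_inf_tmp => _ [t /= t1 <-].
  have t0 : 0 <= t by rewrite (le_trans _ (ltW t1)).
  have m1 := moment_ge1 Vc (ltW p0) t0.
  rewrite /f; apply: mule_ge0.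
    move: m1; case: (moment _ _ _ _ _) => //= r; rewrite lee_fin => r1.
    have -> : (r <= 0) = false by apply/negbTE; rewrite -ltNge (lt_le_trans _ r1).
    by rewrite lee_fin ln_ge0.
  by rewrite lee_fin invr_ge0 mulr_ge0 ?(ltW p0) ?ln_ge0 ?(ltW t1).
apply/lee_addgt0Pr => d d0; rewrite add0e.
apply: ge_ereal_sup => _ [W [M [_ MW]] <-].
have [P pP] := natr_above p.
have [D D0 HD] := @poly_le_exp R P (3 / 2) ltac:(lra).
(* [B] is so large that the exponent [(e * P.+1).+1] is at most [p * d * B]. *)
have [B hB] := natr_above ((e * P.+1).+1%:R / (p * d)).
have [Q1 hQ1] := natr_above (9 * c).
have [Q2 hQ2] := natr_above (2 * (2 ^+ P + 4 + 4 * D)).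
have [Q3 hQ3] := natr_above (M + 1).
have [q hq HG'] := HG (1 + ((B.+1 + 2) * P.+1 + 2 * B.+1 + 2) + 2 * B.+1 + (B.+1 + 2) * P.+1)%N B.+1 (maxn (maxn Q1 Q2) (maxn Q3 8)).
move: hq; rewrite !geq_max => /andP[/andP[q1 q2] /andP[q3 q8]].
have le (a : R) n : a <= n%:R -> (n <= q)%N -> a <= q%:R.
  by move=> h nq; apply: le_trans h _; rewrite ler_nat.
have mom := @moment_pow e P B.+1 q p D _ HD (le _ _ hQ1 q1) (le _ _ hQ2 q2) q8 HG'.
have {}mom := mom ltac:(by rewrite (ltW p0) pP).
set t : R := q%:R ^+ B.+1 in mom.
have Q8 : 8 <= q%:R :> R by rewrite (ler_nat R 8).
have qt : q%:R <= t by rewrite /t exprS ler_peMr ?ler0n// exprn_ege1//; lra.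
have Mt : M < t by have := le _ _ hQ3 q3; lra.
have t1 : 1 <= t by lra.
apply: (@le_trans _ _ (f t)).
  by apply: ge_ereal_inf; exists (f t) => //; exists t => //; exact: MW.
rewrite /f; have m1 := moment_ge1 Vc (ltW p0) (le_trans ler01 t1).
move: m1 mom; case: (moment _ _ _ _ _) => // r; rewrite !lee_fin => r1 rle.
rewrite /=; have -> : (r <= 0) = false by apply/negbTE; rewrite -ltNge (lt_le_trans _ r1).
rewrite -EFinM lee_fin.
have lq : 0 < ln (q%:R : R) by apply: ln_gt0; lra.
have lt : ln t = B.+1%:R * ln (q%:R : R).
  by rewrite /t lnXn ?mulr_natl//; lra.
rewrite ler_pdivrMr; last by rewrite lt mulr_gt0// mulr_gt0// ltr0n.
apply: (@le_trans _ _ ((e * P.+1).+1%:R * ln (q%:R : R))).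
  apply: le_trans (_ : ln (q%:R ^+ (e * P.+1).+1) <= _).
    by rewrite ler_ln ?posrE// ?exprn_gt0//; lra.
  by rewrite lnXn ?mulr_natl//; lra.
rewrite lt !mulrA ler_pM2r//.
move: hB; rewrite ler_pdivrMr ?mulr_gt0// => hB; rewrite -natr1.
have : 0 <= p * d by rewrite mulr_ge0 ?ltW.
by move: hB; set x := (_).+1%:R; lra.
Qed.

End Beta.

(** * Integrals over the torus and step functions *)

Section StepIntegral.
Context {R : realType}.
Local Notation mR := (measurableTypeR R).
Local Notation area := ((@lebesgue_measure R) \x (@lebesgue_measure R))%E.

Definition unit_square : set (mR * mR) := `[0, 1[ `*` `[0, 1[.

(** A weighted square: a weight, the lower left corner, the side. *)
Definition wsquare := (R * (R * R) * R)%type.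
Definition square (i : wsquare) : set (mR * mR) :=
  `[i.1.2.1, i.1.2.1 + i.2[ `*` `[i.1.2.2, i.1.2.2 + i.2[.
Definition step (s : seq wsquare) (x : mR * mR) : R :=
  \sum_(i <- s) i.1.1 * \1_(square i) x.
Definition step_area (s : seq wsquare) : R := \sum_(i <- s) i.1.1 * i.2 ^+ 2.

Lemma measurable_unit_square : measurable unit_square.
Proof. by apply: measurableX; exact: measurable_itv. Qed.

Lemma measurable_square i : measurable (square i).
Proof. by apply: measurableX; exact: measurable_itv. Qed.

Lemma area_square i : 0 <= i.2 -> area (square i) = (i.2 ^+ 2)%:E.
Proof.
move=> i0; rewrite /square product_measure1E; try exact: measurable_itv.
have E a : lebesgue_measure (`[a, a + i.2[ : set R) = (i.2)%:E.
  rewrite lebesgue_measure_itv/= lte_fin ltrDl lt_neqAle i0 andbT eq_sym.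
  case: eqVneq => [->//|_]; first by rewrite -EFinB; congr EFin; ring.
by rewrite expr2 EFinM; congr (_ * _)%E; exact: E.
Qed.

(** The integral of a nonnegative function is a supremum over the simple functions
below it, and is therefore monotone even among nonmeasurable functions. *)
Lemma le_integral_nonmeas (f h : mR * mR -> \bar R) :
  (forall x, unit_square x -> 0 <= f x)%E ->
  (forall x, unit_square x -> f x <= h x)%E ->
  (\int[area]_(x in unit_square) f x <= \int[area]_(x in unit_square) h x)%E.
Proof.
move=> f0 fh; have h0 x : unit_square x -> (0 <= h x)%E.
  by move=> Qx; apply: le_trans (f0 x Qx) (fh x Qx).
rewrite !ge0_integralE//; apply: le_ereal_sup => _ [k kf <-].
exists k => // x; apply: le_trans (kf x) _.
by rewrite /patch; case: ifPn => //; rewrite inE => /fh.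
Qed.

Lemma measurable_step s : measurable_fun setT (step s).
Proof.
rewrite /step; apply: measurable_sum => i; apply: measurable_funM => //.
by apply: measurable_indic; exact: measurable_square.
Qed.

Definition nonneg_weights (s : seq wsquare) :=
  all (fun i : wsquare => (0 <= i.1.1) && (0 <= i.2)) s.

Lemma step_ge0 s x : nonneg_weights s -> 0 <= step s x.
Proof.
move=> /allP s0; rewrite /step big_seq; apply: sumr_ge0 => i /s0 /andP[h _].
by rewrite mulr_ge0.
Qed.

Lemma integral_step s : nonneg_weights s ->
  (\int[area]_(x in unit_square) (step s x)%:E =
   \sum_(i <- s) i.1.1%:E * area (square i `&` unit_square))%E.
Proof.
move=> s0.
have mQ := measurable_unit_square.
elim: s s0 => [|i s IH] /=.
  by move=> _; rewrite big_nil integral0_eq// => x _; rewrite /step big_nil.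
move=> /andP[/andP[w0 l0] s0]; rewrite big_cons -IH//.
have -> : (fun x => (step (i :: s) x)%:E) =
    (fun x => (i.1.1%:E * (\1_(square i) x)%:E + (step s x)%:E)%E).
  by apply/funext => x; rewrite /step big_cons EFinD EFinM.
rewrite ge0_integralD//=; first last.
- by apply/measurable_EFinP; apply: measurable_funTS; exact: measurable_step.
- by move=> x _; rewrite lee_fin step_ge0.
- apply/measurable_EFinP; apply: measurable_funTS; apply: measurable_funM => //.
  by apply: measurable_indic; exact: measurable_square.
- by move=> x _; rewrite mule_ge0 ?lee_fin.
congr (_ + _)%E; rewrite ge0_integralZl//=; last first.
  apply/measurable_EFinP; apply: measurable_funTS.
  by apply: measurable_indic; exact: measurable_square.
by rewrite integral_indic//; exact: measurable_square.
Qed.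

Lemma integral_step_le s : nonneg_weights s ->
  (\int[area]_(x in unit_square) (step s x)%:E <= (step_area s)%:E)%E.
Proof.
move=> s0; rewrite integral_step// /step_area -sumEFin.
rewrite big_seq [leRHS]big_seq; apply: lee_sum => i /(allP s0)/andP[w0 l0].
rewrite EFinM lee_wpmul2l ?lee_fin// -area_square//.
apply: le_measure; rewrite ?inE//; last exact: measurable_square.
by apply: measurableI; [exact: measurable_square|exact: measurable_unit_square].
Qed.

Lemma integral_step_eq s : nonneg_weights s ->
  (forall i, i \in s -> square i `<=` unit_square) ->
  (\int[area]_(x in unit_square) (step s x)%:E = (step_area s)%:E)%E.
Proof.
move=> s0 sQ; rewrite integral_step// /step_area -sumEFin.
rewrite big_seq [RHS]big_seq; apply: eq_bigr => i si.
have /andP[w0 l0] := allP s0 _ si.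
by rewrite EFinM -area_square//; congr (_ * area _)%E; apply/setIidPl/sQ.
Qed.

Implicit Type f : torus R -> R.

Lemma torus_integral_ge0 f : (forall s, 0 <= f s) -> 0 <= torus_integral f.
Proof.
move=> f0; rewrite /torus_integral /Rintegral fine_ge0//.
by apply: integral_ge0 => x _; rewrite lee_fin.
Qed.

Lemma torus_integral_le f s : (forall t, 0 <= f t) -> nonneg_weights s ->
  (forall x, unit_square x -> f (toT x) <= step s x) ->
  torus_integral f <= step_area s.
Proof.
move=> f0 s0 fs; rewrite /torus_integral /Rintegral -lee_fin.
have h : (\int[area]_(x in unit_square) (f (toT x))%:E <= (step_area s)%:E)%E.
  apply: le_trans (integral_step_le s0); apply: le_integral_nonmeas => x Qx.
    by rewrite lee_fin.
  by rewrite lee_fin fs.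
rewrite fineK// ge0_fin_numE; first by apply: le_lt_trans h _; exact: ltry.
by apply: integral_ge0 => x _; rewrite lee_fin.
Qed.

(** The positive part of [step s1 - step s2] is measurable and below the integrand. *)
Lemma torus_integral_ge f s1 s2 M : (forall t, 0 <= f t <= M) ->
  nonneg_weights s1 -> nonneg_weights s2 ->
  (forall i, i \in s1 -> square i `<=` unit_square) ->
  (forall x, unit_square x -> step s1 x <= f (toT x) + step s2 x) ->
  step_area s1 <= torus_integral f + step_area s2.
Proof.
move=> fM s10 s20 s1Q h.
have f0 t : 0 <= f t by case/andP: (fM t).
have mQ := measurable_unit_square.
pose g x := Num.max (step s1 x - step s2 x) 0.
have g0 x : 0 <= g x by rewrite /g le_max lexx orbT.
have mg : measurable_fun setT g.
  by apply: measurable_maxr => //; apply: measurable_funB; exact: measurable_step.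
have gf x : unit_square x -> g x <= f (toT x).
  by move=> Qx; rewrite /g ge_max f0 andbT lerBlDr h.
have fin : (\int[area]_(x in unit_square) (f (toT x))%:E)%E \is a fin_num.
  rewrite ge0_fin_numE; last by apply: integral_ge0 => x _; rewrite lee_fin.
  have M0 : 0 <= M by case/andP: (fM (toT (0, 0))) => a b; apply: le_trans b.
  apply: (@le_lt_trans _ _ (step_area [:: (M, (0, 0), 1)])%:E); last exact: ltry.
  have w0 : nonneg_weights [:: (M, (0, 0), 1)] by rewrite /= M0 ler01.
  apply: le_trans (integral_step_le w0); apply: le_integral_nonmeas => x Qx.
    by rewrite lee_fin.
  rewrite lee_fin /step big_seq1 /= indicE mem_set ?mulr1; first by case/andP: (fM (toT x)).
  by rewrite /square /= !add0r.
rewrite /torus_integral /Rintegral -lee_fin EFinD fineK//.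
apply: (@le_trans _ _ (\int[area]_(x in unit_square) (g x)%:E +
    \int[area]_(x in unit_square) (step s2 x)%:E)%E); last first.
  apply: leeD; last exact: integral_step_le.
  by apply: le_integral_nonmeas => x Qx; rewrite lee_fin//; exact: gf.
rewrite -ge0_integralD//; first last.
- by apply/measurable_EFinP; apply: measurable_funTS; exact: measurable_step.
- by move=> x _; rewrite lee_fin step_ge0.
- by apply/measurable_EFinP; apply: measurable_funTS.
- by move=> x _; rewrite lee_fin.
rewrite -(integral_step_eq s10 s1Q); apply: le_integral_nonmeas => x Qx.
  by rewrite lee_fin step_ge0.
by rewrite -EFinD lee_fin /g -lerBlDr le_max lexx.
Qed.

End StepIntegral.

(** * Norms of 2x2 matrices *)

Section OpNorm.
Context {R : realType}.
Local Notation C := R[i].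
Implicit Types (M N : 'M[C]_2) (v w : 'cV[C]_2).

Lemma enormE v : enorm v = normc (normc (v 0 0) +i* normc (v 1 0))%C.
Proof.
by rewrite /enorm big_ord_recl big_ord1 /=; congr (Num.sqrt (_ + normc (v _ _) ^+ 2)); apply: val_inj.
Qed.

Lemma enorm_ge0 v : 0 <= enorm v. Proof. exact: sqrtr_ge0. Qed.

Lemma normc_mono (a b c d : R) : 0 <= a <= c -> 0 <= b <= d ->
  normc (a +i* b)%C <= normc (c +i* d)%C.
Proof.
move=> /andP[a0 ac] /andP[b0 bd] /=; apply: ler_wsqrtr; apply: lerD;
  rewrite lerXn2r// nnegrE//; [exact: le_trans ac|exact: le_trans bd].
Qed.

Lemma enormD v w : enorm (v + w) <= enorm v + enorm w.
Proof.
rewrite !enormE !mxE.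
apply: (@le_trans _ _ (normc ((normc (v 0 0) + normc (w 0 0)) +i*
   (normc (v 1 0) + normc (w 1 0)))%C)).
  by apply: normc_mono; rewrite normc_ge0 normcD.
exact: (@normcD R (Complex _ _) (Complex _ _)).
Qed.

Lemma enormZ (a : C) v : enorm (a *: v) = normc a * enorm v.
Proof.
rewrite !enormE !mxE !normcM.
have -> : (normc a * normc (v 0 0) +i* (normc a * normc (v 1 0)))%C =
  (normc a)%:C%C * (normc (v 0 0) +i* normc (v 1 0))%C by simpc.
by rewrite normcM normc_real ger0_norm// normc_ge0.
Qed.

Lemma enorm0 : enorm (0 : 'cV[C]_2) = 0.
Proof. by rewrite enormE !mxE normc0 normc0. Qed.

Lemma enorm_coord v i : normc (v i 0) <= enorm v.
Proof.
rewrite /enorm -[leLHS]ger0_norm ?normc_ge0// -sqrtr_sqr; apply: ler_wsqrtr.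
by rewrite (bigD1 i)//= lerDl sumr_ge0// => j _; rewrite sqr_ge0.
Qed.

Lemma enorm_le_sum v : enorm v <= \sum_i normc (v i 0).
Proof.
rewrite enormE (le_trans (normc_leD _))//= !ger0_norm ?normc_ge0//.
rewrite big_ord_recl big_ord1 lerD2l le_eqVlt; apply/orP; left; apply/eqP.
by congr (normc (v _ _)); apply: val_inj.
Qed.

Definition sumnorm M : R := \sum_i \sum_j normc (M i j).

Lemma sumnorm_ge0 M : 0 <= sumnorm M.
Proof. by apply: sumr_ge0 => i _; apply: sumr_ge0 => j _; exact: normc_ge0. Qed.

Lemma enorm_mul_sum M v : enorm (M *m v) <= sumnorm M * enorm v.
Proof.
apply: le_trans (enorm_le_sum _) _; rewrite /sumnorm big_distrl /=.
apply: ler_sum => i _; rewrite mxE big_distrl /=.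
apply: le_trans (normc_sum _ _ _) _; apply: ler_sum => j _.
by rewrite normcM ler_wpM2l ?normc_ge0// enorm_coord.
Qed.

Let S M : set R := [set enorm (M *m v) | v in [set v | enorm v <= 1]].

Let S_sup M : has_sup (S M).
Proof.
split; first by exists (enorm (M *m 0)), 0 => //=; rewrite enorm0 ler01.
exists (sumnorm M) => _ [v /= v1 <-]; apply: le_trans (enorm_mul_sum M v) _.
by rewrite ler_piMr// sumnorm_ge0.
Qed.

Lemma opnorm_ub M v : enorm v <= 1 -> enorm (M *m v) <= opnorm M.
Proof.
by move=> v1; apply: (sup_upper_bound (S_sup M)); exists v.
Qed.

Lemma opnorm_lub M (c : R) : (forall v, enorm v <= 1 -> enorm (M *m v) <= c) ->
  opnorm M <= c.
Proof.
move=> h; apply: ge_sup; first by case: (S_sup M).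
by move=> _ [v /= v1 <-]; exact: h.
Qed.

Lemma opnorm_ge0 M : 0 <= opnorm M.
Proof.
apply: le_trans (opnorm_ub M (v := 0) _); first exact: enorm_ge0.
by rewrite enorm0 ler01.
Qed.

Lemma opnormP M v : enorm (M *m v) <= opnorm M * enorm v.
Proof.
have [v0|v0] := eqVneq (enorm v) 0.
  rewrite v0 mulr0; apply: le_trans (enorm_mul_sum M v) _.
  by rewrite v0 mulr0.
have vp : 0 < enorm v by rewrite lt_neqAle eq_sym v0 enorm_ge0.
have := opnorm_ub M (v := ((enorm v)^-1)%:C%C *: v).
rewrite -scalemxAr !enormZ normc_real ger0_norm ?invr_ge0 ?(ltW vp)//.
rewrite mulVf// => /(_ (lexx _)).
by rewrite mulrC ler_pdivrMr.
Qed.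

Lemma opnormM M N : opnorm (M *m N) <= opnorm M * opnorm N.
Proof.
apply: opnorm_lub => v v1; rewrite -mulmxA; apply: le_trans (opnormP _ _) _.
by rewrite ler_wpM2l ?opnorm_ge0 ?opnorm_ub.
Qed.

Lemma opnormD M N : opnorm (M + N) <= opnorm M + opnorm N.
Proof.
apply: opnorm_lub => v v1; rewrite mulmxDl; apply: le_trans (enormD _ _) _.
by rewrite lerD ?opnorm_ub.
Qed.

Lemma opnorm_sum I (r : seq I) (F : I -> 'M[C]_2) :
  opnorm (\sum_(i <- r) F i) <= \sum_(i <- r) opnorm (F i).
Proof.
elim/big_ind2 : _ => [|a x b y ha hb|//].
  by apply: opnorm_lub => v _; rewrite mul0mx enorm0.
by apply: le_trans (opnormD _ _) _; rewrite lerD.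
Qed.

Lemma opnorm_sumnorm M : opnorm M <= sumnorm M.
Proof.
apply: opnorm_lub => v v1; apply: le_trans (enorm_mul_sum M v) _.
by rewrite ler_piMr// sumnorm_ge0.
Qed.

Lemma enorm_delta (j : 'I_2) : enorm (delta_mx j 0 : 'cV[C]_2) <= 1.
Proof.
rewrite /enorm (bigD1 j)//= big1 => [|k kj]; rewrite mxE ?(negPf kj) ?eqxx /=.
  by rewrite expr1n expr0n /= !addr0 sqrtr1 expr1n sqrtr1.
by rewrite expr0n /= addr0 sqrtr0 expr0n.
Qed.

Lemma opnorm_entry M i j : normc (M i j) <= opnorm M.
Proof.
apply: le_trans (opnorm_ub M (enorm_delta j)); rewrite -colE.
by apply: le_trans (enorm_coord _ i); rewrite !mxE.
Qed.

Lemma opnorm1 : opnorm 1%:M = 1 :> R.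
Proof.
apply/eqP; rewrite eq_le; apply/andP; split.
  by apply: opnorm_lub => v; rewrite mul1mx.
by apply: le_trans (opnorm_entry _ 0 0); rewrite mxE eqxx normc1.
Qed.

(** Half the sum of the squares of the entries bounds the determinant. *)
Lemma opnorm_det1 M : M 0 0 * M 1 1 - M 0 1 * M 1 0 = 1 -> 1 <= opnorm M.
Proof.
move=> D; set o := opnorm M.
have o0 : 0 <= o := opnorm_ge0 M.
have ecol (j : 'I_2) : normc (M 0 j) ^+ 2 + normc (M 1 j) ^+ 2 <= o ^+ 2.
  have := opnorm_ub M (enorm_delta j); rewrite -colE enormE !mxE /= => h.
  rewrite -[X in X <= _]sqr_sqrtr ?addr_ge0 ?sqr_ge0//.
  by rewrite lerXn2r// nnegrE// sqrtr_ge0.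
have h : 1 <= normc (M 0 0) * normc (M 1 1) + normc (M 0 1) * normc (M 1 0).
  rewrite -normc1 -D (le_trans (normcB _ _))//.
  by rewrite !normcM.
have := ecol 0; have := ecol 1; move: h.
set a := normc (M 0 0); set b := normc (M 1 1); set c := normc (M 0 1).
set d := normc (M 1 0) => h e1 e0.
have : 1 <= o ^+ 2.
  have := sqr_ge0 (a - b); have := sqr_ge0 (c - d).
  have : 2 * (a * b + c * d) <= a ^+ 2 + b ^+ 2 + c ^+ 2 + d ^+ 2.
    by have := sqr_ge0 (a - b); have := sqr_ge0 (c - d); rewrite !sqrrB; lra.
  by lra.
by rewrite -{1}(expr1n R 2) ler_pXn2r// nnegrE.
Qed.

End OpNorm.

(** * Transfer matrices *)

Section Transfer.
Context {R : realType}.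
Local Notation C := R[i].
Implicit Types (v : nat -> C).

Definition tmx (x : C) : 'M[C]_2 :=
  \matrix_(i < 2, j < 2) nth 0 (nth [::] [:: [:: x; -1]; [:: 1; 0]] i) j.

Fixpoint tprod v (k : nat) : 'M[C]_2 :=
  if k is k'.+1 then tmx (v k') *m tprod v k' else 1%:M.

Lemma eq_tprod_lt v v' k : (forall j, (j < k)%N -> v j = v' j) ->
  tprod v k = tprod v' k.
Proof.
elim: k => //= k IH h; rewrite h// IH// => j jk.
by apply: h; rewrite ltnW.
Qed.

Lemma eq_tprod v v' k : v =1 v' -> tprod v k = tprod v' k.
Proof. by move=> e; apply: eq_tprod_lt. Qed.

Lemma transfer_iterE al (phi : torus R -> R) z k s :
  transfer_iter al phi z k s =
  tprod (fun j => z - (phi (iter j (Defs.rot al) s))%:C%C) k.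
Proof. by elim: k => //= k ->. Qed.

Lemma tprodD v a k : tprod v (a + k) = tprod (fun j => v (a + j)%N) k *m tprod v a.
Proof.
elim: k => [|k IH]; first by rewrite addn0 mul1mx.
by rewrite addnS /= IH mulmxA.
Qed.

Lemma tmx_mul x (M : 'M[C]_2) j :
  (tmx x *m M) 0 j = x * M 0 j - M 1 j /\ (tmx x *m M) 1 j = M 0 j.
Proof.
have -> : (1 : 'I_2) = lift ord0 ord0 by apply: val_inj.
split; rewrite mxE !big_ord_recl big_ord0 !mxE /=; ring.
Qed.

Lemma tprod_sol v k :
  [/\ tprod v k 0 0 = sol v 0 1 k.+1, tprod v k 1 0 = sol v 0 1 k,
      tprod v k 0 1 = sol v 1 0 k.+1 & tprod v k 1 1 = sol v 1 0 k].
Proof.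
elim: k => [|k [IH1 IH2 IH3 IH4]]; first by split; rewrite !mxE.
have [a b] := tmx_mul (v k) (tprod v k) 0; have [c d] := tmx_mul (v k) (tprod v k) 1.
rewrite /= in a b c d *.
by split; rewrite ?a ?b ?c ?d ?IH1 ?IH2 ?IH3 ?IH4.
Qed.

Lemma tprod_det v k :
  tprod v k 0 0 * tprod v k 1 1 - tprod v k 0 1 * tprod v k 1 0 = 1.
Proof.
elim: k => [|k IH]; first by rewrite !mxE /=; ring.
have [a b] := tmx_mul (v k) (tprod v k) 0; have [c d] := tmx_mul (v k) (tprod v k) 1.
by rewrite /= a b c d -IH; ring.
Qed.

Lemma opnorm_tprod_ge1 v k : 1 <= opnorm (tprod v k).
Proof. by apply: opnorm_det1; exact: tprod_det. Qed.

Lemma sumnormE (M : 'M[C]_2) :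
  sumnorm M = normc (M 0 0) + normc (M 0 1) + (normc (M 1 0) + normc (M 1 1)).
Proof.
have e : lift ord0 ord0 = 1 :> 'I_2 by apply: val_inj.
by rewrite /sumnorm !big_ord_recl !big_ord0 !addr0 e.
Qed.

Lemma tmxE x : [/\ tmx x 0 0 = x, tmx x 0 1 = -1, tmx x 1 0 = 1 & tmx x 1 1 = 0].
Proof. by split; rewrite mxE. Qed.

Lemma opnorm_tmx x : opnorm (tmx x) <= normc x + 2.
Proof.
apply: le_trans (opnorm_sumnorm _) _; rewrite sumnormE.
have [-> -> -> ->] := tmxE x.
rewrite normcNE normc1 normc0; lra.
Qed.

Lemma opnorm_tmxB x y : opnorm (tmx x - tmx y) <= normc (x - y).
Proof.
apply: le_trans (opnorm_sumnorm _) _; rewrite sumnormE.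
have [e1 e2 e3 e4] := tmxE x; have [f1 f2 f3 f4] := tmxE y.
have E i j : (tmx x - tmx y) i j = tmx x i j - tmx y i j by rewrite !mxE.
rewrite !E e1 e2 e3 e4 f1 f2 f3 f4 !subrr normc0; lra.
Qed.

Lemma opnorm_tprod_le v k b : 1 <= b -> (forall j, normc (v j) + 2 <= b) ->
  opnorm (tprod v k) <= b ^+ k.
Proof.
move=> b1 vb; elim: k => [|k IH]; first by rewrite opnorm1.
rewrite /= exprS; apply: le_trans (opnormM _ _) _.
apply: ler_pM; rewrite ?opnorm_ge0//.
exact: le_trans (opnorm_tmx _) (vb k).
Qed.

(** Telescoping: exchange the factors one at a time. *)
Lemma tprodB v v' k : tprod v k - tprod v' k =
  \sum_(j < k) tprod (fun i => v (j.+1 + i)%N) (k - j.+1) *m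
    ((tmx (v j) - tmx (v' j)) *m tprod v' j).
Proof.
elim: k => [|k IH]; first by rewrite subrr big_ord0.
rewrite big_ord_recr /= subnn mul1mx mulmxBl.
have -> : tmx (v k) *m tprod v k - tmx (v' k) *m tprod v' k =
  tmx (v k) *m (tprod v k - tprod v' k)
   + (tmx (v k) *m tprod v' k - tmx (v' k) *m tprod v' k).
  by rewrite mulmxBr addrA subrK.
congr (_ + _); rewrite IH mulmx_sumr; apply: eq_bigr => j _.
rewrite subSn// /= mulmxA; congr (tmx (v _) *m _ *m _).
by rewrite subnKC.
Qed.

(** In each term of [tprodB] the lengths of the two blocks around the exchanged
factor add up to less than [k]. *)
Lemma tprod_perturb v v' k (c d lam : R) : 0 <= c -> 0 <= d -> 0 <= lam ->
  (forall a j, opnorm (tprod (fun i => v (a + i)%N) j) <= c * expR (j%:R * lam)) ->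
  (forall j, opnorm (tprod v' j) <= c * expR (j%:R * lam)) ->
  (forall j, (j < k)%N -> normc (v j - v' j) <= d) ->
  opnorm (tprod v k - tprod v' k) <= k%:R * (c ^+ 2 * expR (k%:R * lam) * d).
Proof.
move=> c0 d0 lam0 hv hv' hd; rewrite tprodB.
apply: le_trans (opnorm_sum _ _) _.
have -> : k%:R * (c ^+ 2 * expR (k%:R * lam) * d) =
    \sum_(j < k) (c ^+ 2 * expR (k%:R * lam) * d).
  by rewrite sumr_const card_ord mulr_natl.
apply: ler_sum => j _.
apply: le_trans (opnormM _ _) _.
apply: (@le_trans _ _ ((c * expR ((k - j.+1)%:R * lam)) *
    (d * (c * expR (j%:R * lam))))).
  apply: ler_pM; rewrite ?opnorm_ge0 ?hv//.
  apply: le_trans (opnormM _ _) _; apply: ler_pM; rewrite ?opnorm_ge0 ?hv'//.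
  by apply: le_trans (opnorm_tmxB _ _) _; exact: hd.
have -> : c * expR ((k - j.+1)%:R * lam) * (d * (c * expR (j%:R * lam))) =
    c ^+ 2 * (expR ((k - j.+1)%:R * lam) * expR (j%:R * lam)) * d by ring.
rewrite ler_wpM2r// ler_wpM2l ?exprn_ge0// -expRD ler_expR -mulrDl.
by rewrite ler_wpM2r// -natrD ler_nat; have := ltn_ord j; move: (nat_of_ord j); clear; lia.
Qed.

(** Each factor is conjugate to its transpose by one diagonal matrix of signs. *)
Lemma sumnorm_rev v k :
  sumnorm (tprod (fun j => v (k - j.+1)%N) k) = sumnorm (tprod v k).
Proof.
pose S : 'M[C]_2 := \matrix_(i, j) ((i == j)%:R * (-1) ^+ i).
have SS : S *m S = 1%:M.
  apply/matrixP => i j; rewrite mxE (bigD1 i)//= big1 ?addr0.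
    rewrite !mxE eqxx mul1r; case: eqVneq => [->|_]; last by rewrite mul0r mulr0.
    by rewrite mul1r -expr2 sqrr_sign.
  by move=> l li; rewrite mxE eq_sym (negPf li) !mul0r.
have ST x : (tmx x)^T = S *m tmx x *m S.
  apply/matrixP => i j; rewrite !mxE !big_ord_recl !big_ord0 !mxE !big_ord_recl !big_ord0 !mxE /=.
  by case: i => [[|[|[]]]]//= _; case: j => [[|[|[]]]]//= _; rewrite /= ?expr0 ?expr1; ring.
have rev (w : nat -> C) n : tprod (fun j => w (n - j.+1)%N) n = S *m (tprod w n)^T *m S.
  elim: n w => [|n IH] w; first by rewrite /= trmx1 mulmx1 SS.
  rewrite [LHS](tprodD (fun j => w (n.+1 - j.+1)%N) 1 n) /= mulmx1 subn1 /=.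
  have -> : tprod (fun j => w (n.+1 - (1 + j).+1)%N) n = tprod (fun j => w (n - j.+1)%N) n.
    by apply: eq_tprod => j; congr (w _); rewrite add1n subSS.
  by rewrite IH trmx_mul ST !mulmxA -[_ *m S *m S]mulmxA SS mulmx1.
rewrite rev /sumnorm exchange_big /=; apply: eq_bigr => i _; apply: eq_bigr => j _.
have SE (M : 'M[C]_2) a b : (S *m M *m S) a b = (-1) ^+ a * M a b * (-1) ^+ b.
  rewrite mxE (bigD1 b)//= big1 ?addr0 => [|l lb]; last by rewrite !mxE (negPf lb) mul0r mulr0.
  rewrite !mxE eqxx mul1r (bigD1 a)//= big1 ?addr0 => [|l la]; last by rewrite !mxE eq_sym (negPf la) !mul0r.
  by rewrite !mxE eqxx mul1r.
have ns a : normc ((-1 : C) ^+ a) = 1.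
  by rewrite normcX normcNE normc1 expr1n.
by rewrite SE !normcM !ns mul1r mulr1 mxE.
Qed.

(** The determinants being 1, the entries of the block are quadratic in those of the
products up to its two ends. One of the solutions with initial data [(0, 1)] or
[(1, 0)] is therefore large at an end. *)
Lemma growth_block v a k X N : 1 <= X -> (a + k < N)%N ->
  8 * X ^+ 2 < sumnorm (tprod (fun j => v (a + j)%N) k) -> growth v N X.
Proof.
move=> X1 akN hY; apply: contrapT => ng.
have X0 : 0 <= X by apply: le_trans X1.
have small (x y : R) n : `|x| <= 1 -> `|y| <= 1 -> (0 < n <= N)%N ->
    normc (sol v x%:C%C y%:C%C n) < X.
  move=> x1 y1 nN; rewrite ltNge; apply/negP => h; apply: ng.
  by exists x, y; split=> //; exists n.
have s01 n : (n <= N)%N -> normc (sol v 0 1 n) <= X.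
  case: n => [_|n nN]; first by rewrite /= expr0n addr0 sqrtr0.
  by apply: ltW; apply: (small 0 1); rewrite ?normr0 ?normr1.
have s10 n : (n <= N)%N -> normc (sol v 1 0 n) <= X.
  case: n => [_|n nN]; first by rewrite /= expr1n expr0n addr0 sqrtr1.
  by apply: ltW; apply: (small 1 0); rewrite ?normr0 ?normr1.
have ent n : (n < N)%N -> forall i j, normc (tprod v n i j) <= X.
  move=> nN i j; have [e1 e2 e3 e4] := tprod_sol v n.
  have two (l : 'I_2) : l = 0 \/ l = 1.
    by case: l => [[|[|[]]]]// h; [left|right]; apply: val_inj.
  case: (two i) => ->; case: (two j) => ->; rewrite ?e1 ?e2 ?e3 ?e4 ?s01 ?s10//;
    exact: ltnW.
have aN : (a < N)%N by apply: leq_ltn_trans akN; rewrite leq_addr.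
set A := tprod v a; set B := tprod v (a + k); set M := tprod _ k in hY.
have BMA : B = M *m A by rewrite /B tprodD.
have dA : A 0 0 * A 1 1 - A 0 1 * A 1 0 = 1 by exact: tprod_det.
have r2 (P Q : 'M[C]_2) i j : (P *m Q) i j = P i 0 * Q 0 j + P i 1 * Q 1 j.
  rewrite mxE !big_ord_recl big_ord0 addr0; congr (_ * _ + P _ _ * Q _ _);
  by apply: val_inj.
have M0 i : M i 0 = B i 0 * A 1 1 - B i 1 * A 1 0.
  by rewrite BMA !r2 -[LHS]mulr1 -dA; ring.
have M1 i : M i 1 = B i 1 * A 0 0 - B i 0 * A 0 1.
  by rewrite BMA !r2 -[LHS]mulr1 -dA; ring.
have hA := ent a aN; have hB := ent (a + k)%N akN.
have pr (x y x' y' : C) : normc x <= X -> normc y <= X -> normc x' <= X ->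
    normc y' <= X -> normc (x * y - x' * y') <= 2 * X ^+ 2.
  move=> hx hy hx' hy'.
  rewrite (le_trans (normcB _ _))// !normcM.
  have := normc_ge0 x; have := normc_ge0 y; have := normc_ge0 x'; have := normc_ge0 y'.
  by move=> *; rewrite expr2; nra.
move: hY; rewrite ltNge => /negP; apply.
have h i j : normc (M i j) <= 2 * X ^+ 2.
  have [->|->] : j = 0 \/ j = 1.
    by case: j => [[|[|[]]]]// h; [left|right]; apply: val_inj.
  - by rewrite M0; apply: pr.
  - by rewrite M1; apply: pr.
apply: (@le_trans _ _ (\sum_(i < 2) \sum_(j < 2) (2 * X ^+ 2))).
  by apply: ler_sum => i _; apply: ler_sum => j _.
rewrite !big_ord_recl !big_ord0; lra.
Qed.

End Transfer.

(** * The torus *)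

Section TorusBasics.
Context {R : realType}.
Implicit Types (x y : R * R).

Lemma toTD x y : toT (x + y) = toT x + toT y.
Proof. by rewrite /toT [RHS]piE. Qed.

Lemma toT_eq x y : toT x = toT y <-> x - y \in @Z2 R.
Proof.
rewrite (Quotient.idealrBE (@Z2 R : zmodClosed (R * R)%type)) /toT.
by split=> [->|/eqP].
Qed.

Lemma toT_surj (s : torus R) : exists x, toT x = s.
Proof. by exists (repr s); rewrite /toT reprK. Qed.

Lemma toT_int x (m n : int) : toT (x.1 + m%:~R, x.2 + n%:~R) = toT x.
Proof.
apply/toT_eq; rewrite unfold_in /=; case: x => x1 x2 /=.
by rewrite addrAC subrr add0r addrAC subrr add0r !intr_int.
Qed.

Lemma toT_frac x : toT (frac x.1, frac x.2) = toT x.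
Proof.
rewrite -(toT_int (frac x.1, frac x.2) (Num.floor x.1) (Num.floor x.2)) /=.
by rewrite /frac !subrK; case: x.
Qed.

Lemma Z2P x : reflect (exists m n : int, x = (m%:~R, n%:~R)) (x \in @Z2 R).
Proof.
rewrite unfold_in; apply: (iffP andP) => [[/intrP[m e1] /intrP[n e2]]|[m [n ->]]].
  by exists m, n; case: x e1 e2 => /= _ _ -> ->.
by rewrite /= !intr_int.
Qed.

Lemma toT_eqP x y :
  toT x = toT y -> exists m n : int, x = (y.1 + m%:~R, y.2 + n%:~R).
Proof.
move/toT_eq/Z2P => [m [n e]]; exists m, n.
by case: x y e => [x1 x2] [y1 y2] [<- <-]; congr (_, _) => /=; ring.
Qed.

Lemma continuous_toT : continuous (@toT R).
Proof. by apply/continuousP => U oU. Qed.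

Lemma rotz_toT al (n : int) x :
  rotz al n (toT x) = toT (x.1 + n%:~R * al.1, x.2 + n%:~R * al.2).
Proof.
have E (k : nat) : toT (k%:R * al.1, k%:R * al.2) = toT al *+ k.
  elim: k => [|k IH]; last rewrite [RHS]mulrS -IH -toTD.
    by rewrite !mul0r mulr0n; apply/esym; rewrite [LHS]piE.
  by congr toT; case: al {IH} => a b /=; rewrite -natr1; congr (_, _) => /=; ring.
rewrite /rotz; have [k [->|->]] : exists k : nat, n = k \/ n = - k%:Z.
- by case: n => k; [exists k; left | exists k.+1; right].
- by rewrite -pmulrn -E -toTD.
- rewrite mulrNz -pmulrn -E -[LHS]/(_ - _).
  have -> : x = ((x.1 + (- k%:Z)%:~R * al.1, x.2 + (- k%:Z)%:~R * al.2) +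
      (k%:R * al.1, k%:R * al.2)).
    by case: x => a b; congr (_, _) => /=; rewrite mulrNz -pmulrn; ring.
  rewrite toTD addrK /=; congr (toT (_, _)); rewrite mulrNz -pmulrn; ring.
Qed.

Lemma rot_toT al (k : nat) x : iter k (Defs.rot al) (toT x) =
  toT (x.1 + k%:R * al.1, x.2 + k%:R * al.2).
Proof. by rewrite -rotz_iter rotz_toT. Qed.

Let D (s t : torus R) : set R :=
  [set Num.sqrt ((x.1 - y.1) ^+ 2 + (x.2 - y.2) ^+ 2)
      | x in [set x | toT x = s] & y in [set y | toT y = t]].

Let hinfD s t : has_inf (D s t).
Proof.
split; last by exists 0 => _ [x _ [y _ <-]]; exact: sqrtr_ge0.
have [x xs] := toT_surj s; have [y yt] := toT_surj t.
by exists (Num.sqrt ((x.1 - y.1) ^+ 2 + (x.2 - y.2) ^+ 2)), x => //; exists y.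
Qed.

Lemma dist_le x y (d : R) : `|x.1 - y.1| <= d -> `|x.2 - y.2| <= d ->
  dist (toT x) (toT y) <= 2 * d.
Proof.
move=> h1 h2; have d0 : 0 <= d by apply: le_trans h1.
apply: le_trans (inf_lbound _ _) _.
- by case: (hinfD (toT x) (toT y)).
- by exists x => //; exists y => //.
rewrite -[leRHS]ger0_norm ?mulr_ge0// -sqrtr_sqr; apply: ler_wsqrtr.
rewrite -(real_normK (num_real (x.1 - _))) -(real_normK (num_real (x.2 - _))).
have : `|x.1 - y.1| ^+ 2 <= d ^+ 2 by rewrite lerXn2r// nnegrE.
have : `|x.2 - y.2| ^+ 2 <= d ^+ 2 by rewrite lerXn2r// nnegrE.
have := sqr_ge0 d; rewrite exprMn; lra.
Qed.

Lemma far_int (t : R) (m : int) : `|t| <= 2^-1 -> `|t| <= `|t + m%:~R|.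
Proof.
move=> t2; have [->|m0] := eqVneq m 0; first by rewrite addr0.
have m1 : 1 <= `|m%:~R : R| by rewrite -intr_norm ler1z -gtz0_ge1 normr_gt0.
have := ler_normB (t + m%:~R) t; rewrite addrAC subrr add0r => h.
by lra.
Qed.

(** For nearby points the identity is the shortest translation, in each coordinate. *)
Lemma dist_ge x y : `|x.1 - y.1| <= 2^-1 -> `|x.2 - y.2| <= 2^-1 ->
  `|x.1 - y.1| <= dist (toT x) (toT y) /\ `|x.2 - y.2| <= dist (toT x) (toT y).
Proof.
move=> h1 h2.
have S (a b : R) : `|a| <= Num.sqrt (a ^+ 2 + b ^+ 2).
  by rewrite -sqrtr_sqr; apply: ler_wsqrtr; rewrite lerDl sqr_ge0.
have key (c : R) : (forall x' y', toT x' = toT x -> toT y' = toT y ->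
    c <= Num.sqrt ((x'.1 - y'.1) ^+ 2 + (x'.2 - y'.2) ^+ 2)) ->
    c <= dist (toT x) (toT y).
  move=> h; apply: lb_le_inf; first by case: (hinfD (toT x) (toT y)).
  by move=> _ [x' ex [y' ey <-]]; exact: h.
have E x' y' : toT x' = toT x -> toT y' = toT y -> exists m n : int,
    x'.1 - y'.1 = x.1 - y.1 + m%:~R /\ x'.2 - y'.2 = x.2 - y.2 + n%:~R.
  move=> /toT_eqP[m [n ->]] /toT_eqP[m' [n' ->]] /=.
  by exists (m - m'), (n - n'); rewrite !intrB; split; ring.
split; apply: key => x' y' ex ey; have [m [n [-> ->]]] := E x' y' ex ey.
  by apply: le_trans (S _ _); exact: far_int.
by rewrite [X in Num.sqrt X]addrC; apply: le_trans (S _ _); exact: far_int.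
Qed.

End TorusBasics.

(** * The discontinuities of a piecewise Hoelder function *)

Section Thin.
Context {R : realType}.
Implicit Types (A B : set (R * R)).

(** At most one-dimensional, in a quantitative form for periodic sets: the number
of squares needed at scale [1/q] is only [O(q)]. *)
Definition thin A := exists CD : nat, forall q : nat, (0 < q)%N ->
  exists2 cs : seq (R * R), (size cs <= CD * q)%N &
  forall x, A x -> exists c (m n : int), [/\ c \in cs,
    `|x.1 - c.1 - m%:~R| <= q%:R^-1 & `|x.2 - c.2 - n%:~R| <= q%:R^-1].

Lemma thin_sub A B : A `<=` B -> thin B -> thin A.
Proof.
move=> AB [CD h]; exists CD => q q0; have [cs scs hcs] := h q q0.
by exists cs => // x /AB; exact: hcs.
Qed.

Lemma thin_bigU (I : eqType) (s : seq I) (F : I -> set (R * R)) :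
  (forall i, i \in s -> thin (F i)) -> thin [set x | exists2 i, i \in s & F i x].
Proof.
elim: s => [_|i s IH h].
  by exists 0%N => q q0; exists [::] => // x; case => i.
have [CD h1] : thin (F i) by apply: h; rewrite inE eqxx.
have [CD' h2] : thin [set x | exists2 j, j \in s & F j x].
  by apply: IH => j js; apply: h; rewrite inE js orbT.
exists (CD + CD')%N => q q0; have [cs scs hcs] := h1 q q0.
have [cs' scs' hcs'] := h2 q q0.
exists (cs ++ cs'); first by rewrite size_cat mulnDl leq_add.
move=> x [j]; rewrite inE => /predU1P[->|js] Fx.
  have [c [m [n [cc e1 e2]]]] := hcs x Fx.
  by exists c, m, n; rewrite mem_cat cc.
have [c [m [n [cc e1 e2]]]] := hcs' x (ex_intro2 _ _ j js Fx).
by exists c, m, n; rewrite mem_cat cc orbT.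
Qed.

Lemma smooth_lipschitz (g : R -> R) (a b : R) : smooth g -> a <= b ->
  exists2 L : nat, (0 < L)%N & forall s t, s \in `[a, b] -> t \in `[a, b] ->
    `|g s - g t| <= L%:R * `|s - t|.
Proof.
move=> sg ab.
have d0 t : derivable g t 1 := sg 0%N t.
have d1 t : derivable (derive1 g) t 1 := sg 1%N t.
have cD : {within `[a, b], continuous (fun t => `|derive1 g t|)}.
  apply: continuous_subspaceT => t; apply: (@continuous_comp _ _ _ (derive1 g) Num.norm).
    by apply/differentiable_continuous/derivable1_diffP.
  exact: norm_continuous.
have [c _ hc] := EVT_max ab cD.
have [L hL] := natr_above `|derive1 g c|.
exists L.+1 => // s t.
wlog st : s t / s <= t => [H si ti|].
  by case: (leP s t) => [st|/ltW ts]; [|rewrite distrC (distrC s)]; exact: H.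
move=> si ti.
have [u ui e] : exists2 u, u \in `[s, t] & g t - g s = derive1 g u * (t - s).
  apply: MVT_segment => // [x _|].
    by rewrite derive1E; apply: derivableP.
  apply: continuous_subspaceT => x.
  by apply/differentiable_continuous/derivable1_diffP.
rewrite distrC e normrM (distrC s) ler_wpM2r//.
apply: (le_trans (hc u _)); last by apply: le_trans hL _; rewrite ler_nat.
move: ui si ti; rewrite !in_itv /= => /andP[? ?] /andP[? ?] /andP[? ?].
by apply/andP; split; lra.
Qed.

(** A compact piece of a smooth curve is Lipschitz. *)
Lemma thin_curve (g1 g2 : R -> R) (t0 : R) : smooth g1 -> smooth g2 ->
  thin [set x | exists2 t, t \in `[t0 - 1, t0 + 1] & toT x = toT (g1 t, g2 t)].
Proof.
move=> s1 s2; have t01 : t0 - 1 <= t0 + 1 by lra.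
have [L1 L10 h1] := smooth_lipschitz s1 t01.
have [L2 L20 h2] := smooth_lipschitz s2 t01.
exists (2 * (L1 + L2) + 1)%N => q q0.
pose N := ((L1 + L2) * q)%N.
have N0 : (0 < N)%N by rewrite muln_gt0 q0 addn_gt0 L10.
have NR : 0 < N%:R :> R by rewrite ltr0n.
pose u (i : nat) : R := t0 - 1 + i%:R / N%:R.
exists [seq (g1 (u i), g2 (u i)) | i <- iota 0 (2 * N).+1].
  by rewrite size_map size_iota /N; move: L1 L2 q q0 {h1 h2 L10 L20 N N0 NR u}; clear; nia.
move=> x [t tI /toT_eqP[m [n ->]]].
have tI' := tI; move: tI'; rewrite in_itv /= => /andP[t1 t2].
pose i := Num.truncn ((t - t0 + 1) * N%:R).
have x0 : 0 <= (t - t0 + 1) * N%:R by apply: mulr_ge0; [lra|exact: ltW].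
have /andP[i1 i2] := truncn_itv x0; rewrite -/i in i1 i2.
have iN : (i <= 2 * N)%N.
  rewrite -(ler_nat R) natrM; apply: le_trans i1 _.
  by rewrite ler_wpM2r ?(ltW NR)//; lra.
have e : `|t - u i| <= N%:R^-1.
  have -> : t - u i = ((t - t0 + 1) * N%:R - i%:R) / N%:R.
    by rewrite /u; field; rewrite lt0r_neq0.
  rewrite normrM [`|_^-1|]ger0_norm ?invr_ge0 ?(ltW NR)// ler_piMl ?invr_ge0 ?(ltW NR)//.
  by rewrite ger0_norm ?subr_ge0// lerBlDr (le_trans (ltW i2))// -natr1 addrC.
have ui : u i \in `[t0 - 1, t0 + 1].
  rewrite in_itv /= /u lerDl divr_ge0//= ?ler0n//.
  have : i%:R / N%:R <= 2 :> R by rewrite ler_pdivrMr// -natrM ler_nat.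
  by move: (i%:R / N%:R) => ?; lra.
have LL (L : nat) : (L <= L1 + L2)%N -> L%:R * `|t - u i| <= q%:R^-1.
  move=> hL; apply: (@le_trans _ _ ((L1 + L2)%:R * N%:R^-1)).
    by apply: ler_pM => //; rewrite ler_nat.
  rewrite /N natrM invfM mulrA mulfV ?mul1r// lt0r_neq0// ltr0n addn_gt0 L10//.
exists (g1 (u i), g2 (u i)), m, n; split.
- apply: (map_f (fun i => (g1 (u i), g2 (u i))) (s := iota 0 (2 * N).+1)).
  by rewrite mem_iota add0n ltnS iN.
- by rewrite /= addrAC addrK (le_trans (h1 _ _ tI ui))// LL// leq_addr.
- by rewrite /= addrAC addrK (le_trans (h2 _ _ tI ui))// LL// leq_addl.
Qed.

End Thin.

(** Compactness of subsets of the plane is used below through open covers. *)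
HB.instance Definition _ (T U : ptopologicalType) := Pointed.on (T * U)%type.

Section ThinBoundary.
Context {R : realType}.

Lemma boundary_closed (S : set (torus R)) : closed (boundary S).
Proof.
rewrite /boundary setDE; apply: closedI; first exact: closed_closure.
by apply: open_closedC; exact: open_interior.
Qed.

(** By compactness, finitely many of the arcs that parametrize the boundary locally
cover the part of it over the closed unit square. *)
Lemma thin_boundary (S : set (torus R)) :
  smooth_1submanifold (boundary S) -> thin [set x | boundary S (toT x)].
Proof.
move=> sm; set C' : set (R * R) := [set x | boundary S (toT x)].
have loc (x : R * R) : exists U : set (R * R), C' x ->
    [/\ open U, U x & thin (U `&` C')].
  have [Cx|nCx] := pselect (C' x); last by exists setT.
  have [g1 [g2 /= [[s1 s2] _ [[t0 gt0] _] gV]]] := sm _ Cx.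
  have oV : open (`]t0 - 1, t0 + 1[%classic : set R) by exact: itv_open.
  have [W [oW gW]] := gV _ oV.
  exists (@toT R @^-1` W) => _; split.
  - by move/continuousP: (@continuous_toT R); apply.
  - rewrite /preimage /= -gt0.
    suff: (boundary S `&` W) (toT (g1 t0, g2 t0)) by case.
    by rewrite -gW; exists t0 => //=; rewrite in_itv /=; apply/andP; split; lra.
  apply: thin_sub (thin_curve t0 s1 s2) => y [Wy Cy].
  have : (boundary S `&` W) (toT y) by [].
  rewrite -gW => -[t tI e]; exists t => //.
  by move: tI; rewrite /= !in_itv /= => /andP[? ?]; apply/andP; split; exact: ltW.
have [U hU] := choice loc.
pose K : set (R * R) := (`[0, 1] `*` `[0, 1]) `&` C'.
have cC' : closed C'.
  apply: (@closed_comp _ _ (@toT R) (boundary S)); last exact: boundary_closed.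
  by move=> x _; exact: continuous_toT.
have cK : compact K.
  by apply: compact_closedI cC'; apply: compact_setX; exact: segment_compact.
have {}cK : cover_compact (K : set (R * R)%type).
  by move: cK; rewrite -(@compact_cover (R * R)%type).
have [||D' D'C KD'] := cK _ C' U.
- by move=> x /hU[].
- by move=> x [_ Cx]; exists x => //; case: (hU x Cx).
have : thin [set x | exists2 y, y \in finmap.enum_fset D' & (U y `&` C') x].
  apply: thin_bigU => y yD; have := D'C y yD; rewrite inE => Cy.
  by case: (hU y Cy).
case=> CD h; exists CD => q q0; have [cs scs hcs] := h q q0.
exists cs => // x Cx.
pose y := (frac x.1, frac x.2).
have xy : toT x = toT y by rewrite /y toT_frac.
have Cy : C' y by rewrite /C' /= -xy.
have Ky : K y.
  split => //; rewrite /y /=.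
  by have /andP[? ?] := frac_itv x.1; have /andP[? ?] := frac_itv x.2;
    split; rewrite /= in_itv /=; apply/andP; split => //; exact: ltW.
have [u uD Uuy] := KD' y Ky.
have [c [m [n [cc e1 e2]]]] : exists c (m n : int), [/\ c \in cs,
    `|y.1 - c.1 - m%:~R| <= q%:R^-1 & `|y.2 - c.2 - n%:~R| <= q%:R^-1].
  by apply: hcs; exists u.
exists c, (m + Num.floor x.1), (n + Num.floor x.2); split => //.
- suff -> : x.1 - c.1 - (m + Num.floor x.1)%:~R = y.1 - c.1 - m%:~R by [].
  by rewrite /y /= /frac intrD; ring.
- suff -> : x.2 - c.2 - (n + Num.floor x.2)%:~R = y.2 - c.2 - n%:~R by [].
  by rewrite /y /= /frac intrD; ring.
Qed.

End ThinBoundary.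

Section PiecewiseHolder.
Context {R : realType}.

(** A segment is connected, and the complement of the boundary of [S] is the union of
the interiors of [S] and of its complement. *)
Lemma segment_indic (S : set (torus R)) (x y : R * R) :
  (forall t : R, 0 <= t <= 1 ->
    ~ boundary S (toT (x.1 + t * (y.1 - x.1), x.2 + t * (y.2 - x.2)))) ->
  \1_S (toT x) = \1_S (toT y) :> R.
Proof.
move=> nb; pose h (t : R) := toT (x.1 + t * (y.1 - x.1), x.2 + t * (y.2 - x.2)).
have ch : continuous h.
  pose l (t : R) : R * R := (x.1 + t * (y.1 - x.1), x.2 + t * (y.2 - x.2)).
  have cl : continuous l.
    have ca (a b : R) : continuous (fun t : R => a + t * b).
      by move=> t; apply: cvgD; [exact: cvg_cst|apply: cvgMl; exact: cvg_id].
    move=> t; exact: (cvg_pair (ca x.1 (y.1 - x.1) t) (ca x.2 (y.2 - x.2) t)).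
  by move=> t; apply: (@continuous_comp _ _ _ l (@toT R)); [exact: cl|exact: continuous_toT].
have h0 : h 0 = toT x by rewrite /h !mul0r !addr0; case: (x).
have h1 : h 1 = toT y.
  by rewrite /h !mul1r ![_ + (_ - _)]addrC !subrK; case: (y).
have SI t : 0 <= t <= 1 -> closure S (h t) -> S^° (h t).
  by move=> /nb nbt cl; apply: contrapT => ni; apply: nbt.
have I0 : (0 : R) \in `[0, 1] by rewrite in_itv /= lexx ler01.
have I1 : (1 : R) \in `[0, 1] by rewrite in_itv /= lexx ler01.
pose B : set R := `[0, 1] `&` [set t | S^° (h t)].
have BE : B !=set0 -> B = `[0, 1]%classic.
  move=> B0; apply: (@segment_connected R 0 1) => //.
    exists [set t | S^° (h t)] => //.
    apply: (@open_comp _ _ h S^°); last exact: open_interior.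
    by move=> t _; exact: ch.
  exists [set t | closure S (h t)].
    apply: (@closed_comp _ _ h (closure S)); last exact: closed_closure.
    by move=> t _; exact: ch.
  apply/seteqP; split => t [tI]/= Bt; split => //.
    by apply: subset_closure; exact: interior_subset Bt.
  by apply: SI Bt; move: tI; rewrite /= in_itv.
have SB t : t \in `[0, 1] -> S (h t) -> B t.
  move=> tI St; split => //; apply: SI; first by move: tI; rewrite in_itv.
  exact: subset_closure.
have BS t : B t -> S (h t) by case=> _ /=; exact: interior_subset.
rewrite !indicE -h0 -h1; congr (_%:R); congr nat_of_bool.
apply/idP/idP; rewrite !inE => Sh; apply: BS; rewrite BE ?in_itv//=; 
  try by exists 0; exact: SB. 
by exists 1; exact: SB.
Qed.

Lemma ereal_sup_real (A : set (\bar R)) (a : \bar R) :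
  A a -> (forall x, A x -> (0 <= x)%E) -> (ereal_sup A < +oo)%E ->
  exists2 b : R, 0 <= b & forall x, A x -> (x <= b%:E)%E.
Proof.
move=> Aa A0 Aoo; have s0 : (0 <= ereal_sup A)%E.
  by apply: le_trans (A0 _ Aa) _; exact: ereal_sup_ubound.
exists (fine (ereal_sup A)); first exact: fine_ge0.
by move=> x Ax; rewrite fineK ?ge0_fin_numE//; exact: ereal_sup_ubound.
Qed.

Lemma toT_half_neq0 : toT ((2^-1, 0) : R * R) <> toT (0, 0).
Proof.
move=> /toT_eqP[m [n []]]; rewrite add0r => h _.
have h2 : (m * 2)%:~R = 1%:~R :> R by rewrite intrM -h mulVf.
move/eqP: h2; rewrite eqr_int => /eqP; clear; lia.
Qed.

(** The torus has two distinct points, so that both suprema are nonnegative and each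
is bounded by their sum. *)
Lemma holder_bounds g (psi : torus R -> R) : (holder_norm g psi < +oo)%E ->
  exists b H : R, [/\ 0 <= b, 0 <= H, forall s, `|psi s| <= b &
    forall s t, s <> t -> `|psi s - psi t| / dist s t `^ g <= H].
Proof.
rewrite /holder_norm; set A := [set _ | s in setT]; set B := [set _ | st in _].
have A1 : A (`|psi (toT (0, 0))|)%:E by exists (toT (0, 0)).
have A0 x : A x -> (0 <= x)%E by move=> [s _ <-]; rewrite lee_fin.
have B1 : exists x, B x.
  by eexists; exists (toT (2^-1, 0), toT (0, 0)) => //=; exact: toT_half_neq0.
have B0 x : B x -> (0 <= x)%E.
  by move=> [s _ <-]; rewrite lee_fin mulr_ge0// invr_ge0 powR_ge0.
have sA : (0 <= ereal_sup A)%E.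
  by apply: le_trans (A0 _ A1) _; exact: ereal_sup_ubound.
have sB : (0 <= ereal_sup B)%E.
  by case: B1 => x Bx; apply: le_trans (B0 _ Bx) _; exact: ereal_sup_ubound.
move=> hs.
have Aoo : (ereal_sup A < +oo)%E by apply: le_lt_trans hs; rewrite leeDl.
have Boo : (ereal_sup B < +oo)%E by apply: le_lt_trans hs; rewrite leeDr.
have [b b0 hb] := ereal_sup_real A1 A0 Aoo.
have [H H0 hH] : exists2 b : R, 0 <= b & forall x, B x -> (x <= b%:E)%E.
  by case: B1 => x Bx; exact: ereal_sup_real Bx B0 Boo.
exists b, H; split => // [s|s t st].
  by rewrite -lee_fin; apply: hb; exists s.
by rewrite -lee_fin; apply: hH; exists (s, t).
Qed.

(** Off the squares of side [O(1/q)] around the boundaries, two points at distance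
[1/q] are joined by a segment on which all indicator functions are constant. *)
Lemma piecewise_holder_scale (phi : torus R -> R) : piecewise_holder phi ->
  exists (c0 g C1 : R) (CD : nat),
    [/\ 0 <= c0, 0 < g, 0 <= C1, (forall s, `|phi s| <= c0) &
    forall q : nat, (1 < q)%N ->
    exists2 cs : seq (R * R), (size cs <= CD * q)%N &
    forall x y : R * R, `|x.1 - y.1| <= q%:R^-1 -> `|x.2 - y.2| <= q%:R^-1 ->
      (forall c (m n : int), c \in cs ->
        `|x.1 - c.1 - m%:~R| <= 2 / q%:R -> `|x.2 - c.2 - n%:~R| <= 2 / q%:R ->
        False) ->
      `|phi (toT x) - phi (toT y)| <= C1 * q%:R `^ (- g)].
Proof.
move=> [g [K [psi [S [g0 hh hS hphi]]]]].
have [b hb] := choice (fun j => holder_bounds (hh j)).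
have [H hH] := choice hb.
have [CDs hCDs] := choice (fun j => thin_boundary (hS j).1).
pose CD := (\sum_(j < K) CDs j)%N.
exists (\sum_j b j), g, (\sum_j H j * 2 `^ g), CD; split => //.
- by apply: sumr_ge0 => j _; case: (hH j).
- by apply: sumr_ge0 => j _; rewrite mulr_ge0 ?powR_ge0//; case: (hH j).
- move=> s; rewrite hphi (le_trans (ler_norm_sum _ _ _))//; apply: ler_sum => j _.
  have [_ _ hj _] := hH j; rewrite indicE normrM.
  by case: (_ \in _); rewrite ?normr1 ?mul1r// normr0 mul0r (le_trans _ (hj s)).
move=> q q1; have q0 : (0 < q)%N by exact: ltnW.
have qR : 0 < q%:R :> R by rewrite ltr0n.
have [cs hcs] := choice (fun j => let: ex_intro2 cs a b := hCDs j q q0 in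
  ex_intro (fun cs => _ /\ _) cs (conj a b)).
exists (flatten [seq cs j | j <- enum 'I_K]).
  rewrite size_flatten /shape -map_comp sumnE big_map big_enum /= /CD big_distrl /=.
  by apply: leq_sum => j _; case: (hcs j).
move=> x y h1 h2 far.
have ind j : \1_(S j) (toT x) = \1_(S j) (toT y) :> R.
  apply: segment_indic => t /andP[t0 t1] bt.
  have [c [m [n [cc e1 e2]]]] := (hcs j).2 _ bt.
  have cl (a a' d : R) (l : int) : `|a - a'| <= q%:R^-1 ->
      `|a + t * (a' - a) - d - l%:~R| <= q%:R^-1 -> `|a - d - l%:~R| <= 2 / q%:R.
    move=> u1 u2; have -> : a - d - l%:~R =
        (a + t * (a' - a) - d - l%:~R) + t * (a - a') by ring.
    apply: le_trans (ler_normD _ _) _; rewrite normrM (ger0_norm t0).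
    have : t * `|a - a'| <= `|a - a'| by rewrite ler_piMl.
    by move: u1 u2; set v := q%:R^-1; rewrite -/v; move: (t * _) => *; lra.
  apply: (far c m n _ (cl _ _ _ _ h1 e1) (cl _ _ _ _ h2 e2)).
  by apply/flattenP; exists (cs j) => //; apply: map_f; rewrite mem_enum.
have [->|xy] := eqVneq x y.
  rewrite subrr normr0 mulr_ge0 ?powR_ge0//.
  by apply: sumr_ge0 => j _; rewrite mulr_ge0 ?powR_ge0//; case: (hH j).
have q2 : q%:R^-1 <= 2^-1 :> R by rewrite lef_pV2 ?posrE// ler_nat.
have [d1 d2] := dist_ge (le_trans h1 q2) (le_trans h2 q2).
have dle := dist_le h1 h2.
have dpos : 0 < dist (toT x) (toT y).
  rewrite ltNge; apply/negP => d0; move: xy; rewrite [x]surjective_pairing.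
  rewrite [y]surjective_pairing; move: (le_trans d1 d0) (le_trans d2 d0).
  by rewrite !normr_le0 !subr_eq0 => /eqP-> /eqP->; rewrite eqxx.
have neq : toT x <> toT y.
  move=> e; have := dist_le (x := x) (y := x) (d := 0).
  rewrite !subrr normr0 mulr0 => /(_ (lexx _) (lexx _)).
  by rewrite [X in dist _ X]e leNgt dpos.
rewrite !hphi -sumrB big_distrl /=; apply: le_trans (ler_norm_sum _ _ _) _.
apply: ler_sum => j _; have [_ Hj0 _ hj] := hH j.
rewrite ind -mulrBr normrM.
apply: (@le_trans _ _ `|psi j (toT x) - psi j (toT y)|).
  by rewrite indicE; case: (_ \in _); rewrite ?normr1 ?mul1r// normr0 mul0r.
have := hj _ _ neq; rewrite ler_pdivrMr ?powR_gt0// => /le_trans; apply.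
rewrite -mulrA ler_wpM2l//.
apply: (@le_trans _ _ ((2 * q%:R^-1) `^ g)).
  by apply: ge0_ler_powR; rewrite ?nnegrE ?(ltW g0) ?(ltW dpos)// mulr_ge0// invr_ge0 ltW.
by rewrite powRM ?invr_ge0 ?(ltW qR)// -powR_inv1 ?(ltW qR)// -powRrM mulN1r.
Qed.

End PiecewiseHolder.

(** * Energies away from the spectrum *)

Section EasyEnergies.
Context {R : realType}.
Local Notation C := R[i].
Implicit Types (V : nat -> R) (z : C) (v : nat -> C).

Lemma growth_le v (N N' : nat) (X X' : R) : (N <= N')%N -> X' <= X ->
  growth v N X -> growth v N' X'.
Proof.
move=> NN XX [a [b [a1 b1 [n /andP[n0 nN] h]]]]; exists a, b; split=> //.
exists n; first by rewrite n0 (leq_trans nN).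
exact: le_trans XX h.
Qed.

(** When [normc (z - V k)] is at least 3, solutions double at every step. *)
Lemma far_growth V z (c0 : R) q : (forall k, `|V k| <= c0) -> c0 + 3 <= normc z ->
  growth (fun k => z - (V k)%:C%C) q.+1 (2 ^+ q).
Proof.
move=> Vc zc; set v := fun k => _.
have v3 k : 3 <= normc (v k).
  have := normcBC z (V k)%:C%C; have := normcD (v k) (V k)%:C%C.
  rewrite /v subrK normc_real; have := Vc k; lra.
have h k : 2 ^+ k <= normc (sol v 0 1 k.+1) /\
    normc (sol v 0 1 k) <= normc (sol v 0 1 k.+1).
  elim: k => [|k [IH1 IH2]].
    by rewrite expr0 normc1 normc0.
  have E : 2 * normc (sol v 0 1 k.+1) <= normc (sol v 0 1 k.+2).
    have e : v k * sol v 0 1 k.+1 = sol v 0 1 k.+2 + sol v 0 1 k.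
      by rewrite [sol v 0 1 k.+2]/= subrK.
    have := normcD (sol v 0 1 k.+2) (sol v 0 1 k).
    rewrite -e normcM.
    have := ler_wpM2r (normc_ge0 (sol v 0 1 k.+1)) (v3 k); lra.
  split; first by rewrite exprS; lra.
  by have := normc_ge0 (sol v 0 1 k.+1); lra.
exists 0, 1; split; rewrite ?normr0 ?normr1//.
by exists q.+1; rewrite ?leqnn//; case: (h q).
Qed.

(** The mass [S n] of the solution on [1, n] is [flux n / Im z], and the flux is
at most half of [|w n|^2 + |w n.+1|^2], so that [S] grows geometrically. *)
Lemma upper_growth V z (eta : R) (m : nat) (X : R) :
  0 <= eta <= complex.Im z -> 0 <= X ->
  X ^+ 2 * (2 * m).+1%:R <= (1 + 2 * eta) ^+ m ->
  growth (fun k => z - (V k)%:C%C) (2 * m).+1 X.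
Proof.
move=> /andP[e0 ez] X0 hX; set v := fun k => _.
pose w := sol v 0 1.
pose S n : R := \sum_(j < n) normc (w j.+1) ^+ 2.
have S0 n : 0 <= S n by apply: sumr_ge0 => j _; rewrite exprn_ge0 ?normc_ge0.
have SS n : S n.+1 = S n + normc (w n.+1) ^+ 2 by rewrite /S big_ord_recr.
have fl n : flux w n = complex.Im z * S n.
  elim: n => [|n IH].
    by rewrite /S big_ord0 mulr0 /flux /w /=; simpc.
  by rewrite (@flux_step _ V z w n erefl) IH SS mulrDr.
have step n : (1 + 2 * eta) * S n <= S n.+2.
  have := flux_le w n.+1; rewrite fl => h.
  have {}h := le_trans (ler_norm _) h.
  have h1 : eta * S n.+1 <= complex.Im z * S n.+1 by rewrite ler_wpM2r.
  have h2 : eta * S n <= eta * S n.+1.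
    by rewrite ler_wpM2l// SS lerDl exprn_ge0 ?normc_ge0.
  have h3 : 2 * (normc (w n.+1) * normc (w n.+2)) <= normc (w n.+1) ^+ 2 + normc (w n.+2) ^+ 2.
    by have := sqr_ge0 (normc (w n.+1) - normc (w n.+2)); rewrite sqrrB; lra.
  rewrite (SS n.+1) (SS n); lra.
have Sm : (1 + 2 * eta) ^+ m <= S (2 * m).+1.
  elim: m {hX} => [|k IH].
    rewrite muln0 expr0 SS.
    have -> : w 1%N = 1 by [].
    by rewrite normc1 expr1n lerDr.
  rewrite exprS mulnS; apply: le_trans (step _); rewrite ler_wpM2l//; lra.
apply: contrapT => ng.
have small n : (n < (2 * m).+1)%N -> normc (w n.+1) < X.
  move=> nm; rewrite ltNge; apply/negP => h; apply: ng.
  by exists 0, 1; rewrite normr0 normr1; split => //; exists n.+1.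
have : S (2 * m).+1 < X ^+ 2 * (2 * m).+1%:R.
  rewrite /S mulr_natr -[X in _ *+ X]card_ord -sumr_const; apply: ltr_sum.
    by apply/hasP; exists ord0; rewrite ?mem_index_enum.
  by move=> j _; rewrite ltrXn2r// ?nnegrE ?normc_ge0// small.
by rewrite ltNge (le_trans hX Sm).
Qed.

Lemma three_le_pow q : (0 < q)%N -> 3 <= (1 + 2 / q%:R) ^+ q :> R.
Proof.
move=> q0; have qR : 0 < q%:R :> R by rewrite ltr0n.
apply: le_trans (bernoulli_exp q _); last by rewrite lerDl divr_ge0// ltW.
by rewrite addrAC subrr add0r mulrCA mulfV ?lt0r_neq0//; lra.
Qed.

End EasyEnergies.

(** * Choice of the scales *)

Section Scales.
Context {R : realType}.

Lemma sqr_le_exp (x : R) : 0 <= x -> x ^+ 2 / 4 <= expR x.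
Proof.
move=> x0; have -> : x ^+ 2 / 4 = (x / 2) ^+ 2 by field.
have -> : expR x = expR (x / 2) ^+ 2 by rewrite expr2 -expRD; congr expR; field.
have h : x / 2 <= expR (x / 2).
  by apply: le_trans (expR_ge1Dx _); rewrite lerDr ler01.
by rewrite lerXn2r ?nnegrE ?expR_ge0 ?divr_ge0.
Qed.

(** The length [k] of the blocks is a multiple of [ln q], chosen so large that
growth at rate [l] over one block beats [q ^ A], and the tolerance [e] so small
that [expR (3 k e)] is still at most [q ^ g]. *)
Lemma scale_choice (g l Cs W T : R) (A : nat) : 0 < g <= 1 -> 0 < l -> 0 <= Cs ->
  0 <= W -> 1 <= T -> forall e, e = g * l / (6 * A.+1%:R) ->
  exists Q1 : nat, forall q, (Q1 <= q)%N -> exists k : nat,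
  [/\ (0 < k <= q)%N, Cs * k%:R < e * q%:R, W * k%:R <= expR (k%:R * e),
      expR (3 * (k%:R * e)) <= q%:R `^ g & q%:R `^ (- g) <= T^-1 /\
      q%:R ^+ A <= expR (k%:R * (l - e)) / 2].
Proof.
move=> /andP[g0 g1] l0 Cs0 W0 T1 e eE.
have A0 : 1 <= A.+1%:R :> R by rewrite ler1n.
have Ap : 0 < A.+1%:R :> R by rewrite ltr0n.
have e0 : 0 < e by rewrite eE divr_gt0 ?mulr_gt0.
pose b := 2 * A.+1%:R / l.
have b0 : 0 < b by rewrite divr_gt0 ?mulr_gt0.
have be : 3 * b * e = g by rewrite /b eE; field; rewrite !lt0r_neq0.
have el : e <= l / 2.
  rewrite eE ler_pdivrMr ?mulr_gt0//.
  have : g * l <= 1 * l by rewrite ler_wpM2r// ltW.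
  have : l * 1 <= l * A.+1%:R by rewrite ler_wpM2l// ltW.
  by lra.
pose X0 := 1 + (4 * Cs * b / e + 1) + (4 * W / e ^+ 2 + 2) / b + 4 * b + T / g
  + (l / 2 + 1).
have p1 : 0 <= 4 * Cs * b / e.
  by rewrite divr_ge0 ?(ltW e0)// mulr_ge0 ?(ltW b0)// mulr_ge0.
have p2 : 0 <= (4 * W / e ^+ 2 + 2) / b.
  by rewrite divr_ge0 ?(ltW b0)// addr_ge0// divr_ge0 ?exprn_ge0 ?(ltW e0)// mulr_ge0.
have p3 : 0 <= 4 * b by rewrite mulr_ge0// ltW.
have p4 : 0 <= T / g by rewrite divr_ge0 ?(ltW g0)// (le_trans ler01).
have p5 : 0 <= l / 2 + 1 by rewrite addr_ge0// divr_ge0// ltW.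
have [Q hQ] := natr_above (expR X0); exists Q => q Qq.
have qX : expR X0 <= q%:R by apply: le_trans hQ _; rewrite ler_nat.
have qR : 0 < q%:R :> R by apply: lt_le_trans qX; exact: expR_gt0.
pose x := ln (q%:R : R).
have qx : q%:R = expR x by rewrite lnK// posrE.
have xX : X0 <= x by rewrite -ler_expR -qx.
have x1 : 1 <= x by apply: le_trans xX; rewrite /X0; lra.
have x2 : 4 * Cs * b / e < x by apply: lt_le_trans xX; rewrite /X0; lra.
have x3 : (4 * W / e ^+ 2 + 2) / b <= x by apply: le_trans xX; rewrite /X0; lra.
have x4 : 4 * b <= x by apply: le_trans xX; rewrite /X0; lra.
have x5 : T / g <= x by apply: le_trans xX; rewrite /X0; lra.
have x6 : l / 2 + 1 <= x by apply: le_trans xX; rewrite /X0; lra.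
have x0 : 0 < x by apply: lt_le_trans x1.
have xq : x ^+ 2 / 4 <= q%:R by rewrite qx; apply: sqr_le_exp; exact: ltW.
have bx0 : 0 <= b * x by rewrite mulr_ge0 ?ltW.
pose k := Num.trunc (b * x).
have /andP[k1 k2] := truncn_itv bx0; rewrite -/k -natr1 in k1 k2.
have x3' : 4 * W / e ^+ 2 + 2 <= b * x by move: x3; rewrite ler_pdivrMr// [x * b]mulrC.
have W1 : 0 <= 4 * W / e ^+ 2 by rewrite divr_ge0 ?exprn_ge0 ?(ltW e0)// mulr_ge0.
have kW : 4 * W / e ^+ 2 + 1 <= k%:R by lra.
have kR : 0 < k%:R :> R by lra.
have k0 : 0 <= k%:R :> R := ltW kR.
have ke0 : 0 <= k%:R * e by rewrite mulr_ge0 ?ltW.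
exists k; split.
- rewrite -(ltr0n R) kR /= -(ler_nat R); apply: le_trans k1 _; apply: le_trans xq.
  by rewrite ler_pdivlMr// mulrAC [b * 4]mulrC expr2 ler_wpM2r// ltW.
- apply: (@le_lt_trans _ _ (Cs * (b * x))); first by rewrite ler_wpM2l.
  apply: lt_le_trans (ler_wpM2l (ltW e0) xq).
  move: x2; rewrite ltr_pdivrMr// => x2.
  rewrite (_ : e * _ = x * e / 4 * x); last by field.
  by rewrite mulrA ltr_pM2r// ltr_pdivlMr// mulrC mulrA.
- apply: le_trans (sqr_le_exp ke0); rewrite ler_pdivlMr// exprMn.
  have : 4 * W / e ^+ 2 <= k%:R by lra.
  rewrite ler_pdivrMr ?exprn_gt0// => h.
  rewrite (_ : W * _ * 4 = k%:R * (4 * W)); last by ring.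
  by rewrite expr2 -mulrA ler_wpM2l.
- rewrite /powR (gt_eqF qR) ler_expR -/x.
  have := ler_wpM2r (ltW e0) k1 => h.
  have : g * x = 3 * (b * x * e) by rewrite -be; ring.
  by move=> ->; rewrite ler_wpM2l.
split.
  have T0 : 0 < T by apply: lt_le_trans T1.
  rewrite powRN lef_pV2 ?posrE ?powR_gt0//.
  rewrite /powR (gt_eqF qR) -/x; apply: (le_trans _ (expR_ge1Dx _)).
  by move: x5; rewrite ler_pdivrMr// mulrC => h; rewrite (le_trans h)// lerDr.
rewrite ler_pdivlMr// qx -expRM_natl.
apply: (@le_trans _ _ (expR (A%:R * x) * expR 1)).
  by rewrite ler_wpM2l ?expR_ge0// (le_trans _ (expR_ge1Dx _)).
rewrite -expRD ler_expR.
have h1 : k%:R * (l / 2) <= k%:R * (l - e) by rewrite ler_wpM2l//; lra.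
apply: le_trans h1.
have h2 : (b * x - 1) * (l / 2) <= k%:R * (l / 2).
  by rewrite ler_wpM2r ?divr_ge0 ?(ltW l0)//; lra.
apply: le_trans h2.
have -> : (b * x - 1) * (l / 2) = A.+1%:R * x - l / 2.
  by rewrite /b; field; exact: lt0r_neq0.
by rewrite -natr1 mulrDl mul1r; lra.
Qed.

End Scales.

(** * Frequency of visits to small squares *)

Section Visits.
Context {R : realType}.
Implicit Types (x y al : R * R).

Definition orb al x (j : nat) : R * R := (x.1 + j%:R * al.1, x.2 + j%:R * al.2).

Lemma orbD al x a j : orb al (orb al x a) j = orb al x (a + j).
Proof. by rewrite /orb /= natrD; congr (_, _); ring. Qed.

(** Index of the cell of the square grid of mesh [1/p] on the torus. *)
Definition cidx (p : nat) (t : R) : nat := Num.trunc (p%:R * frac t).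
Definition cell p x : nat * nat := (cidx p x.1, cidx p x.2).

Lemma cidx_lt p t : (0 < p)%N -> (cidx p t < p)%N.
Proof.
move=> p0; have /andP[f0 f1] := frac_itv t.
rewrite /cidx truncn_lt_nat ?mulr_ge0 ?ler0n//.
by rewrite gtr_pMr ?ltr0n.
Qed.

Lemma cidx_itv p t : (0 < p)%N ->
  (cidx p t)%:R / p%:R <= frac t < (cidx p t)%:R / p%:R + p%:R^-1.
Proof.
move=> p0; have /andP[f0 f1] := frac_itv t.
have pR : 0 < p%:R :> R by rewrite ltr0n.
have h0 : 0 <= p%:R * frac t by rewrite mulr_ge0 ?ler0n.
have /andP[h1 h2] := truncn_itv h0; rewrite -/(cidx p t) in h1 h2.
rewrite ler_pdivrMr// mulrC h1 /= -[X in _ + X]mul1r -mulrDl ltr_pdivlMr//.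
by rewrite mulrC -natr1 in h2 *.
Qed.

Lemma cidx_uniq p t (m : int) (i : nat) : (i < p)%N ->
  i%:R / p%:R <= t - m%:~R < i%:R / p%:R + p%:R^-1 -> cidx p t = i.
Proof.
move=> ip /andP[h1 h2]; have p0 : (0 < p)%N by apply: leq_ltn_trans ip.
have pR : 0 < p%:R :> R by rewrite ltr0n.
have fm : Num.floor t = m.
  apply: floor_def.
  apply/andP; split.
    by rewrite -subr_ge0; apply: le_trans h1; rewrite divr_ge0 ?ler0n.
  rewrite intrD -ltrBlDl (lt_le_trans h2)//.
  by rewrite -[X in _ + X]mul1r -mulrDl ler_pdivrMr// mul1r natr1 ler_nat.
rewrite /cidx; apply/truncn_def; rewrite /frac fm.
rewrite mulrC -ler_pdivrMr// h1/= -ltr_pdivlMr//.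
by rewrite -natr1 mulrDl mul1r.
Qed.

(** The mesh [1/(q+1)] leaves a slack of [1/(q (q+1))]; the left end of the cell is
aimed at the middle of this slack, which tolerates an error of half of it. *)
Lemma cidx_shift q t (s : R) (i i' : nat) (m : int) : (0 < q)%N -> (i < q)%N ->
  cidx q.+1 t = i' ->
  `|i'%:R / q.+1%:R + s - (i%:R / q%:R + (2 * q * q.+1)%:R^-1) - m%:~R|
    <= (2 * q * q.+1)%:R^-1 ->
  cidx q (t + s) = i.
Proof.
move=> q0 iq ti' h; have /andP[t1 t2] := cidx_itv t (ltn0Sn q); rewrite ti' in t1 t2.
have e : (2 * q * q.+1)%:R^-1 + (2 * q * q.+1)%:R^-1 + q.+1%:R^-1 = q%:R^-1 :> R.
  have qn : q%:R != 0 :> R by rewrite pnatr_eq0 -lt0n.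
  have qn1 : q%:R + 1 != 0 :> R by rewrite natr1 pnatr_eq0.
  by rewrite !natrM -natr1; field; apply/andP.
move: h t1 t2; rewrite ler_distl.
set d := (2 * q * q.+1)%:R^-1 in e *; set a' := i'%:R / _; set a := i%:R / _.
move=> /andP[h1 h2] t1 t2.
apply: (@cidx_uniq q _ (m + Num.floor t)) => //.
rewrite intrD -/a; move: t1 t2; rewrite /frac; move: (Num.floor t)%:~R => F t1 t2.
rewrite -e; move: (q.+1%:R^-1) t2 d h1 h2 {e} => /= w t2 d h1 h2.
by move: (m%:~R : R) h1 h2 t1 t2 => M h1 h2 t1 t2; apply/andP; split; lra.
Qed.

Definition dense_orbits al := forall d : R, 0 < d -> exists n0 : nat,
  forall x y, exists n : nat, exists m1 m2 : int,
    [/\ (n <= n0)%N, `|x.1 + n%:R * al.1 - y.1 - m1%:~R| <= d &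
        `|x.2 + n%:R * al.2 - y.2 - m2%:~R| <= d].

Lemma hitting_dense (tau : R) al :
  rationally_independent al -> WDC tau al -> dense_orbits al.
Proof.
move=> ia wa d d0; have [e he] := hitting ia wa.
have [Q hQ] := natr_above d^-1.
have [q [Qq q0 h]] := he Q; exists (q ^ e)%N => x y.
have [n [m1 [m2 [nq h1 h2]]]] := h x y.
have qd : q%:R^-1 <= d.
  rewrite -[leRHS]invrK lef_pV2 ?posrE ?invr_gt0 ?ltr0n//.
  by apply: le_trans hQ _; rewrite ler_nat.
by exists n, m1, m2; split => //; apply: le_trans qd.
Qed.

Variable al : R * R.
Hypothesis dense : dense_orbits al.

(** Any cell of mesh [1/(q+1)] can be rotated into any cell of mesh [1/q]
within a bounded time; hence it receives at most [1/q^2] of the visits. *)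
Lemma visits q : (0 < q)%N -> exists n0 : nat, forall N x (i' : nat * nat),
  (i'.1 < q.+1)%N -> (i'.2 < q.+1)%N ->
  (q ^ 2 * \sum_(j < N) (cell q.+1 (orb al x j) == i') <= N + n0)%N.
Proof.
move=> q0; have d0 : 0 < (2 * q * q.+1)%:R^-1 :> R.
  by rewrite invr_gt0 ltr0n !muln_gt0 q0.
have [n0 hn0] := dense d0; exists n0 => N x [i1 i2] /= i1q i2q.
have one (c1 c2 : 'I_q) : (\sum_(j < N) (cell q.+1 (orb al x j) == (i1, i2)) <=
    \sum_(j < N + n0) (cell q (orb al x j) == (c1 : nat, c2 : nat)))%N.
  have [n [m1 [m2 [nn0 h1 h2]]]] := hn0 (i1%:R / q.+1%:R, i2%:R / q.+1%:R)
    (c1%:R / q%:R + (2 * q * q.+1)%:R^-1, c2%:R / q%:R + (2 * q * q.+1)%:R^-1).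
  apply: (@leq_trans (\sum_(j < N) (cell q (orb al x (j + n)) == (c1 : nat, c2 : nat)))).
    apply: leq_sum => j _; case: eqP => // -[e1 e2].
    rewrite lt0b -orbD /cell /=; apply/eqP; congr (_, _).
      exact: (cidx_shift q0 (ltn_ord c1) e1 h1).
    exact: (cidx_shift q0 (ltn_ord c2) e2 h2).
  rewrite -(big_mkord xpredT (fun j => nat_of_bool (cell q (orb al x (j + n)) == _))).
  rewrite -(big_mkord xpredT (fun j => nat_of_bool (cell q (orb al x j) == _))).
  have -> : (\sum_(0 <= j < N) (cell q (orb al x (j + n)) == (c1 : nat, c2 : nat)) =
     \sum_(n <= j < N + n) (cell q (orb al x j) == (c1 : nat, c2 : nat)))%N.
    by rewrite -{2}[n]add0n big_addn addnK.
  have nN : (N + n <= N + n0)%N by rewrite leq_add2l.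
  rewrite [X in (_ <= X)%N](@big_cat_nat _ _ _ n)//=; last first.
    by rewrite (leq_trans _ nN)// leq_addl.
  rewrite (leq_trans _ (leq_addl _ _))// [X in (_ <= X)%N](@big_cat_nat _ _ _ (N + n))//=.
    by rewrite leq_addr.
  by rewrite leq_addl.
apply: (@leq_trans (\sum_(c1 < q) \sum_(c2 < q)
   \sum_(j < N + n0) (cell q (orb al x j) == (c1 : nat, c2 : nat)))%N).
  rewrite -mulnn -mulnA -[X in (X * _)%N](card_ord q) -sum_nat_const.
  apply: leq_sum => c1 _; rewrite -[X in (X * _)%N](card_ord q) -sum_nat_const.
  by apply: leq_sum => c2 _; exact: one.
under eq_bigr do rewrite exchange_big /=.
rewrite exchange_big /= -[X in (_ <= X)%N]card_ord -sum1_card; apply: leq_sum => j _.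
set c := cell q _.
have c1 : (c.1 < q)%N by exact: cidx_lt.
have c2 : (c.2 < q)%N by exact: cidx_lt.
rewrite (bigD1 (Ordinal c1))//= [X in (_ + X)%N]big1 ?addn0; last first.
  move=> i /eqP ne; apply: big1 => i' _; case: eqP => // e; case: ne.
  by apply: val_inj; exact: esym (congr1 fst e).
rewrite (bigD1 (Ordinal c2))//= [X in (_ + X)%N]big1 ?addn0; last first.
  move=> i /eqP ne; case: eqP => // e; case: ne.
  by apply: val_inj; exact: esym (congr1 snd e).
by case: (_ == _).
Qed.

Lemma visits_sum q : (0 < q)%N -> exists n0 : nat,
  forall N x (f : R * R -> R) (u : nat * nat -> R),
  (forall y, 0 <= f y <= u (cell q.+1 y)) ->
  q%:R ^+ 2 * \sum_(j < N) f (orb al x j) <=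
  (\sum_(i1 < q.+1) \sum_(i2 < q.+1) u (i1 : nat, i2 : nat)) * (N + n0)%:R.
Proof.
move=> q0; have [n0 h] := visits q0; exists n0 => N x f u fu.
have u0 (i1 i2 : 'I_q.+1) : 0 <= u (i1 : nat, i2 : nat).
  pose y := (i1%:R / q.+1%:R, i2%:R / q.+1%:R) : R * R.
  have cy (i : 'I_q.+1) : cidx q.+1 (i%:R / q.+1%:R : R) = i.
    apply: (@cidx_uniq _ _ 0) => //.
    by rewrite subr0 lexx/= ltrDl invr_gt0 ltr0n.
  by have /andP[a b] := fu y; move: (le_trans a b); rewrite /cell /= !cy.
pose V (i : nat * nat) : R := \sum_(j < N) (cell q.+1 (orb al x j) == i)%:R.
apply: (@le_trans _ _ (q%:R ^+ 2 *
    \sum_(i1 < q.+1) \sum_(i2 < q.+1) u (i1 : nat, i2 : nat) * V (i1 : nat, i2 : nat))).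
  rewrite ler_wpM2l ?exprn_ge0//.
  have -> : \sum_(i1 < q.+1) \sum_(i2 < q.+1) u (i1 : nat, i2 : nat) * V (i1 : nat, i2 : nat)
     = \sum_(j < N) \sum_(i1 < q.+1) \sum_(i2 < q.+1) u (i1 : nat, i2 : nat) *
         (cell q.+1 (orb al x j) == (i1 : nat, i2 : nat))%:R.
    under eq_bigr => i1 _ do under eq_bigr => i2 _ do rewrite /V mulr_sumr.
    rewrite [RHS]exchange_big /=; apply: eq_bigr => i1 _.
    by rewrite exchange_big.
  apply: ler_sum => j _; set y := orb al x j.
  have c1 : ((cell q.+1 y).1 < q.+1)%N by exact: cidx_lt.
  have c2 : ((cell q.+1 y).2 < q.+1)%N by exact: cidx_lt.
  have t0 (i1 i2 : 'I_q.+1) : 0 <= u (i1 : nat, i2 : nat) *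
      (cell q.+1 y == (i1 : nat, i2 : nat))%:R by rewrite mulr_ge0 ?ler0n.
  rewrite (bigD1 (Ordinal c1))//= (bigD1 (Ordinal c2))//=.
  rewrite -[leLHS]addr0 lerD//; last first.
    by apply: sumr_ge0 => i _; apply: sumr_ge0 => i' _; exact: t0.
  rewrite -[leLHS]addr0 lerD//; last by apply: sumr_ge0 => i _; exact: (t0 (Ordinal c1)).
  by rewrite eqxx mulr1; case/andP: (fu y).
rewrite mulr_sumr mulr_suml; apply: ler_sum => i1 _.
rewrite mulr_sumr mulr_suml; apply: ler_sum => i2 _.
rewrite mulrCA ler_wpM2l// /V -natr_sum -natrX -natrM ler_nat.
exact: (h N x (i1 : nat, i2 : nat) (ltn_ord i1) (ltn_ord i2)).
Qed.

End Visits.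

Section ErgodicUpper.
Context {R : realType}.
Variable al : R * R.
Hypothesis dense : dense_orbits al.
Implicit Type G : torus R -> R.

Lemma frac_id (t : R) : 0 <= t < 1 -> frac t = t.
Proof.
move=> /andP[t0 t1]; rewrite /frac.
have -> : Num.floor t = 0 by apply: floor_def; rewrite t0/= add0r.
by rewrite subr0.
Qed.

(** Upper Riemann integrability, with an explicit majorant of the oscillation. *)
Definition almost_continuous G := forall e : R, 0 < e -> exists P0 : nat,
  forall p, (P0 <= p)%N -> exists s : seq wsquare,
    [/\ nonneg_weights s, step_area s <= e & forall x y : R * R, unit_square x ->
      `|x.1 - y.1| <= p%:R^-1 -> `|x.2 - y.2| <= p%:R^-1 ->
      G (toT y) <= G (toT x) + step s x].

(** By [visits] each cell of mesh [1/(q+1)] is visited with frequency at most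
[1/q ^ 2], so that Birkhoff averages are at most [((q+1)/q) ^ 2] times the upper
Riemann sum over the grid. *)
Lemma ergodic_upper G (M e : R) : (forall t, 0 <= G t <= M) ->
  almost_continuous G -> 0 < e -> exists C : R, 0 <= C /\ forall N x,
    \sum_(j < N) G (toT (orb al x j)) <= N%:R * (torus_integral G + e) + C.
Proof.
move=> GM ac e0; set I := torus_integral G.
have I0 : 0 <= I by apply: torus_integral_ge0 => t; case/andP: (GM t).
have e2 : 0 < e / 2 by rewrite divr_gt0.
have [P0 hP] := ac _ e2.
(* Such a [q] gives [((q+1)/q) ^ 2 * (I + e / 2) <= I + e]. *)
have [Q hQ] := natr_above (6 * (I + e) / e).
pose q := (maxn (maxn P0 Q) 1).
have q0 : (0 < q)%N by rewrite /q leq_max orbT.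
have qP : (P0 <= q.+1)%N by rewrite ltnW// ltnS /q !leq_max leqnn.
have qQ : 6 * (I + e) / e <= q%:R.
  by apply: le_trans hQ _; rewrite ler_nat /q !leq_max leqnn orbT.
have qR : 0 < q%:R :> R by rewrite ltr0n.
set p := q.+1 in qP; have pR : 0 < p%:R :> R by rewrite ltr0n.
have [s2 [s20 s2e s2G]] := hP p qP.
pose U (i : nat * nat) : set R := [set G (toT y) | y in [set y | cell p y = i]].
have supU (y : R * R) : has_sup (U (cell p y)).
  split; first by exists (G (toT y)), y.
  by exists M => _ [y' _ <-]; case/andP: (GM (toT y')).
pose u i := sup (U i).
have uG (y : R * R) : 0 <= G (toT y) <= u (cell p y).
  case/andP: (GM (toT y)) => -> _ /=; apply: sup_upper_bound; first exact: supU.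
  by exists y.
have cy (i : 'I_p) : cidx p (i%:R / p%:R : R) = i.
  apply: (@cidx_uniq _ _ _ 0) => //.
  by rewrite subr0 lexx/= ltrDl invr_gt0.
have u0 (i : 'I_p * 'I_p) : 0 <= u (i.1 : nat, i.2 : nat).
  have /andP[a b] := uG (i.1%:R / p%:R, i.2%:R / p%:R); move: (le_trans a b).
  by rewrite /cell /= !cy.
pose w (i : 'I_p * 'I_p) : wsquare :=
  (u (i.1 : nat, i.2 : nat), (i.1%:R / p%:R, i.2%:R / p%:R), p%:R^-1).
pose s1 := [seq w i | i <- index_enum ('I_p * 'I_p)%type].
have ule (x : R * R) : unit_square x -> step s1 x <= u (cell p x).
  move=> [x1 x2].
  have {}x1 : frac x.1 = x.1 by apply: frac_id; move: x1; rewrite /= in_itv.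
  have {}x2 : frac x.2 = x.2 by apply: frac_id; move: x2; rewrite /= in_itv.
  pose c : 'I_p * 'I_p := (Ordinal (cidx_lt x.1 (ltn0Sn q)), Ordinal (cidx_lt x.2 (ltn0Sn q))).
  rewrite /step big_map (bigD1 c)//= [X in _ + X]big1 ?addr0; last first.
    move=> [i1 i2] ic; rewrite indicE.
    have [[h1 h2]|ns] := pselect (square (w (i1, i2)) x);
      last by rewrite memNset// mulr0.
    case/eqP: ic; rewrite /square /= !in_itv /= in h1 h2.
    congr (_, _); apply: val_inj => /=; apply/esym;
      by apply: (@cidx_uniq _ _ _ 0) => //; rewrite subr0.
  rewrite indicE ler_piMr//; first exact: (u0 c).
  by case: (_ \in _).
have uub (x : R * R) : unit_square x -> u (cell p x) <= G (toT x) + step s2 x.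
  move=> xQ; apply: ge_sup; first by case: (supU x).
  move=> _ [y yc <-]; rewrite -(toT_frac y).
  have [x1 x2] := xQ.
  have {}x1 : frac x.1 = x.1 by apply: frac_id; move: x1; rewrite /= in_itv.
  have {}x2 : frac x.2 = x.2 by apply: frac_id; move: x2; rewrite /= in_itv.
  have [y1 y2] : cidx p y.1 = cidx p x.1 /\ cidx p y.2 = cidx p x.2.
    by split; [exact: (congr1 fst yc)|exact: (congr1 snd yc)].
  have near (t t' : R) : frac t = t -> cidx p t' = cidx p t -> `|t - frac t'| <= p%:R^-1.
    move=> ft ct; have /andP[a b] := cidx_itv t (ltn0Sn q).
    have /andP[a' b'] := cidx_itv t' (ltn0Sn q); move: a b a' b'; rewrite ct ft.
    set c := _ / _; rewrite -/p; move: (p%:R^-1) => r a b a' b'.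
    by rewrite ler_norml; apply/andP; split; lra.
  by apply: s2G => //; exact: near.
have wsq i : i \in s1 -> square i `<=` unit_square.
  move=> /mapP[j _ ->] x [/=]; rewrite !in_itv /= => /andP[h1 h2] /andP[h3 h4].
  have b (k : 'I_p) : k%:R / p%:R + p%:R^-1 <= 1 :> R.
    by rewrite -[X in _ + X]mul1r -mulrDl ler_pdivrMr// mul1r natr1 ler_nat.
  split; rewrite /= in_itv /=; apply/andP; split.
  - by apply: le_trans h1; rewrite divr_ge0 ?ler0n.
  - exact: lt_le_trans h2 (b _).
  - by apply: le_trans h3; rewrite divr_ge0 ?ler0n.
  - exact: lt_le_trans h4 (b _).
have s10 : nonneg_weights s1.
  by apply/allP => _ /mapP[i _ ->] /=; rewrite u0/= invr_ge0 ltW.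
have := torus_integral_ge GM s10 s20 wsq (fun x xQ => le_trans (ule x xQ) (uub x xQ)).
rewrite -/I {1}/step_area big_map /= -big_distrl /= => hA.
have [n0 hn] := visits_sum dense q0.
exists ((I + e) * n0%:R); split.
  by rewrite mulr_ge0 ?ler0n// addr_ge0// ltW.
move=> N x; have := hn N x (fun y => G (toT y)) u uG.
set S := \sum_(j < N) _.
have -> : \sum_(i1 < q.+1) \sum_(i2 < q.+1) u (i1 : nat, i2 : nat) =
    \sum_(i : 'I_p * 'I_p) u (i.1 : nat, i.2 : nat).
  by rewrite (pair_bigA _ (fun i1 i2 : 'I_q.+1 => u (i1 : nat, i2 : nat))).
set T := \sum_(i : 'I_p * 'I_p) _ in hA *.
move=> hS.
have hT : T <= (q%:R + 1) ^+ 2 * (I + e / 2).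
  have : T * p%:R^-1 ^+ 2 <= I + e / 2 by apply: le_trans hA _; rewrite lerD2l.
  by rewrite exprVn ler_pdivrMr ?exprn_gt0// mulrC natr1.
have hq : (q%:R + 1) ^+ 2 * (I + e / 2) <= q%:R ^+ 2 * (I + e).
  move: qQ; rewrite ler_pdivrMr//.
  have q1 : 1 <= q%:R :> R by rewrite ler1n.
  move: (q%:R) qR q1 => r r0 r1 h.
  have h' := ler_wpM2l (ltW r0) h.
  have : (r + 1) ^+ 2 <= r ^+ 2 + 3 * r by rewrite sqrrD expr2 in h' *; nra.
  by move=> hh; nra.
have : q%:R ^+ 2 * S <= q%:R ^+ 2 * ((I + e) * (N + n0)%:R).
  apply: le_trans hS _; rewrite mulrA; apply: ler_wpM2r; first exact: ler0n.
  exact: le_trans hT hq.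
by rewrite ler_pM2l ?exprn_gt0// natrD mulrDr [_ * N%:R]mulrC.
Qed.

End ErgodicUpper.

(** * Exceptional squares along an orbit *)

Section CenterSquares.
Context {R : realType}.
Variable al : R * R.

Lemma step_ge_mem (s : seq wsquare) i (x : R * R) : nonneg_weights s -> i \in s ->
  square i x -> i.1.1 <= step s x.
Proof.
move=> s0 si sx; rewrite /step (big_rem i)//= indicE mem_set// mulr1 lerDl.
rewrite big_seq; apply: sumr_ge0 => j /mem_rem /(allP s0) /andP[h _].
by rewrite mulr_ge0.
Qed.

(** The centers are moved back along the orbit; of the integer translates of each,
only nine can come close to the unit square. *)
Lemma center_squares (cs : seq (R * R)) (k p : nat) : (3 <= p)%N ->
  exists2 bs : seq (R * R), size bs = (9 * (k * size cs))%N &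
  forall (M : R) (x : R * R) j c (m n : int), 0 <= M -> unit_square x ->
    (j < k)%N -> c \in cs ->
    `|(orb al x j).1 - c.1 - m%:~R| <= 2 / p%:R ->
    `|(orb al x j).2 - c.2 - n%:~R| <= 2 / p%:R ->
    M <= step [seq (M, b, 5 / p%:R) | b <- bs] x.
Proof.
move=> p3; have pR : 0 < p%:R :> R by rewrite ltr0n (leq_trans _ p3).
have p23 : 2 / p%:R <= 2 / 3 :> R.
  by rewrite ler_wpM2l// lef_pV2 ?posrE// ler_nat.
pose sh : seq (R * R) := [seq (a, b) | a <- [:: -1; 0; 1], b <- [:: -1; 0; 1]].
pose cor (jc : nat * (R * R)) (a : R * R) : R * R :=
  (frac (jc.2.1 - jc.1%:R * al.1) + a.1 - 2 / p%:R,
   frac (jc.2.2 - jc.1%:R * al.2) + a.2 - 2 / p%:R).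
pose js := [seq (j, c) | j <- iota 0 k, c <- cs].
exists [seq cor jc a | jc <- js, a <- sh].
  by rewrite !size_allpairs size_iota mulnC.
move=> M x j c m n M0 [x1 x2] jk cc h1 h2.
have key (t d a : R) (i : int) : 0 <= t < 1 -> `|t + a - d - i%:~R| <= 2 / p%:R ->
    exists2 s : R, s \in [:: -1; 0; 1] &
      frac (d - a) + s - 2 / p%:R <= t < frac (d - a) + s - 2 / p%:R + 5 / p%:R.
  move=> /andP[t0 t1]; have /andP[f0 f1] := frac_itv (d - a).
  have -> : t + a - d - i%:~R = t - frac (d - a) - (i + Num.floor (d - a))%:~R.
    by rewrite /frac intrD; ring.
  set l := (i + _)%R; set f := frac _ in f0 f1 *.
  rewrite ler_norml => /andP[u1 u2].
  have r0 : 0 < p%:R^-1 :> R by rewrite invr_gt0.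
  exists l%:~R.
    have b1 : l < 2.
      by rewrite -(ltr_int R); move: (l%:~R : R) u1 u2 => L u1 u2; lra.
    have b2 : -2 < l.
      by rewrite -(ltr_int R); move: (l%:~R : R) u1 u2 => L u1 u2; lra.
    have [->|[->|->]] : l = -1 \/ l = 0 \/ l = 1.
      by move: l b1 b2 {u1 u2}; clear; lia.
    - by rewrite mulrN1z !inE eqxx.
    - by rewrite !inE eqxx orbT.
    - by rewrite !inE eqxx !orbT.
  by move: (l%:~R : R) u1 u2 => L u1 u2; apply/andP; split; lra.
have [s1 s1i b1] : exists2 s : R, s \in [:: -1; 0; 1] &
    frac (c.1 - j%:R * al.1) + s - 2 / p%:R <= x.1 <
    frac (c.1 - j%:R * al.1) + s - 2 / p%:R + 5 / p%:R.
  by apply: key h1; move: x1; rewrite /= in_itv.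
have [s2 s2i b2] : exists2 s : R, s \in [:: -1; 0; 1] &
    frac (c.2 - j%:R * al.2) + s - 2 / p%:R <= x.2 <
    frac (c.2 - j%:R * al.2) + s - 2 / p%:R + 5 / p%:R.
  by apply: key h2; move: x2; rewrite /= in_itv.
have inb : cor (j, c) (s1, s2) \in [seq cor jc a | jc <- js, a <- sh].
  apply: allpairs_f; first by apply: allpairs_f => //; rewrite mem_iota.
  exact: allpairs_f.
apply: (@step_ge_mem _ (M, cor (j, c) (s1, s2), 5 / p%:R)).
- apply/allP => _ /mapP[b _ ->] /=; rewrite M0/= mulr_ge0// invr_ge0 ltW//.
- exact: (map_f (fun b => (M, b, 5 / p%:R))).
- by split; rewrite /= in_itv.
Qed.

Lemma step_cat (s t : seq wsquare) x : step (s ++ t) x = step s x + step t x :> R.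
Proof. by rewrite /step big_cat. Qed.

Lemma step_area_cat (s t : seq wsquare) :
  step_area (s ++ t) = step_area s + step_area t :> R.
Proof. by rewrite /step_area big_cat. Qed.

Lemma step_unit (w : R) (x : R * R) : unit_square x -> step [:: (w, (0, 0), 1)] x = w.
Proof.
move=> xQ; rewrite /step big_seq1 /= indicE mem_set ?mulr1//.
by rewrite /square /= !add0r.
Qed.

Lemma step_area_unit (w : R) : step_area [:: (w, (0, 0), 1)] = w.
Proof. by rewrite /step_area big_seq1 /= expr1n mulr1. Qed.

Lemma step_area_const (bs : seq (R * R)) (M l : R) :
  step_area [seq (M, b, l) | b <- bs] = (size bs)%:R * (M * l ^+ 2).
Proof.
rewrite /step_area big_map /=; elim: bs => [|b bs IH]; first by rewrite big_nil mul0r.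
by rewrite big_cons IH /= -natr1; ring.
Qed.

Lemma powRN_small (g e : R) : 0 < g -> 0 < e ->
  exists P0, forall p, (P0 <= p)%N -> p%:R `^ (- g) <= e.
Proof.
move=> g0 e0; have [P hP] := natr_above (e^-1 `^ g^-1).
exists P.+1 => p Pp; have p0 : 0 < p%:R :> R by rewrite ltr0n (leq_trans _ Pp).
rewrite powRN -[leRHS]invrK lef_pV2 ?posrE ?powR_gt0 ?invr_gt0//.
have -> : e^-1 = (e^-1 `^ g^-1) `^ g.
  by rewrite -powRrM mulVf ?lt0r_neq0// powRr1// invr_ge0 ltW.
apply: ge0_ler_powR; rewrite ?nnegrE ?powR_ge0 ?(ltW g0) ?(ltW p0)//.
by apply: le_trans hP _; rewrite ler_nat ltnW.
Qed.

End CenterSquares.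

(** * The Lyapunov exponent *)

Section Cocycle.
Context {R : realType}.
Local Notation C := R[i].
Variables (al : R * R) (phi : torus R -> R) (c0 : R).
Hypothesis phic : forall s, `|phi s| <= c0.
Implicit Types (z : C) (x y : R * R).

Lemma transfer_toT z k x : transfer_iter al phi z k (toT x) =
  tprod (fun j => z - (phi (toT (orb al x j)))%:C%C) k.
Proof. by rewrite transfer_iterE; apply: eq_tprod => j; rewrite rot_toT. Qed.

(** The subadditive cocycle whose mean growth rate is the Lyapunov exponent. *)
Definition lognorm z k (s : torus R) : R := ln (opnorm (transfer_iter al phi z k s)).

Definition max_rate : R := ln (2 * c0 + 7).
Definition bounded_energy z := normc z <= c0 + 5.

Lemma c0_ge0 : 0 <= c0. Proof. exact: le_trans (phic (toT (0, 0))). Qed.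

Lemma max_rate_ge0 : 0 <= max_rate.
Proof. by rewrite ln_ge0//; have := c0_ge0; lra. Qed.

Lemma expR_max_rate k : (2 * c0 + 7) ^+ k = expR (k%:R * max_rate).
Proof.
have h := c0_ge0; rewrite expRM_natl lnK// posrE; lra.
Qed.

Lemma opnorm_transfer_ge1 z k s : 1 <= opnorm (transfer_iter al phi z k s).
Proof. by rewrite transfer_iterE; exact: opnorm_tprod_ge1. Qed.

Lemma opnorm_transfer_gt0 z k s : 0 < opnorm (transfer_iter al phi z k s).
Proof. exact: lt_le_trans ltr01 (opnorm_transfer_ge1 z k s). Qed.

Lemma lognorm_ge0 z k s : 0 <= lognorm z k s.
Proof. by rewrite ln_ge0// opnorm_transfer_ge1. Qed.

Lemma expR_lognorm z k s : expR (lognorm z k s) = opnorm (transfer_iter al phi z k s).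
Proof. by rewrite lnK// posrE opnorm_transfer_gt0. Qed.

Lemma opnorm_block z x k : bounded_energy z ->
  opnorm (tprod (fun j => z - (phi (toT (orb al x j)))%:C%C) k) <= expR (k%:R * max_rate).
Proof.
move=> bz; rewrite -expR_max_rate; apply: opnorm_tprod_le; first by have := c0_ge0; lra.
move=> j; have := normcB z (phi (toT (orb al x j)))%:C%C; rewrite normc_real.
by have := phic (toT (orb al x j)); rewrite /bounded_energy in bz; lra.
Qed.

Lemma lognorm_le z k s : bounded_energy z -> lognorm z k s <= k%:R * max_rate.
Proof.
move=> bz; have [x <-] := toT_surj s.
rewrite -ler_expR expR_lognorm transfer_toT; exact: opnorm_block.
Qed.

Lemma lognorm_add z a k x :
  lognorm z (a + k) (toT x) <= lognorm z a (toT x) + lognorm z k (toT (orb al x a)).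
Proof.
have E : transfer_iter al phi z (a + k) (toT x) =
    transfer_iter al phi z k (toT (orb al x a)) *m transfer_iter al phi z a (toT x).
  rewrite (transfer_toT z (a + k) x) tprodD -(transfer_toT z a x).
  congr (_ *m _); rewrite (transfer_toT z k (orb al x a)).
  by apply: eq_tprod => j; rewrite orbD.
rewrite addrC /lognorm E -lnM ?posrE ?opnorm_transfer_gt0//.
rewrite ler_ln ?posrE ?opnormM// -?E ?opnorm_transfer_gt0//.
by rewrite mulr_gt0 ?opnorm_transfer_gt0.
Qed.

Lemma ln_le_add (a b d : R) : 1 <= a -> 1 <= b -> 0 <= d -> a <= b + d ->
  ln a <= ln b + d.
Proof.
move=> a1 b1 d0 h; have b0 : 0 < b by apply: lt_le_trans b1.
have a0 : 0 < a by apply: lt_le_trans a1.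
rewrite -lerBlDl -ln_div ?posrE//.
apply: (@le_trans _ _ ((a - b) / b)).
  have := @le_ln1Dx R ((a - b) / b); rewrite mulrBl mulfV ?lt0r_neq0//.
  rewrite addrCA subrr addr0; apply.
  by rewrite ltrBrDl subrr divr_gt0.
rewrite ler_pdivrMr// lerBlDl (le_trans h)// lerD2l ler_peMr//.
Qed.

Lemma lognorm_perturb z z' k x y (d : R) : bounded_energy z -> bounded_energy z' -> 0 <= d ->
  (forall j, (j < k)%N -> normc ((z - (phi (toT (orb al x j)))%:C%C) -
     (z' - (phi (toT (orb al y j)))%:C%C)) <= d) ->
  lognorm z k (toT x) <= lognorm z' k (toT y) + k%:R * (expR (k%:R * max_rate) * d).
Proof.
move=> bz bz' d0 h.
have := @tprod_perturb R (fun j => z - (phi (toT (orb al x j)))%:C%C)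
  (fun j => z' - (phi (toT (orb al y j)))%:C%C) k 1 d max_rate ler01 d0 max_rate_ge0.
rewrite expr1n !mul1r; set A := tprod _ k; set B := tprod _ k => P.
have {}P : opnorm (A - B) <= k%:R * (expR (k%:R * max_rate) * d).
  apply: P => // [a j|j]; last by rewrite mul1r; exact: opnorm_block.
  rewrite mul1r (eq_tprod (v' := fun i => z - (phi (toT (orb al (orb al x a) i)))%:C%C)).
    exact: opnorm_block.
  by move=> i; rewrite orbD.
have h' : opnorm A <= opnorm B + opnorm (A - B).
  by rewrite -{1}(subrK B A) addrC; exact: opnormD.
rewrite /lognorm !transfer_toT -/A -/B; apply: ln_le_add.
- exact: opnorm_tprod_ge1.
- exact: opnorm_tprod_ge1.
- by rewrite !mulr_ge0 ?expR_ge0 ?ler0n.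
- by apply: le_trans h' _; rewrite lerD2l.
Qed.

Lemma lognorm_energy z z' k x : bounded_energy z -> bounded_energy z' ->
  lognorm z k (toT x) <= lognorm z' k (toT x) + k%:R * (expR (k%:R * max_rate) * normc (z - z')).
Proof.
move=> bz bz'; apply: lognorm_perturb => //; first exact: normc_ge0.
by move=> j _; rewrite opprB addrA subrK.
Qed.

Variables (g C1 : R) (CD : nat).
Hypotheses (g0 : 0 < g) (C10 : 0 <= C1).
Hypothesis geo : forall q : nat, (1 < q)%N ->
    exists2 cs : seq (R * R), (size cs <= CD * q)%N &
    forall x y : R * R, `|x.1 - y.1| <= q%:R^-1 -> `|x.2 - y.2| <= q%:R^-1 ->
      (forall c (m n : int), c \in cs ->
        `|x.1 - c.1 - m%:~R| <= 2 / q%:R -> `|x.2 - c.2 - n%:~R| <= 2 / q%:R ->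
        False) ->
      `|phi (toT x) - phi (toT y)| <= C1 * q%:R `^ (- g).

(** The exceptional squares surround the centers moved back by the first [k]
rotations, by [center_squares]. *)
Lemma small_oscillation k p : (3 <= p)%N ->
  exists2 bs : seq (R * R), (size bs <= 9 * (k * (CD * p)))%N &
  forall M x, 0 <= M -> unit_square x ->
    M <= step [seq (M, b, 5 / p%:R) | b <- bs] x \/
    forall y j, (j < k)%N -> `|x.1 - y.1| <= p%:R^-1 -> `|x.2 - y.2| <= p%:R^-1 ->
      `|phi (toT (orb al x j)) - phi (toT (orb al y j))| <= C1 * p%:R `^ (- g).
Proof.
move=> p3; have p1 : (1 < p)%N by apply: leq_trans p3.
have [cs scs hcs] := geo p1.
have [bs sbs hbs] := center_squares al cs k p3.
exists bs; first by rewrite sbs !leq_mul.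
move=> M x M0 xQ.
have [[j [c [m [n [jk cc e1 e2]]]]]|far] := pselect (exists j c (m n : int),
    [/\ (j < k)%N, c \in cs, `|(orb al x j).1 - c.1 - m%:~R| <= 2 / p%:R &
       `|(orb al x j).2 - c.2 - n%:~R| <= 2 / p%:R]).
  by left; exact: (hbs M x j c m n).
have shift (a b c : R) : a + c - (b + c) = a - b by ring.
right=> y j jk h1 h2; apply: hcs => [||c m n cc e1 e2].
- by rewrite shift.
- by rewrite shift.
- by apply: far; exists j, c, m, n.
Qed.

Lemma area_small k (M e : R) : 0 <= M -> 0 < e -> exists P0, forall p bs,
  (P0 <= p)%N -> (size (bs : seq (R * R)) <= 9 * (k * (CD * p)))%N ->
  step_area [seq (M, b, 5 / p%:R) | b <- bs] <= e.
Proof.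
move=> M0 e0; have [P hP] := natr_above (M * 225 * (k * CD)%:R / e).
exists P.+1 => p bs Pp sb; rewrite step_area_const.
have pR : 0 < p%:R :> R by rewrite ltr0n (leq_trans _ Pp).
have pe : M * 225 * (k * CD)%:R <= e * p%:R.
  rewrite [leRHS]mulrC -ler_pdivrMr//; apply: le_trans hP _.
  by rewrite ler_nat ltnW.
apply: (@le_trans _ _ ((9 * (k * (CD * p)))%:R * (M * (5 / p%:R) ^+ 2))).
  by rewrite ler_wpM2r ?ler_nat// mulr_ge0// exprn_ge0// divr_ge0// ltW.
have -> : (9 * (k * (CD * p)))%:R * (M * (5 / p%:R) ^+ 2) =
    (M * 225 * (k * CD)%:R) / p%:R :> R.
  rewrite mulnA mulnA !natrM; field; exact: lt0r_neq0.
by rewrite ler_pdivrMr.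
Qed.

(** Outside the exceptional squares the [k] values of the potential, and with them
the product of [k] transfer matrices, hardly change at scale [1/p]; on them the
function is bounded by [k * max_rate]. *)
Lemma lognorm_almost_continuous z k : bounded_energy z -> almost_continuous (lognorm z k).
Proof.
move=> bz e e0.
have M0 : 0 <= k%:R * max_rate by rewrite mulr_ge0 ?ler0n ?max_rate_ge0.
have e2 : 0 < e / 2 by rewrite divr_gt0.
have [P1 hP1] := area_small k M0 e2.
pose B := k%:R * (expR (k%:R * max_rate) * C1) + 1.
have B0 : 0 < B by rewrite ltr_wpDl// !mulr_ge0 ?ler0n ?expR_ge0.
have [P2 hP2] := powRN_small g0 (divr_gt0 e2 B0).
exists (maxn (maxn P1 P2) 3) => p.
rewrite !geq_max => /andP[/andP[Pp1 Pp2] p3].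
have [bs sbs hbs] := small_oscillation k p3.
exists ((e / 2, (0, 0), 1) :: [seq (k%:R * max_rate, b, 5 / p%:R) | b <- bs]); split.
- rewrite /= (ltW e2) ler01/=; apply/allP => _ /mapP[b _ ->] /=.
  by rewrite M0/= mulr_ge0// invr_ge0.
- rewrite -cat1s step_area_cat; have := hP1 p bs Pp1 sbs.
  by rewrite step_area_unit; lra.
move=> x y xQ h1 h2; rewrite -cat1s step_cat step_unit//.
have [bad|good] := hbs _ x M0 xQ.
  apply: le_trans (lognorm_le k (toT y) bz) _; apply: le_trans bad _.
  by rewrite addrA lerDr addr_ge0 ?lognorm_ge0// ltW.
set S := step _ x.
have S0 : 0 <= S.
  apply: step_ge0; apply/allP => _ /mapP[b _ ->] /=.
  by rewrite M0/= mulr_ge0// invr_ge0.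
have d0 : 0 <= C1 * p%:R `^ (- g) by rewrite mulr_ge0// powR_ge0.
have h := @lognorm_perturb z z k y x _ bz bz d0.
have {}h : lognorm z k (toT y) <= lognorm z k (toT x) +
    k%:R * (expR (k%:R * max_rate) * (C1 * p%:R `^ (- g))).
  apply: h => j jk; rewrite opprB addrC addrA subrK -rmorphB normc_real.
  exact: good.
have : k%:R * (expR (k%:R * max_rate) * (C1 * p%:R `^ (- g))) <= B * p%:R `^ (- g).
  by rewrite !mulrA ler_wpM2r ?powR_ge0// /B !mulrA lerDl.
have := hP2 p Pp2; rewrite ler_pdivlMr// [_ * B]mulrC => u1 u2.
apply: le_trans h _; rewrite lerD2l (le_trans u2)// (le_trans u1)//.
by rewrite lerDl.
Qed.

Hypothesis dense : dense_orbits al.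

Lemma lognorm0 z s : lognorm z 0 s = 0.
Proof. by rewrite /lognorm /= opnorm1 ln1. Qed.

Lemma lognorm_blocks z k0 l x : \sum_(i < k0) lognorm z (l * k0) (toT (orb al x i)) <=
  \sum_(j < l * k0) lognorm z k0 (toT (orb al x j)).
Proof.
elim: l => [|l IH].
  by rewrite mul0n big_ord0 big1// => i _; rewrite lognorm0.
rewrite mulSnr big_split_ord /=.
apply: le_trans (lerD IH (lexx _)); rewrite -big_split /=; apply: ler_sum => i _.
by rewrite [(l * k0 + i)%N]addnC -orbD; exact: lognorm_add.
Qed.

(** Averaging subadditivity over the [k0] possible phases of the blocks. *)
Lemma lognorm_average z k0 k x : bounded_energy z -> (0 < k0 <= k)%N ->
  exists2 N, (N <= k)%N & k0%:R * lognorm z k (toT x) <=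
    \sum_(j < N) lognorm z k0 (toT (orb al x j)) + k0%:R * (3 * k0%:R * max_rate).
Proof.
move=> bz /andP[k00 k0k].
(* With this number of blocks, for every phase [i < k0], they end before [k] and
   leave out at most [3 * k0] steps. *)
pose l := ((k - k0) %/ k0)%N.
have lk : (l * k0 <= k - k0)%N := leq_trunc_div _ _.
exists (l * k0)%N; first by rewrite (leq_trans lk)// leq_subr.
apply: le_trans (lerD (lognorm_blocks z k0 l x) (lexx _)).
have c (w : R) : k0%:R * w = \sum_(i < k0) w.
  by rewrite sumr_const card_ord mulr_natl.
rewrite !c -big_split /=; apply: ler_sum => i _.
have ik : (i <= k0)%N by apply: ltnW.
pose r := (k - i - l * k0)%N.
have kE : k = (i + (l * k0 + r))%N.
  have h : (i + l * k0 <= k)%N by rewrite -(subnKC k0k) leq_add.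
  by rewrite /r -subnDA addnA subnKC.
have rk : (r <= 2 * k0)%N.
  have h : (k - k0 < l.+1 * k0)%N by rewrite -ltn_divLR.
  rewrite /r; move: h k0k; rewrite mulSn; move: (l * k0)%N (nat_of_ord i) => u v.
  by clear; lia.
have e1 := lognorm_add z i (l * k0 + r) x; rewrite -kE in e1.
have e2 := lognorm_add z (l * k0) r (orb al x i).
have f1 : lognorm z i (toT x) <= k0%:R * max_rate.
  by apply: le_trans (lognorm_le i _ bz) _; rewrite ler_wpM2r ?max_rate_ge0 ?ler_nat.
have f2 : lognorm z r (toT (orb al (orb al x i) (l * k0))) <= 2 * k0%:R * max_rate.
  apply: le_trans (lognorm_le r _ bz) _; rewrite ler_wpM2r ?max_rate_ge0//.
  by rewrite -natrM ler_nat.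
apply: le_trans e1 _; apply: le_trans (lerD f1 (le_trans e2 (lerD (lexx _) f2))) _.
rewrite addrCA lerD2l (_ : _ + _ = 3 * k0%:R * max_rate)//; ring.
Qed.

(** Since [lognorm E k0] is upper Riemann integrable, unique ergodicity bounds its
Birkhoff sums from above uniformly in the initial point. *)
Lemma lognorm_uniform E k0 (e : R) : bounded_energy E -> (0 < k0)%N -> 0 < e ->
  exists D : R, 0 <= D /\ forall z k x, bounded_energy z ->
    lognorm z k (toT x) <= k%:R * ((torus_integral (lognorm E k0) + e) / k0%:R +
      expR (k0%:R * max_rate) * normc (z - E)) + D.
Proof.
move=> bE k00 e0; set I := torus_integral _; set b := expR _.
have I0 : 0 <= I by apply: torus_integral_ge0 => s; exact: lognorm_ge0.
have b0 : 0 <= b by exact: expR_ge0.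
have kR : 0 < k0%:R :> R by rewrite ltr0n.
have FM s : 0 <= lognorm E k0 s <= k0%:R * max_rate by rewrite lognorm_ge0 lognorm_le.
have [D [D0 hD]] := ergodic_upper dense FM (lognorm_almost_continuous k0 bE) e0.
have q0 : 0 <= k0%:R * (3 * k0%:R * max_rate) by rewrite !mulr_ge0 ?ler0n ?max_rate_ge0.
have r0 : 0 <= k0%:R * max_rate by rewrite mulr_ge0 ?ler0n ?max_rate_ge0.
exists (D + 3 * k0%:R * max_rate + k0%:R * max_rate); split.
  by rewrite !addr_ge0// mulr_ge0 ?max_rate_ge0// mulr_ge0 ?ler0n.
move=> z k x bz; have d0 := normc_ge0 (z - E).
have [kk0|k0k] := ltnP k k0.
  apply: le_trans (lognorm_le k _ bz) _.
  apply: (@le_trans _ _ (k0%:R * max_rate)).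
    by rewrite ler_wpM2r ?max_rate_ge0// ler_nat ltnW.
  rewrite addrA lerDr addr_ge0//; first last.
    by rewrite addr_ge0// mulr_ge0 ?max_rate_ge0// mulr_ge0 ?ler0n.
  rewrite mulr_ge0 ?ler0n// addr_ge0 ?(mulr_ge0 b0)// divr_ge0 ?ler0n//.
  by rewrite addr_ge0// ltW.
have [N Nk h] := lognorm_average x bz (introT andP (conj k00 k0k)).
have h2 : \sum_(j < N) lognorm z k0 (toT (orb al x j)) <=
    k%:R * (I + e + k0%:R * (b * normc (z - E))) + D.
  apply: (@le_trans _ _ (\sum_(j < N) (lognorm E k0 (toT (orb al x j)) +
      k0%:R * (b * normc (z - E))))).
    by apply: ler_sum => j _; exact: lognorm_energy.
  rewrite big_split /= sumr_const card_ord -(mulr_natl _ N).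
  apply: le_trans (lerD (hD N x) (lexx _)) _.
  rewrite -/I addrAC -mulrDr lerD2r ler_wpM2r ?ler_nat//.
  by rewrite addr_ge0 ?mulr_ge0 ?ler0n// addr_ge0// ltW.
have {}h := le_trans h (lerD h2 (lexx _)).
have E1 : k%:R * ((I + e) / k0%:R + b * normc (z - E)) =
    k%:R * (I + e + k0%:R * (b * normc (z - E))) / k0%:R.
  by field; exact: lt0r_neq0.
rewrite E1; move: (3 * k0%:R * max_rate) h => w h; apply: (@le_trans _ _ ((k%:R * (I + e + k0%:R * (b * normc (z - E))) + D +
   k0%:R * w) / k0%:R)).
  by rewrite ler_pdivlMr// mulrC.
rewrite !mulrDl -!addrA lerD2l.
have D1 : D / k0%:R <= D by rewrite ler_pdivrMr// ler_peMr// ler1n.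
have E2 : k0%:R * w / k0%:R = w by rewrite mulrAC mulfV ?mul1r// lt0r_neq0.
by rewrite E2; apply: lerD => //; rewrite lerDl.
Qed.

Lemma torus_integral_const (G : torus R -> R) c : (forall s, 0 <= G s) ->
  0 <= c -> (forall x, unit_square x -> G (toT x) <= c) -> torus_integral G <= c.
Proof.
move=> G0 c0' Gc; rewrite -(step_area_unit c); apply: torus_integral_le => //.
  by rewrite /= c0' ler01.
by move=> x xQ; rewrite step_unit// Gc.
Qed.

(** By subadditivity the means over [k] steps converge to their infimum. *)
Lemma lyapunov_inf E : bounded_energy E ->
  (forall k, (0 < k)%N ->
    k%:R * lyapunov al phi E <= torus_integral (lognorm E k)) /\
  (forall e : R, 0 < e -> exists2 k, (0 < k)%N &
    torus_integral (lognorm E k) <= k%:R * (lyapunov al phi E + e)).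
Proof.
move=> bE; pose u (k : nat) : R := k%:R^-1 * torus_integral (lognorm E k).
have I0 k : 0 <= torus_integral (lognorm E k).
  by apply: torus_integral_ge0 => s; exact: lognorm_ge0.
pose A : set R := [set u k | k in [set k | (0 < k)%N]].
have hA : has_inf A.
  split; first by exists (u 1%N), 1%N.
  by exists 0 => _ [k _ <-]; rewrite mulr_ge0 ?invr_ge0 ?ler0n.
have key k0 (e : R) : (0 < k0)%N -> 0 < e -> exists D : R, forall k, (0 < k)%N ->
    u k <= u k0 + e + D / k%:R.
  move=> k00 e0; have [D [D0 hD]] := lognorm_uniform bE k00 e0; exists D => k k0'.
  have kR : 0 < k%:R :> R by rewrite ltr0n.
  have k0R : 1 <= k0%:R :> R by rewrite ler1n.
  have k0P : 0 < k0%:R :> R by rewrite ltr0n.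
  have w0 : 0 <= (torus_integral (lognorm E k0) + e) / k0%:R.
    by rewrite divr_ge0 ?ler0n// addr_ge0// ltW.
  have : torus_integral (lognorm E k) <=
      k%:R * ((torus_integral (lognorm E k0) + e) / k0%:R) + D.
    apply: torus_integral_const.
    - by move=> s; exact: lognorm_ge0.
    - by rewrite addr_ge0// mulr_ge0 ?ler0n.
    - move=> x _; have := hD E k x bE.
      by rewrite subrr normc0 mulr0 addr0.
  move=> h; rewrite /u mulrC ler_pdivrMr// mulrDl divfK ?lt0r_neq0//.
  apply: le_trans h _; rewrite lerD2r mulrC ler_wpM2r ?(ltW kR)//.
  rewrite mulrDl [X in X + _]mulrC lerD2l ler_pdivrMr//.
  by rewrite ler_peMr// ltW.
have lim : u @ \oo --> inf A.
  apply/cvgrPdist_le => e e0.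
  have e3 : 0 < e / 3 by rewrite divr_gt0.
  have [_ [k0 k00 <-] hk0] := inf_adherent e3 hA.
  have [D hD] := key k0 _ k00 e3.
  have [K hK] := natr_above (`|D| / (e / 3)).
  near=> k; have kK : (K < k)%N by near: k; exact: nbhs_infty_gt.
  have k1 : (0 < k)%N by apply: leq_ltn_trans kK.
  have kR : 0 < k%:R :> R by rewrite ltr0n.
  have lo : inf A <= u k by apply: inf_lbound; [case: hA|exists k].
  have hi := hD k k1.
  have Dk : D / k%:R <= e / 3.
    rewrite ler_pdivrMr// mulrC -ler_pdivrMr//.
    apply: le_trans (ltW (_ : K%:R < k%:R)); last by rewrite ltr_nat.
    apply: le_trans hK; rewrite ler_wpM2r ?invr_ge0 ?(ltW e3)//.
    exact: ler_norm.
  rewrite distrC ger0_norm ?subr_ge0// lerBlDl (le_trans hi)//.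
  apply: le_trans (lerD (lerD (ltW hk0) (lexx _)) Dk) _.
  by rewrite -!addrA lerD2l (_ : _ + (_ + _) = e)//; field.
have L : lyapunov al phi E = inf A by apply: cvg_lim.
rewrite L; split => [k k0|e e0].
  have kR : 0 < k%:R :> R by rewrite ltr0n.
  rewrite mulrC -ler_pdivlMr// mulrC; apply: inf_lbound; first by case: hA.
  by exists k.
have [_ [k k0 <-] hk] := inf_adherent e0 hA; exists k => //.
have kR : 0 < k%:R :> R by rewrite ltr0n.
by rewrite [leRHS]mulrC -ler_pdivrMr// mulrC ltW.
Unshelve. all: by end_near.
Qed.

Lemma lyapunov_ge0 E : bounded_energy E -> 0 <= lyapunov al phi E.
Proof.
move=> bE; apply/ler_addgt0Pr => e e0.
have [_ /(_ e e0)[k k0 h]] := lyapunov_inf bE.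
have kR : 0 < k%:R :> R by rewrite ltr0n.
rewrite -(pmulr_rge0 _ kR); apply: le_trans h.
by apply: torus_integral_ge0 => s; exact: lognorm_ge0.
Qed.

Hypothesis lcont : continuous (fun E : R => lyapunov al phi E%:C%C).

Lemma bounded_near (E : R) z : `|complex.Re z - E| <= 1 -> `|E| <= c0 + 3 ->
  0 <= complex.Im z <= 1 -> bounded_energy z.
Proof.
move=> h1 h2 /andP[i0 i1]; rewrite /bounded_energy (le_trans (normc_leD _))//.
rewrite (ger0_norm i0); have := ler_normD (complex.Re z - E) E; rewrite subrK.
by move=> h; lra.
Qed.

(** A block length at which the mean at [E0] is nearly optimal also serves for the
energies nearby, real or complex: the block is Lipschitz in the energy, and the
Lyapunov exponent is continuous. *)
Lemma lognorm_near (e E0 : R) : 0 < e -> `|E0| <= c0 + 3 ->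
  exists r T : R, [/\ 0 < r, 1 <= T & forall z, `|complex.Re z - E0| <= r ->
   0 <= complex.Im z <= T^-1 -> forall k x,
   lognorm z k (toT x) <= k%:R * (lyapunov al phi (complex.Re z)%:C%C + e) + T].
Proof.
move=> e0 E0b; pose L (E : R) := lyapunov al phi E%:C%C.
have cL : continuous L := lcont.
have e4 : 0 < e / 4 by rewrite divr_gt0.
have bE : bounded_energy E0%:C%C.
  by apply: (bounded_near (E := E0)) => //=; rewrite ?subrr ?normr0 ?lexx ?ler01.
have [k0 k00 hk0] := (lyapunov_inf bE).2 _ e4.
have [D [D0 hD]] := lognorm_uniform bE k00 e4.
set b := expR (k0%:R * max_rate) in hD.
have b0 : 0 < b by exact: expR_gt0.
have k0R : 1 <= k0%:R :> R by rewrite ler1n.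
have k0P : 0 < k0%:R :> R by rewrite ltr0n.
have /cvgrPdist_le/(_ _ e4)/nbhs_ballP[r1 /= r10 hr1] := cL E0.
pose r := Num.min (r1 / 2) (Num.min 1 (e / 4 / (2 * b))).
pose T := D + 1 + (e / 4 / (2 * b))^-1.
have eb : 0 < e / 4 / (2 * b) by rewrite divr_gt0// mulr_gt0.
have r0 : 0 < r by rewrite /r !lt_min divr_gt0// ltr01 eb.
have eb' : 0 < (e / 4 / (2 * b))^-1 by rewrite invr_gt0.
have T1 : 1 <= T by rewrite /T addrAC lerDr addr_ge0// ltW.
have T0 : 0 < T by apply: lt_le_trans T1.
exists r, T; split => // z hz /andP[i0 i1] k x.
have rr1 : r <= r1 / 2 by rewrite /r ge_min lexx.
have rr2 : r <= 1 by rewrite /r !ge_min lexx orbT.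
have rr3 : r <= e / 4 / (2 * b) by rewrite /r !ge_min lexx !orbT.
have i1' : complex.Im z <= 1.
  by apply: le_trans i1 _; rewrite invf_le1.
have bz : bounded_energy z.
  by apply: bounded_near E0b _; [exact: le_trans rr2|rewrite i0].
have Lz : L E0 <= L (complex.Re z) + e / 4.
  have : `|L E0 - L (complex.Re z)| <= e / 4.
    apply: hr1; rewrite /ball /= distrC (le_lt_trans hz)// (le_lt_trans rr1)//.
    by rewrite ltr_pdivrMr// ltr_pMr// ltr1n.
  by rewrite ler_distl => /andP[_]; rewrite addrC.
have nz : b * normc (z - E0%:C%C) <= e / 4.
  have h1 : normc (z - E0%:C%C) <= `|complex.Re z - E0| + `|complex.Im z|.
    by apply: le_trans (normc_leD _) _; case: (z) => u v /=; rewrite oppr0 addr0.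
  have h2 : `|complex.Im z| <= e / 4 / (2 * b).
    rewrite ger0_norm// (le_trans i1)// -[leRHS]invrK lef_pV2 ?posrE//.
    by rewrite /T lerDr addr_ge0.
  rewrite mulrC -ler_pdivlMr//; apply: le_trans h1 _.
  apply: le_trans (lerD (le_trans hz rr3) h2) _.
  by rewrite (_ : _ + _ = e / 4 / b)//; field; exact: lt0r_neq0.
apply: le_trans (hD z k x bz) _; apply: lerD; last first.
  by rewrite /T -addrA lerDl addr_ge0// ltW.
rewrite ler_wpM2l ?ler0n//.
apply: le_trans (lerD (lexx _) nz) _.
have h3 : (torus_integral (lognorm E0%:C%C k0) + e / 4) / k0%:R <= L E0 + e / 4 + e / 4.
  rewrite ler_pdivrMr// mulrDl lerD//; first by rewrite mulrC.
  by rewrite ler_peMr// ltW.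
apply: le_trans (lerD h3 (lexx _)) _.
apply: le_trans (lerD (lerD (lerD Lz (lexx _)) (lexx _)) (lexx _)) _.
by rewrite -!addrA lerD2l (_ : _ + (_ + (_ + _)) = e)//; field.
Qed.

(** Compactness of the energy window makes the previous bound uniform. *)
Lemma lognorm_unif (e : R) : 0 < e -> exists2 T : R, 1 <= T & forall z,
  `|complex.Re z| <= c0 + 3 -> 0 <= complex.Im z <= T^-1 -> forall k x,
   lognorm z k (toT x) <= k%:R * (lyapunov al phi (complex.Re z)%:C%C + e) + T.
Proof.
move=> e0.
(* The constant [T], which tends to infinity, bounds both the additive error and
   the inverse of the height of the energies. *)
pose P (T E : R) := forall z, complex.Re z = E -> 0 <= complex.Im z <= T^-1 ->
  forall k x, lognorm z k (toT x) <= k%:R * (lyapunov al phi (complex.Re z)%:C%C + e) + T.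
have := @segment_compact R (- (c0 + 3)) (c0 + 3).
move/compact_near_coveringP => /(_ _ +oo_R P _) [|T0 [_ hT0]].
- move=> E0; rewrite /= in_itv /= => hE0.
  have E0b : `|E0| <= c0 + 3 by rewrite ler_norml.
  have [r [T [r0 T1 h]]] := lognorm_near e0 E0b.
  exists (ball E0 r, [set T' | T <= T']) => /=.
    split; first exact: nbhsx_ballx.
    by exists T; split; [exact: num_real|move=> T' /= /ltW].
  move=> [E T'] [/= hE TT'] z zE /andP[i0 i1] k x.
  have T0 : 0 < T by apply: lt_le_trans T1.
  have T'0 : 0 < T' by apply: lt_le_trans TT'.
  apply: le_trans (h z _ _ k x) _.
  + by rewrite zE distrC ltW.
  + by rewrite i0 (le_trans i1)// lef_pV2.
  + by rewrite lerD2l.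
exists (Num.max 1 T0 + 1); first by rewrite ler_wpDr// le_max lexx.
move=> z hz hi k x; apply: (hT0 _ _ (complex.Re z)) => //.
  by rewrite ltr_pwDr// le_max lexx orbT.
by rewrite /= in_itv /= -ler_norml.
Qed.

Hypothesis lpos : forall E : R, 0 < lyapunov al phi E%:C%C.

Lemma lyapunov_lower : exists2 l : R, 0 < l & forall E : R, `|E| <= c0 + 3 ->
  l <= lyapunov al phi E%:C%C.
Proof.
have c3 : - (c0 + 3) <= c0 + 3 by rewrite ge0_cp// addr_ge0// c0_ge0.
have [E1 _ h] := EVT_min c3 (continuous_subspaceT lcont).
exists (lyapunov al phi E1%:C%C); first exact: lpos.
by move=> E hE; apply: h; rewrite in_itv /= -ler_norml.
Qed.

Hypothesis g1 : g <= 1.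

(** The mean of [lognorm] over the torus is at least [k] times the Lyapunov exponent,
and the exceptional squares are too small to account for it. *)
Lemma good_point (E e : R) k p : bounded_energy E%:C%C -> (0 < k)%N -> (3 <= p)%N ->
  0 < e <= lyapunov al phi E%:C%C -> 225 * k%:R * CD%:R * max_rate < e * p%:R ->
  exists x : R * R, k%:R * (lyapunov al phi E%:C%C - e) <= lognorm E%:C%C k (toT x) /\
    forall y j, (j < k)%N -> `|x.1 - y.1| <= p%:R^-1 -> `|x.2 - y.2| <= p%:R^-1 ->
      `|phi (toT (orb al x j)) - phi (toT (orb al y j))| <= C1 * p%:R `^ (- g).
Proof.
move=> bE k0 p3 /andP[e0 eL] small; set l := lyapunov _ _ _ in eL *.
have kR : 0 < k%:R :> R by rewrite ltr0n.
have pR : 0 < p%:R :> R by rewrite ltr0n (leq_trans _ p3).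
have M0 : 0 <= k%:R * max_rate by rewrite mulr_ge0 ?ler0n ?max_rate_ge0.
have L0 : 0 <= k%:R * (l - e) by rewrite mulr_ge0 ?ler0n// subr_ge0.
have [bs sbs hbs] := small_oscillation k p3.
apply: contrapT => no.
pose s2 : seq wsquare := [seq (k%:R * max_rate, b, 5 / p%:R) | b <- bs].
have s20 : nonneg_weights s2.
  by apply/allP => _ /mapP[b _ ->] /=; rewrite M0/= mulr_ge0// invr_ge0 ltW.
have : torus_integral (lognorm E%:C%C k) <= step_area ((k%:R * (l - e), (0, 0), 1) :: s2).
  apply: torus_integral_le.
  - by move=> s; exact: lognorm_ge0.
  - by rewrite /nonneg_weights /= L0 ler01.
  move=> x xQ; rewrite -cat1s step_cat step_unit//.
  have [bad|good] := hbs _ x M0 xQ.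
    by apply: le_trans (lognorm_le k (toT x) bE) _; apply: le_trans bad _; rewrite lerDr.
  have [h|h] := leP (k%:R * (l - e)) (lognorm E%:C%C k (toT x)).
    by exfalso; apply: no; exists x.
  by apply: le_trans (ltW h) _; rewrite lerDl step_ge0.
rewrite -cat1s step_area_cat step_area_unit step_area_const => h.
have := le_trans ((lyapunov_inf bE).1 k k0) h; rewrite -/l mulrBr -addrA lerDl.
rewrite addrC subr_ge0 leNgt => /negP; apply.
apply: (@le_lt_trans _ _ ((9 * (k * (CD * p)))%:R * (k%:R * max_rate * (5 / p%:R) ^+ 2))).
  by rewrite ler_wpM2r ?ler_nat// mulr_ge0// exprn_ge0// divr_ge0// ltW.
have -> : (9 * (k * (CD * p)))%:R * (k%:R * max_rate * (5 / p%:R) ^+ 2) =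
    k%:R * (225 * k%:R * CD%:R * max_rate / p%:R) :> R.
  by rewrite !natrM; field; exact: lt0r_neq0.
by rewrite ltr_pM2l// ltr_pdivrMr.
Qed.

(** At the good point, for the real energy [E], the norm of the block is at least
[expR (k * (L(E) - e))]. By the upper bound on shorter blocks, a displacement by
[1/q] and a change of the energy by [q ^ -g] alter the block by at most
[expR (k * (L(E) + e)) * q ^ -g], up to a factor absorbed by [expR (k * e)]; this
is less than half of its norm since [expR (3 * k * e)] is at most [q ^ g]. *)
Lemma block_growth (e T l : R) q N k : 0 < e <= l -> 1 <= T ->
  (forall z, `|complex.Re z| <= c0 + 3 -> 0 <= complex.Im z <= T^-1 -> forall k x,
   lognorm z k (toT x) <= k%:R * (lyapunov al phi (complex.Re z)%:C%C + e) + T) ->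
  (forall E : R, `|E| <= c0 + 3 -> l <= lyapunov al phi E%:C%C) ->
  (forall x y : R * R, exists n : nat, exists m1 m2 : int,
      [/\ (n <= N)%N, `|x.1 + n%:R * al.1 - y.1 - m1%:~R| <= q%:R^-1 &
          `|x.2 + n%:R * al.2 - y.2 - m2%:~R| <= q%:R^-1]) ->
  (0 < k)%N -> (3 <= q)%N -> 225 * k%:R * CD%:R * max_rate < e * q%:R ->
  2 * expR T ^+ 2 * (C1 + 1) * k%:R <= expR (k%:R * e) ->
  expR (3 * (k%:R * e)) <= q%:R `^ g -> q%:R `^ (- g) <= T^-1 ->
  forall x z, `|complex.Re z| <= c0 + 3 -> 0 <= complex.Im z <= q%:R `^ (- g) ->
  exists2 n, (n <= N)%N &
    expR (k%:R * (l - e)) / 2 <= opnorm (transfer_iter al phi z k (toT (orb al x n))).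
Proof.
move=> /andP[e0 el] T1 hT hl hit k0 q3 c1 c2 c3 qT x z Rz /andP[i0 i1].
have T0 : 0 < T by apply: lt_le_trans T1.
have qR : 0 < q%:R :> R by rewrite ltr0n (leq_trans _ q3).
set E := complex.Re z in Rz.
have bE : bounded_energy E%:C%C.
  by apply: (bounded_near (E := E)) => //=; rewrite ?subrr ?normr0 ?lexx ?ler01.
have eL : 0 < e <= lyapunov al phi E%:C%C by rewrite e0 (le_trans el)// hl.
have [y [yF yg]] := good_point bE k0 q3 eL c1.
have [n [m1 [m2 [nN h1 h2]]]] := hit x y; exists n => //.
set x' : R * R := ((orb al x n).1 - m1%:~R, (orb al x n).2 - m2%:~R).
have tx : toT x' = toT (orb al x n).
  rewrite -(toT_int x' m1 m2) /x'; congr toT.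
  by rewrite [RHS]surjective_pairing; congr (_, _); rewrite /= subrK.
have yx1 : `|y.1 - x'.1| <= q%:R^-1.
  by rewrite distrC /x' /= addrAC.
have yx2 : `|y.2 - x'.2| <= q%:R^-1.
  by rewrite distrC /x' /= addrAC.
rewrite -tx !transfer_toT; set lam := lyapunov al phi E%:C%C + e.
pose v (j : nat) := E%:C%C - (phi (toT (orb al y j)))%:C%C.
pose v' (j : nat) := z - (phi (toT (orb al x' j)))%:C%C.
have blk z' w a j : `|complex.Re z'| <= c0 + 3 -> 0 <= complex.Im z' <= T^-1 ->
    opnorm (tprod (fun i => z' - (phi (toT (orb al w (a + i))))%:C%C) j) <=
    expR T * expR (j%:R * (lyapunov al phi (complex.Re z')%:C%C + e)).
  move=> r i; rewrite -expRD addrC.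
  rewrite (eq_tprod (v' := fun i => z' - (phi (toT (orb al (orb al w a) i)))%:C%C)).
    by rewrite -transfer_toT -expR_lognorm ler_expR; exact: hT.
  by move=> i'; rewrite orbD.
have iT : 0 <= complex.Im z <= T^-1 by rewrite i0 (le_trans i1).
have hE : 0 <= complex.Im E%:C%C <= T^-1 by rewrite /= lexx invr_ge0 ltW.
have lam0 : 0 <= lam by rewrite addr_ge0 ?(ltW e0)// lyapunov_ge0.
have d0 : 0 <= (C1 + 1) * q%:R `^ (- g) by rewrite mulr_ge0 ?powR_ge0// addr_ge0.
have := @tprod_perturb R v v' k (expR T) _ lam (expR_ge0 T) d0 lam0.
have hv a j : opnorm (tprod (fun i => v (a + i)%N) j) <= expR T * expR (j%:R * lam).
  exact: blk.
have hv' j : opnorm (tprod v' j) <= expR T * expR (j%:R * lam).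
  exact: (blk z x' 0%N j).
have hd j : (j < k)%N -> normc (v j - v' j) <= (C1 + 1) * q%:R `^ (- g).
  move=> jk; have -> : v j - v' j = (E%:C%C - z) +
     (phi (toT (orb al x' j)) - phi (toT (orb al y j)))%:C%C.
    rewrite /v /v' rmorphB /= opprB [X in _ + X = _]addrC addrACA.
    by congr (_ + _); exact: addrC.
  apply: le_trans (normcD _ _) _; rewrite normc_real mulrDl mul1r addrC distrC.
  apply: lerD; first exact: yg.
  apply: le_trans i1; rewrite /E; case: (z) i0 => a b /= b0.
  by rewrite subrr expr0n add0r sub0r sqrrN sqrtr_sqr ger0_norm.
move=> /(_ hv hv' hd); set A := tprod v k; set A' := tprod v' k => P.
have AF : expR (k%:R * (lyapunov al phi E%:C%C - e)) <= opnorm A.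
  by rewrite /A /v -transfer_toT -expR_lognorm ler_expR.
have AD : opnorm A <= opnorm A' + opnorm (A - A').
  by rewrite -{1}(subrK A' A) addrC; exact: opnormD.
pose L := lyapunov al phi E%:C%C; rewrite -/L in AF.
have half : k%:R * (expR T ^+ 2 * expR (k%:R * lam) * ((C1 + 1) * q%:R `^ (- g)))
    <= expR (k%:R * (L - e)) / 2.
  have q3e : q%:R `^ (- g) <= expR (- (3 * (k%:R * e))).
    by rewrite powRN expRN lef_pV2 ?posrE ?powR_gt0 ?expR_gt0.
  have E1 : expR (k%:R * (L - e)) =
      expR (k%:R * lam) * expR (- (3 * (k%:R * e))) * expR (k%:R * e).
    by rewrite -!expRD; congr expR; rewrite /lam -/L; ring.
  rewrite ler_pdivlMr// E1.
  set a := expR (k%:R * lam); set b := expR (- _) in q3e *.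
  have a0 : 0 <= a by exact: expR_ge0.
  have b0 : 0 <= b by exact: expR_ge0.
  have -> : k%:R * (expR T ^+ 2 * a * ((C1 + 1) * q%:R `^ (- g))) * 2 =
     a * q%:R `^ (- g) * (2 * expR T ^+ 2 * (C1 + 1) * k%:R) by ring.
  apply: ler_pM => //.
  - by rewrite mulr_ge0// powR_ge0.
  - by rewrite !mulr_ge0 ?exprn_ge0 ?expR_ge0 ?ler0n// addr_ge0.
  - by rewrite ler_wpM2l.
have lE : expR (k%:R * (l - e)) <= expR (k%:R * (L - e)).
  by rewrite ler_expR ler_wpM2l ?ler0n// lerD2r hl.
have := le_trans AF (le_trans AD (lerD (lexx _) (le_trans P half))).
rewrite -lerBlDr -[X in X - _]mulr1 -mulrBr => u.
apply: le_trans u; rewrite (_ : 1 - 2^-1 = 2^-1); last by field.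
by rewrite ler_wpM2r// invr_ge0.
Qed.

(** * Growth at polynomial distance *)

Variable e0 : nat.
Hypothesis hits : forall Q0 : nat, exists q : nat,
    [/\ (Q0 <= q)%N, (0 < q)%N & forall x y : R * R,
      exists n : nat, exists m1 m2 : int,
      [/\ (n <= q ^ e0)%N,
          `|x.1 + n%:R * al.1 - y.1 - m1%:~R| <= q%:R^-1 &
          `|x.2 + n%:R * al.2 - y.2 - m2%:~R| <= q%:R^-1]].

(** The tolerance [e] is a fixed small multiple of the minimal Lyapunov exponent [l];
with [k] from [scale_choice] all the conditions of [block_growth] hold once [q]
is large. *)
Lemma cocycle_growth (A Q0 : nat) : exists q k : nat, [/\ (Q0 <= q)%N, (k <= q)%N &
  forall x z, `|complex.Re z| <= c0 + 3 -> 0 <= complex.Im z <= q%:R `^ (- g) ->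
  exists2 n, (n <= q ^ e0)%N &
    q%:R ^+ A <= opnorm (transfer_iter al phi z k (toT (orb al x n)))].
Proof.
have [l l0 hl] := lyapunov_lower.
pose e : R := g * l / (6 * A.+1%:R).
have A1 : 1 <= A.+1%:R :> R by rewrite ler1n.
have e00 : 0 < e by rewrite /e divr_gt0 ?mulr_gt0 ?(lt_le_trans ltr01 A1).
have el : e <= l.
  rewrite /e ler_pdivrMr ?mulr_gt0 ?(lt_le_trans ltr01 A1)//.
  rewrite mulrC ler_wpM2l ?(ltW l0)// (le_trans g1)//.
  by rewrite (le_trans A1)// ler_peMl ?(le_trans ler01)// ler1n.
have [T T1 hT] := lognorm_unif e00.
have Cs0 : 0 <= 225 * CD%:R * max_rate by rewrite !mulr_ge0 ?ler0n ?max_rate_ge0.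
have W0 : 0 <= 2 * expR T ^+ 2 * (C1 + 1).
  by rewrite !mulr_ge0 ?exprn_ge0 ?expR_ge0// addr_ge0.
have gg : 0 < g <= 1 by rewrite g0.
have [Q1 hQ1] := @scale_choice R g l _ _ T A gg l0 Cs0 W0 T1 e (erefl e).
have [q [Qq q0 hq]] := hits (maxn (maxn Q0 Q1) 3).
move: Qq; rewrite !geq_max => /andP[/andP[qQ0 qQ1] q3].
have [k [/andP[k0 kq] h1 h2 h3 [h4 h5]]] := hQ1 q qQ1.
exists q, k; split => // x z Rz Iz.
have h1' : 225 * k%:R * CD%:R * max_rate < e * q%:R.
  by rewrite (_ : 225 * _ * _ * _ = 225 * CD%:R * max_rate * k%:R)//; ring.
have ee : 0 < e <= l by rewrite e00.
have [n nN hn] := block_growth ee T1 hT hl hq k0 q3 h1' h2 h3 h4 x Rz Iz.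
by exists n => //; apply: le_trans hn.
Qed.

End Cocycle.

Section Assembly.
Context {R : realType}.
Local Notation C := R[i].

Lemma opnorm_growth (v : nat -> C) a k N (X : R) : 1 <= X -> (a + k < N)%N ->
  8 * X ^+ 2 < opnorm (tprod (fun j => v (a + j)%N) k) -> growth v N X.
Proof.
move=> X1 aN h; apply: growth_block X1 aN _.
exact: lt_le_trans h (opnorm_sumnorm _).
Qed.

Lemma poly_le_pow2 (P : nat) :
  exists Q : nat, forall q, (Q <= q)%N -> (1 + q%:R) ^+ P <= 2 ^+ q :> R.
Proof.
have [c cc h] := @poly_le_exp R P.+1 2 (ltr1n _ 2).
have [Q hQ] := natr_above c; exists Q => q Qq.
have q0 : 0 < 1 + q%:R :> R by rewrite ltr_wpDr ?ler0n.
rewrite -(ler_pM2l q0) -exprS; apply: le_trans (h q) _.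
rewrite ler_wpM2r ?exprn_ge0// (le_trans hQ)// (@le_trans _ _ q%:R) ?ler_nat//.
by rewrite lerDr.
Qed.

Variables (al : R * R) (phi : torus R -> R) (c0 : R).
Hypothesis phic : forall s, `|phi s| <= c0.
Variable t : R * R.
Let V (n : int) : R := phi (rotz al n (toT t)).

Lemma right_growth z n k N (X : R) : 1 <= X -> (n + k < N)%N ->
  8 * X ^+ 2 < opnorm (transfer_iter al phi z k (toT (orb al (orb al t 1) n))) ->
  growth (fun j => z - (V j.+1%:Z)%:C%C) N X.
Proof.
move=> X1 nN h; apply: opnorm_growth X1 nN _.
rewrite (eq_tprod (v' := fun j => z - (phi (toT (orb al (orb al (orb al t 1) n) j)))%:C%C)).
  by rewrite -transfer_toT.
move=> j; rewrite /V rotz_toT !orbD.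
by rewrite -pmulrn add1n.
Qed.

(** Read from right to left, a block that lies to the left of the origin is a
block of the reflected half line. *)
Lemma left_growth z n k N M (X : R) : 1 <= X -> (n <= M)%N -> (M + k.+1 < N)%N ->
  let x := (t.1 - (M + k.+1)%:R * al.1, t.2 - (M + k.+1)%:R * al.2) in
  8 * X ^+ 2 < opnorm (transfer_iter al phi z k (toT (orb al x n))) ->
  growth (fun j => z - (V (- j.+1%:Z))%:C%C) N X.
Proof.
move=> X1 nM MN x h.
apply: (@growth_block _ _ (M - n).+1 k) X1 _ _.
  by apply: leq_ltn_trans MN; rewrite addSnnS leq_add2r leq_subr.
apply: lt_le_trans h _; apply: le_trans (opnorm_sumnorm _) _.
rewrite transfer_toT -sumnorm_rev.
rewrite (@eq_tprod_lt _ _ (fun j => z - (V (- ((M - n).+1 + j).+1%:Z))%:C%C))//.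
move=> j jk; rewrite /V rotz_toT !orbD /x /orb /=.
have E : (n + (k - j.+1))%:R = (M + k.+1)%:R - ((M - n).+1 + j).+1%:R :> R.
  rewrite -natrB; last by rewrite addSnnS -addnS leq_add ?leq_subr.
  by congr (_%:R); move: jk nM; clear; lia.
by rewrite mulrNz -pmulrn E; congr (z - (phi (toT (_, _)))%:C%C); ring.
Qed.


(** Three regimes of energies: high above the real axis, far from the spectrum,
and close to the real axis in a compact window. *)
Lemma scale_growth (e0 : nat) (g : R) : 0 < g <= 1 ->
  (forall A Q0 : nat, exists q k : nat, [/\ (Q0 <= q)%N, (k <= q)%N &
    forall x z, `|complex.Re z| <= c0 + 3 -> 0 <= complex.Im z <= q%:R `^ (- g) ->
    exists2 n, (n <= q ^ e0)%N &
      q%:R ^+ A <= opnorm (transfer_iter al phi z k (toT (orb al x n)))]) ->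
  forall A B Q0 : nat, exists2 q : nat, (Q0 <= q)%N & forall z,
    (q%:R ^+ B)^-1 <= complex.Im z ->
    growth (fun k => z - (V k.+1%:Z)%:C%C) (q ^ (e0 + 3)) (q%:R ^+ A) /\
    growth (fun k => z - (V (- k.+1%:Z))%:C%C) (q ^ (e0 + 3)) (q%:R ^+ A).
Proof.
move=> /andP[g0 g1] cg A B Q0.
have [Q2 hQ2] := poly_le_pow2 (2 * A + 3).
(* By [growth_block] a solution is as large as the square root of the block. *)
have [q [k [Qq kq hq]]] := cg (2 * A + 2)%N (maxn (maxn Q0 Q2) 3).
move: Qq; rewrite !geq_max => /andP[/andP[qQ0 qQ2] q3].
have q0 : (0 < q)%N by apply: leq_trans q3.
have qR : 0 < q%:R :> R by rewrite ltr0n.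
have q1 : 1 <= q%:R :> R by rewrite ler1n.
have qA1 : 1 <= q%:R ^+ A :> R by rewrite exprn_ege1.
have pw := hQ2 q qQ2.
have Nlarge m : (m <= 2 * q ^ 2 + 1)%N -> (m <= q ^ (e0 + 3))%N.
  move=> h; apply: leq_trans h _; rewrite expnD.
  apply: (@leq_trans (q ^ 3)); last by rewrite leq_pmull// expn_gt0 q0.
  have : (3 * q ^ 2 <= q ^ 3)%N by rewrite [(q ^ 3)%N]expnS leq_mul2r q3 orbT.
  have : (0 < q ^ 2)%N by rewrite expn_gt0 q0.
  by move: (q ^ 2)%N (q ^ 3)%N; clear; lia.
have easy (W : nat -> R) z : (forall j, `|W j| <= c0) ->
    q%:R^-1 <= complex.Im z \/ c0 + 3 <= normc z ->
    growth (fun k => z - (W k)%:C%C) (q ^ (e0 + 3)) (q%:R ^+ A).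
  move=> Wc [hz|hz].
    apply: (@growth_le _ _ (2 * (q * q)).+1 _ (q%:R ^+ A)) => //.
      by apply: Nlarge; rewrite mulnn addn1.
    apply: (@upper_growth _ _ _ q%:R^-1); rewrite ?invr_ge0 ?ler0n//.
    rewrite exprM; apply: (@le_trans _ _ (2 ^+ q)); last first.
      have h3 := @three_le_pow R q q0.
      by rewrite lerXn2r ?nnegrE//; apply: le_trans h3; rewrite ler_nat.
    apply: le_trans pw; rewrite -exprM mulnC exprD.
    apply: ler_pM; rewrite ?exprn_ge0 ?ler0n//.
      by rewrite lerXn2r ?nnegrE ?addr_ge0 ?ler0n// lerDr.
    rewrite -[1 in leRHS]/(1%:R) -natrD -natrX ler_nat.
    by rewrite !expnS expn0; move: (q); clear; nia.
  apply: (@growth_le _ _ q.+1 _ (2 ^+ q)); last exact: far_growth.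
    by apply: Nlarge; rewrite expnS expn1; move: (q); clear; nia.
  apply: le_trans pw; apply: (@le_trans _ _ ((1 + q%:R) ^+ A)).
    by rewrite lerXn2r ?nnegrE ?addr_ge0 ?ler0n// lerDr.
  by rewrite ler_weXn2l ?lerDl ?ler0n// mul2n -addnn -addnA leq_addr.
exists q => // z hz.
have Iz : 0 < complex.Im z by apply: lt_le_trans hz; rewrite invr_gt0 exprn_gt0.
have Vc (f : nat -> int) j : `|V (f j)| <= c0 by exact: phic.
have [h|h] := leP q%:R^-1 (complex.Im z).
  by split; apply: easy; [exact: (Vc (fun j => j.+1%:Z))|left|
    exact: (Vc (fun j => - j.+1%:Z))|left].
have [h'|h'] := leP (c0 + 3) (normc z).
  by split; apply: easy; [exact: (Vc (fun j => j.+1%:Z))|right|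
    exact: (Vc (fun j => - j.+1%:Z))|right].
have Rz : `|complex.Re z| <= c0 + 3 by apply: le_trans (normc_Re _) (ltW h').
have Ig : 0 <= complex.Im z <= q%:R `^ (- g).
  rewrite (ltW Iz) (le_trans (ltW h))// -powR_inv1 ?(ltW qR)//.
  by apply: ler_powR => //; rewrite lerN2.
have X8 : 8 * (q%:R ^+ A) ^+ 2 < q%:R ^+ (2 * A + 2) :> R.
  rewrite exprD mulnC exprM mulrC ltr_pM2l ?exprn_gt0// -natrX ltr_nat.
  by rewrite expnS expn1; move: (q) q3; clear; nia.
have kN : (q ^ e0 + k.+1 < q ^ (e0 + 3))%N.
  have a0 : (0 < q ^ e0)%N by rewrite expn_gt0 q0.
  apply: (@leq_ltn_trans (q ^ e0 + q.+1)); first by rewrite leq_add2l ltnS.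
  rewrite expnD; apply: (@leq_trans (q ^ e0 * (q + 3))).
    by move: (q ^ e0)%N a0; clear; nia.
  rewrite leq_mul2l; apply/orP; right; apply: (@leq_trans (q * 3)).
    by move: q3; clear; lia.
  by rewrite expnS leq_mul2l; apply/orP; right; move: q3; rewrite expnS expn1; clear; nia.
split.
  have [n nN hn] := hq (orb al t 1) z Rz Ig.
  apply: (@right_growth _ n k _ _ qA1); last exact: lt_le_trans hn.
  by apply: leq_ltn_trans kN; rewrite leq_add.
have [n nN hn] := hq (t.1 - (q ^ e0 + k.+1)%:R * al.1,
  t.2 - (q ^ e0 + k.+1)%:R * al.2) z Rz Ig.
by apply: (left_growth qA1 nN kN); apply: lt_le_trans hn.
Qed.

End Assembly.

Theorem theorem1p8 (R : realType) (alpha : R * R)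
    (halpha : rationally_independent alpha)
    (phi : torus R -> R) (hphi : piecewise_holder phi)
    (hcont : continuous (fun E : R => lyapunov alpha phi E%:C%C))
    (hpos : forall E : R, 0 < lyapunov alpha phi E%:C%C)
    (hWDC : (\bigcup_(tau in [set tau : R | 1 < tau]) WDC tau) alpha) :
  forall (theta : torus R) (p : R), 0 < p -> beta_lower alpha phi theta p = 0%E.
Proof.
move=> theta p p0; have [tau _ wdc] := hWDC.
have [c0 [g [C1 [CD [c00 g0 C10 phic geo]]]]] := piecewise_holder_scale hphi.
have [e hits] := hitting halpha wdc.
have dense := hitting_dense halpha wdc.
pose g' := Num.min g 1.
have g'01 : 0 < g' <= 1 by rewrite /g' lt_min g0 ltr01 ge_min lexx orbT.
have [g'0 g'1] := andP g'01.
have geo' (q : nat) : (1 < q)%N ->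
    exists2 cs : seq (R * R), (size cs <= CD * q)%N &
    forall x y : R * R, `|x.1 - y.1| <= q%:R^-1 -> `|x.2 - y.2| <= q%:R^-1 ->
      (forall c (m n : int), c \in cs ->
        `|x.1 - c.1 - m%:~R| <= 2 / q%:R -> `|x.2 - c.2 - n%:~R| <= 2 / q%:R ->
        False) ->
      `|phi (toT x) - phi (toT y)| <= C1 * q%:R `^ (- g').
  move=> q1; have [cs scs hcs] := geo q q1; exists cs => // x y h1 h2 far.
  apply: le_trans (hcs x y h1 h2 far) _; rewrite ler_wpM2l//.
  by apply: ler_powR; [rewrite ler1n ltnW|rewrite lerN2 /g' ge_min lexx].
have [t tE] := toT_surj theta; rewrite -tE.
apply: (@beta_zero _ _ _ _ c0 _ (e + 3)) => //.
apply: (scale_growth phic t g'01).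
exact: (cocycle_growth phic g'0 C10 geo' dense hcont hpos g'1 hits).
Qed.
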